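(* Let $\Gamma>0$, let $\lambda_-^*\le\lambda_+^*$ be real, and let $q\in M_1([\lambda_-^*,\lambda_+^*])$. (a) In case $q_\pm=\lambda_\pm^*$, the good rate function $I^H_q$ is $$I^H_q(m;\lambda^*_\pm,\Gamma)=\tfrac12\big[\log|B|+\mathbf L(\psi)-\mathbf L(\theta)\big].$$ Here $t\ge0$, $\theta\ge\lambda_+^*$, $B$ and $\psi$ are such that $$\text{(i)}\quad B-1=(\theta-\psi)\mathbf G(\psi)+Bt,$$ $$\text{(ii)}\quad B(2m-\theta)=\Gamma\mathbf G(\psi)+\frac{B\Gamma t}{\theta-\psi^*},\ \text{ with } t=0\text{ whenever }\psi\ne\psi^*,$$ $$\text{(iii)}\quad B(\psi-\theta)\ \ge\ \Gamma\mathbf G(\theta)-\Gamma\mathbf G(\psi)-\frac{B\Gamma t}{\theta-\psi^*},\ \text{ with equality whenever }\theta>\lambda_+^*,$$ with $m>\overline m$ requiring $B>0$ and $\theta>\psi\ge\psi^*=\lambda_+^*$, while for $m<\overline m$ we consider either $B>0$ and $\psi>\theta$, or $B<0$ and $\psi\le\psi^*=\lambda_-^*$. (b) For any $q\in M_1([\lambda_-^*,\lambda_+^*])$, the good rate function $I^G_q$ is $$I^G_q(m;\lambda^*_\pm,\Gamma)=\tfrac12\big[(\theta-\psi)\mathbf G(\psi)+t+\mathbf L(\psi)-\mathbf L(\theta)\big],$$ with $B=1$ and $\theta,\psi\ge\psi^*=\lambda_+^*$, $t\ge0$, determined by (ii) and (iii).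
   Context: $M_+(J)$ and $M_1(J)$ are the finite Borel measures, respectively the Borel probability measures, on $J\subseteq\mathbb R$. Write $q_+=\max\,\mathrm{supp}(q)$ and $q_-=\min\,\mathrm{supp}(q)$. For $\xi\in\mathbb R$ and $\nu\in M_+((-\infty,\xi])$, $$F(\xi,\nu;\Gamma)=\tfrac12\inf_{\theta>\xi}\Big[\theta+\Gamma\int\frac{\nu(dx)}{\theta-x}\Big].$$ For a probability measure $\mu$ and a finite measure $\nu$, $H(\mu|\nu)=\int d\mu\,\log\frac{d\mu}{d\nu}+\nu(\mathbb R)-1$ if $\mu\ll\nu$, and $H(\mu|\nu)=\infty$ otherwise. The rate functions are $$I^H_q(m;\lambda^*_\pm,\Gamma)=\inf\{\tfrac12H(q|\nu):\nu\in M_1([\lambda_-^*,\lambda_+^*]),\ m=F(\lambda_+^*,\nu;\Gamma)\},$$ $$I^G_q(m;\lambda^*_\pm,\Gamma)=\inf\{\tfrac12H(q|\nu):\nu\in M_+([\lambda_-^*,\lambda_+^*]),\ m=F(\lambda_+^*,\nu;\Gamma)\},$$ and $\overline m=F(\lambda_+^*,q;\Gamma)$. These are the good rate functions of the large deviation principles at speed $n$ for $\sup_{x\in S^{n-1}}\big(\frac12\sum_i\lambda_ix_i^2+\sum_ih_ix_i\big)$, where $S^{n-1}$ is the unit sphere of $\mathbb R^n$, $\lambda_1(n)\ge\dots\ge\lambda_n(n)$ satisfy $\frac1n\sum_j\delta_{\lambda_j}\to q$ weakly, $\lambda_1(n)\to\lambda_+^*$, $\lambda_n(n)\to\lambda_-^*$,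 and the random vector $h$ is uniform on $\sqrt\Gamma S^{n-1}$ (for $I^H_q$), or centered Gaussian with covariance $\frac{\Gamma}{n}\mathbf I_n$ (for $I^G_q$). For $\xi\notin(\lambda_-^*,\lambda_+^* )$, the logarithmic potential and the Stieltjes transform of $q$ are $$\mathbf L(\xi)=\int\log|\xi-x|\,q(dx),\qquad \mathbf G(\xi)=\mathbf L'(\xi)=\int(\xi-x)^{-1}q(dx).$$
   Formalization: In (a), where the multiplier B would be 0 and no B≠0, ψ solve (i)–(iii), the limit B→0, |ψ|→∞, B(ψ−θ)→β is used; m=m̄ takes ψ=θ. In (b), θ=ψ is allowed only at m=m̄, as otherwise (ii),(iii) admit the false value 0. Parameters exist wherever the rate is finite. *)

(* Defs.v *)
From HB Require Import structures.
From mathcomp Require Import all_boot all_order all_algebra.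
From mathcomp Require Import all_classical all_reals all_analysis.

Set Implicit Arguments.
Unset Strict Implicit.
Unset Printing Implicit Defensive.

Import Order.TTheory GRing.Theory Num.Theory.
Import numFieldNormedType.Exports.

Local Open Scope classical_set_scope.
Local Open Scope ring_scope.

(* M_1(J), resp. M_+(J), is rendered by Borel probability, resp. finite,
   measures on R that give no mass to the complement of J. *)
Definition carried_by (R : realType) (a b : R)
    (nu : set (measurableTypeR R) -> \bar R) : Prop :=
  nu (~` `[a, b]%classic) = 0%E.

Definition msupp (R : realType) (q : set (measurableTypeR R) -> \bar R) : set R :=
  [set x : R | forall e : R, 0 < e -> (0%:E < q `](x - e)%R, (x + e)%R[%classic)%E].

(* The support of a compactly supported probability measure is nonempty and
   compact, so that sup and inf are max and min. *)
Definition qplus (R : realType) (q : set (measurableTypeR R) -> \bar R) : R :=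
  sup (msupp q).
Definition qminus (R : realType) (q : set (measurableTypeR R) -> \bar R) : R :=
  inf (msupp q).

Local Open Scope ereal_scope.

Definition Ffun (R : realType) (G : R) (xi : R)
    (nu : set (measurableTypeR R) -> \bar R) : \bar R :=
  (2^-1)%:E * ereal_inf
    [set th%:E + G%:E * \int[nu]_x ((th - x)^-1)%:E | th in `]xi, +oo[%classic].

(* The negative part of the integrand is mu-integrable because nu is finite,
   so the integral is never of the form +oo - oo. *)
Definition Hent (R : realType) (mu : probability (measurableTypeR R) R)
    (nu : {finite_measure set (measurableTypeR R) -> \bar R}) : \bar R :=
  if `[< mu `<< nu >] then
    \int[mu]_x lne (Radon_Nikodym (charge_of_finite_measure mu) nu x)
      + nu setT - 1
  else +oo.

Definition rateH (R : realType) (G lm lp : R)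
    (q : probability (measurableTypeR R) R) (m : R) : \bar R :=
  ereal_inf [set (2^-1)%:E * Hent q nu | nu in
    [set nu : probability (measurableTypeR R) R |
      carried_by lm lp nu /\ m%:E = Ffun G lp nu]].

Definition rateG (R : realType) (G lm lp : R)
    (q : probability (measurableTypeR R) R) (m : R) : \bar R :=
  ereal_inf [set (2^-1)%:E * Hent q nu | nu in
    [set nu : {finite_measure set (measurableTypeR R) -> \bar R} |
      carried_by lm lp nu /\ m%:E = Ffun G lp nu]].

Definition mbar (R : realType) (G lp : R)
    (q : probability (measurableTypeR R) R) : \bar R := Ffun G lp q.

(* lne 0 = -oo, so an atom of q at xi gives Lpot q xi = -oo. *)
Definition Lpot (R : realType) (q : probability (measurableTypeR R) R)
    (xi : R) : \bar R :=
  \int[q]_x lne (`|xi - x|%R)%:E.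

(* Only used outside (lm, lp).  In \bar R, 0^-1 = +oo; the two branches make
   the Stieltjes transform at an endpoint its one-sided limit from outside the
   interval, possibly +oo at lp and -oo at lm. *)
Definition Stieltjes (R : realType) (lp : R)
    (q : probability (measurableTypeR R) R) (xi : R) : \bar R :=
  if (lp <= xi)%R then \int[q]_x ((xi - x)%R%:E)^-1
  else - \int[q]_x ((x - xi)%R%:E)^-1.

(* B Gamma t / (th - psis), equal to 0 if t = 0 and infinite if t <> 0 and
   th = psis (0 * +oo = 0 in \bar R). *)
Definition tterm (R : realType) (G B t th psis : R) : \bar R :=
  (B * G * t)%R%:E * ((th - psis)%R%:E)^-1.

Definition eq_i (R : realType) (lp : R)
    (q : probability (measurableTypeR R) R) (B t th psi : R) : Prop :=
  (B - 1)%R%:E = (th - psi)%R%:E * Stieltjes lp q psi + (B * t)%R%:E.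

Definition eq_ii (R : realType) (G lp : R)
    (q : probability (measurableTypeR R) R) (m B t th psi psis : R) : Prop :=
  (B * (2 * m - th))%R%:E = G%:E * Stieltjes lp q psi + tterm G B t th psis
  /\ (psi <> psis -> t = 0%R).

Definition ineq_iii (R : realType) (G lp : R)
    (q : probability (measurableTypeR R) R) (B t th psi psis : R) : Prop :=
  let rhs := G%:E * Stieltjes lp q th - G%:E * Stieltjes lp q psi
             - tterm G B t th psis in
  rhs <= (B * (psi - th))%R%:E
  /\ ((lp < th)%R -> (B * (psi - th))%R%:E = rhs).

(* The third case, m = mbar, is the common boundary of the first two; there
   the optimal nu is q itself. *)
Definition branchH (R : realType) (G lm lp : R)
    (q : probability (measurableTypeR R) R) (m B th psi psis : R) : Prop :=
  [\/ mbar G lp q < m%:E /\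
        [/\ (0 < B)%R, psis = lp, (psis <= psi)%R & (psi < th)%R],
      m%:E < mbar G lp q /\
        ([/\ (0 < B)%R, psis = lp & (th < psi)%R] \/
         [/\ (B < 0)%R, psis = lm & (psi <= psis)%R])
    | m%:E = mbar G lp q /\ [/\ (0 < B)%R, psis = lp & psi = th]].

Definition solH (R : realType) (G lm lp : R)
    (q : probability (measurableTypeR R) R) (m B t th psi psis : R) : Prop :=
  [/\ (0 <= t)%R /\ (lp <= th)%R,
      eq_i lp q B t th psi,
      eq_ii G lp q m B t th psi psis,
      ineq_iii G lp q B t th psi psis
    & branchH G lm lp q m B th psi psis].

Definition valH (R : realType) (q : probability (measurableTypeR R) R)
    (B th psi : R) : \bar R :=
  (2^-1)%:E * ((ln `|B|)%R%:E + Lpot q psi - Lpot q th).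

(* The limit of solH as B -> 0 and |psi| -> +oo with B * (psi - th) -> be,
   which separates the branches B > 0 and B < 0 in m < mbar.  Then (i) gives
   be = \int (th - x) q(dx), while psi * Stieltjes(psi) -> 1 turns (ii), after
   multiplication by psi, into the second equation; log |B| + L(psi)
   tends to log be.  The corresponding optimizer is ((th - x) / be) q(dx). *)
Definition solH_lim (R : realType) (G lp : R)
    (q : probability (measurableTypeR R) R) (m be th : R) : Prop :=
  [/\ m%:E < mbar G lp q /\ (lp <= th)%R,
      be%:E = \int[q]_x (th - x)%R%:E,
      (be * (2 * m - th))%R = G,
      G%:E * Stieltjes lp q th <= be%:E
    & (lp < th)%R -> be%:E = G%:E * Stieltjes lp q th].

Definition valH_lim (R : realType) (q : probability (measurableTypeR R) R)
    (be th : R) : \bar R :=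
  (2^-1)%:E * ((ln be)%:E - Lpot q th).

(* For th = psi, (iii) degenerates to 0 >= 0 and carries no information; as in
   the case of unit total mass, this is only allowed for m = mbar. *)
Definition solG (R : realType) (G lp : R)
    (q : probability (measurableTypeR R) R) (m t th psi : R) : Prop :=
  [/\ [/\ (0 <= t)%R, (lp <= th)%R & (lp <= psi)%R],
      eq_ii G lp q m 1 t th psi lp,
      ineq_iii G lp q 1 t th psi lp
    & m%:E <> mbar G lp q -> th <> psi].

Definition valG (R : realType) (lp : R) (q : probability (measurableTypeR R) R)
    (t th psi : R) : \bar R :=
  (2^-1)%:E * ((th - psi)%R%:E * Stieltjes lp q psi + t%:E
                + Lpot q psi - Lpot q th).

(* Main.v *)
(* Integrating ln z <= z - 1 at z = phi / (dq/dnu) gives, for every phi > 0,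
   H(q|nu) >= \int ln phi dq - \int phi dnu + nu(R).  For
   phi(x) = B + beta / (theta - x) with beta = B (psi - theta), the right-hand
   side depends on nu only through its mass and \int nu(dx) / (theta - x), and the
   latter is controlled by m = F(lambda_+, nu).  Equality holds for
   nu = q / phi + t delta_{psi^*}: equations (i) and (ii) give this nu the right
   mass and the right value of F, and (iii) makes theta the minimizer in F.

   Existence of a solution:
   - m = mbar: take psi = theta, the minimizer of theta + Gamma G(theta).
   - m > mbar: maximize L(psi) - L(theta) + Phi((theta - psi)(2m - theta) / Gamma),
     with Phi(y) = y for the Gaussian and Phi(y) = - ln (1 - y) for the spherical
     field; the first-order conditions are (i)-(iii).
   - m < mbar: equality in (iii) expresses B and psi through theta, and the
     remaining equation is solved by the intermediate value theorem; if it has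
     no solution, either theta sticks at lambda_+ or the missing mass t sits at
     lambda_-. *)
Require Import Defs.
From HB Require Import structures.
From mathcomp Require Import all_boot all_order all_algebra.
From mathcomp Require Import all_classical all_reals all_analysis.
From mathcomp Require Import measurable_realfun ring lra.

Import Order.TTheory GRing.Theory Num.Theory.
Import numFieldNormedType.Exports.

Local Open Scope classical_set_scope.
Local Open Scope ring_scope.

Set Implicit Arguments.
Unset Strict Implicit.
Unset Printing Implicit Defensive.

Lemma ln_sub_le (R : realType) (y z : R) : 0 < y -> 0 < z ->
  ln z - ln y <= (z - y) / y.
Proof.
move=> y0 z0; rewrite -ln_div ?posrE//.
have := @le_ln1Dx R (z / y - 1).
rewrite (_ : 1 + (z / y - 1) = z / y); last by ring.
rewrite (_ : (z - y) / y = z / y - 1); last by field; rewrite gt_eqF.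
by apply; rewrite ltrBrDr addNr divr_gt0.
Qed.

Section real_functions.
Variable R : realType.

Lemma near_ball (P : R -> Prop) (a : R) : (\forall b \near a, P b) ->
  exists2 e, 0 < e & forall b, `|b - a| < e -> P b.
Proof.
move=> /nbhs_ballP[e /= e0 h]; exists e => // b ba; apply: h.
by rewrite /ball/= distrC.
Qed.

Lemma continuous_maxr (a : R) : continuous (fun b => Num.max a b).
Proof.
move=> b; apply: (@continuous_max R R (fun=> a) id b); [exact: cvg_cst|exact: cvg_id].
Qed.

Lemma right_limit_le (f : R -> R) (a b c : R) : {for a, continuous f} -> a < b ->
  (forall x, a < x -> x < b -> f x <= c) -> f a <= c.
Proof.
move=> cf ab h; rewrite leNgt; apply/negP => fa.
have := cvgr_gt _ cf c => /(_ _ fa)/near_ball[e e0 he].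
pose x := a + Num.min e (b - a) / 2.
have m0 : 0 < Num.min e (b - a) by rewrite lt_min e0 subr_gt0.
have me : Num.min e (b - a) <= e by rewrite ge_min lexx.
have mb : Num.min e (b - a) <= b - a by rewrite ge_min lexx orbT.
have := he x; rewrite /x addrAC subrr add0r gtr0_norm ?divr_gt0// => /(_ ltac:(lra)).
by rewrite ltNge => /negP; apply; apply: h; lra.
Qed.

Lemma left_limit_ge (f : R -> R) (a b c : R) : {for a, continuous f} -> b < a ->
  (forall x, b < x -> x < a -> c <= f x) -> c <= f a.
Proof.
move=> cf ab h; rewrite leNgt; apply/negP => fa.
have := cvgr_lt _ cf c => /(_ _ fa)/near_ball[e e0 he].
pose x := a - Num.min e (a - b) / 2.
have m0 : 0 < Num.min e (a - b) by rewrite lt_min e0 subr_gt0.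
have me : Num.min e (a - b) <= e by rewrite ge_min lexx.
have mb : Num.min e (a - b) <= a - b by rewrite ge_min lexx orbT.
have := he x; rewrite /x addrAC subrr add0r normrN gtr0_norm ?divr_gt0// => /(_ ltac:(lra)).
by rewrite ltNge => /negP; apply; apply: h; lra.
Qed.

Lemma IVT_antitone (f : R -> R) (a b c : R) : a <= b -> continuous f ->
  f b <= c -> c <= f a -> exists2 x, a <= x <= b & f x = c.
Proof.
move=> ab cf fb fa; have [|x] := @IVT R f a b c ab (continuous_subspaceT cf).
  by rewrite ge_min le_max fb fa orbT.
by rewrite in_itv/= => xab fx; exists x.
Qed.

Lemma last_root (f : R -> R) (a b : R) : continuous f -> a <= b -> f a <= 0 -> 0 < f b ->
  exists c, [/\ a <= c, c < b, f c = 0 & forall x, c < x <= b -> 0 < f x].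
Proof.
move=> cf ab fa fb.
pose S := [set x | a <= x <= b /\ f x <= 0].
have Sa : S a by split => //; rewrite lexx.
have Sb : ubound S b by move=> x [/andP[]].
have hS : has_sup S by split; [exists a|exists b].
pose c := sup S.
have ac : a <= c by exact: sup_upper_bound.
have cb : c <= b by apply: ge_sup => //; exists a.
have fc : f c <= 0.
  rewrite leNgt; apply/negP => h.
  have [e e0 he] := near_ball (cvgr_gt _ (cf c) 0 h).
  have [x Sx xc] := sup_adherent e0 hS.
  have xc' : x <= c by exact: sup_upper_bound.
  rewrite -/c in xc.
  have := he x; rewrite ltr_norml; move: Sx => [_ fx].
  by move=> /(_ ltac:(apply/andP; split; lra)); rewrite ltNge fx.
have cb' : c < b.
  by rewrite lt_neqAle cb andbT; apply/eqP => cbE; move: fc; rewrite cbE leNgt fb.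
have pos x : c < x <= b -> 0 < f x.
  move=> /andP[cx xb]; rewrite ltNge; apply/negP => fx.
  have : x <= c by apply: sup_upper_bound => //; split => //; rewrite xb (le_trans ac (ltW cx)).
  by rewrite leNgt cx.
exists c; split => //; apply/le_anti; rewrite fc leNgt; apply/negP => fc0.
have cN : continuous (fun x => - f x) by move=> x; apply: cvgN; exact: cf.
have h1 : - f b <= 0 by rewrite oppr_le0 ltW.
have h2 : 0 <= - f c by rewrite oppr_ge0 ltW.
have [x /andP[cx xb] /eqP] := IVT_antitone (ltW cb') cN h1 h2.
rewrite oppr_eq0 => /eqP fx; have cx' : c < x.
  by rewrite lt_neqAle cx andbT; apply/eqP => cxE; move: fc0; rewrite cxE fx ltxx.
by have := pos x; rewrite cx' xb fx ltxx => /(_ isT).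
Qed.

End real_functions.

Section measure_facts.
Context d (T : measurableType d) (R : realType).
Local Open Scope ereal_scope.

Lemma measurable_lne (D : set (\bar R)) : measurable_fun D (@lne R).
Proof.
move=> mD; apply: (measurability _ (ErealGenOInfty.measurableE R)) => //.
move=> _ [_ [y ->] <-]; apply: measurableI => //.
rewrite (_ : _ @^-1` _ = `]expeR y%:E, +oo[%classic); first exact: emeasurable_itv.
apply/seteqP; split => x /=; rewrite 2!in_itv/= !andbT.
  case: x => [r|//=|//=]; last by rewrite !ltry.
  have [r0|r0] := leP r 0%R; first by rewrite le0_lneNy// ltNge leNye.
  rewrite lne_EFin// !lte_fin => yr; rewrite -(@lnK _ r) ?posrE// ltr_expR.
  by [].
case: x => [r|_|//]; last by rewrite ltry.
rewrite !lte_fin => yr.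
have r0 : (0 < r)%R by exact: lt_trans (expR_gt0 _) yr.
by rewrite lne_EFin// lte_fin -ltr_expR lnK ?posrE.
Qed.

Lemma le_integral_measurable (mu : {measure set T -> \bar R}) (D : set T)
    (f g : T -> \bar R) :
  measurable D -> measurable_fun D f -> measurable_fun D g ->
  (forall x, D x -> f x <= g x) ->
  \int[mu]_(x in D) f x <= \int[mu]_(x in D) g x.
Proof.
move=> mD mf mg fg; rewrite integralE [leRHS]integralE leeB//.
- apply: ge0_le_integral => //; [exact: measurable_funepos..|].
  by move=> x Dx; apply: (@funepos_le _ _ D) => //; [move=> y /set_mem/fg|rewrite inE].
- apply: ge0_le_integral => //; [exact: measurable_funeneg..|].
  by move=> x Dx; apply: (@funeneg_le _ _ D) => //; [move=> y /set_mem/fg|rewrite inE].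
Qed.

Lemma integral_setD_null (mu : {measure set T -> \bar R}) (A D : set T)
    (f : T -> \bar R) :
  measurable A -> measurable D -> D `<=` A -> mu (A `\` D) = 0 ->
  measurable_fun A f ->
  \int[mu]_(x in A) f x = \int[mu]_(x in D) f x.
Proof.
move=> mA mD DA AD0 mf.
rewrite -[in RHS](setIidr DA) integral_mkcondr.
have mAD : measurable (A `\` D) by exact: measurableD.
apply: ae_eq_integral => //.
  apply/(measurable_restrict f mD mA).
  by apply: measurable_funS mf => //; rewrite setIC; exact: subIsetl.
exists (A `\` D); split => // x /= /not_implyP[Ax nfx]; split => // Dx.
by apply: nfx; rewrite patchE mem_set.
Qed.

End measure_facts.

Lemma measurable_funV_gt0 d (T : measurableType d) (R : realType) (D : set T)
    (f : T -> R) : measurable D -> measurable_fun D f ->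
  (forall x, D x -> 0 < f x) -> measurable_fun D (fun x => (f x)^-1).
Proof.
move=> mD mf f0; apply: (eq_measurable_fun (fun x => expR (- ln (f x)))).
  by move=> x /set_mem/f0 fx0; rewrite expRN lnK.
apply: (measurableT_comp (@measurable_expR R)); apply: measurable_funN.
exact: measurableT_comp.
Qed.
Lemma probability_full d (T : measurableType d) (R : realType)
    (q : probability T R) (A : set T) :
  measurable A -> (q (~` A) = 0 -> q A = 1)%E.
Proof.
move=> mA qA; rewrite -(@probability_setT _ _ _ q) -(setUv A) measureU0//.
exact: measurableC.
Qed.

(** * Relative entropy *)

Section entropy.
Context (R : realType).
Local Notation T := (measurableTypeR R).
Local Open Scope ereal_scope.
Variables (q : probability T R) (nu : {finite_measure set T -> \bar R}).

Lemma Hent_ae (r : T -> \bar R) : q `<< nu -> measurable_fun [set: T] r ->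
  ae_eq nu setT (Radon_Nikodym (charge_of_finite_measure q) nu) r ->
  Hent q nu = \int[q]_x lne (r x) + nu setT - 1.
Proof.
move=> qnu mr rE; rewrite /Hent asboolT//; congr (_ + _ - _).
apply: ae_eq_integral => //.
- by apply: (measurableT_comp (@measurable_lne R setT)).
- by apply: (measurableT_comp (@measurable_lne R setT)).
have := null_dominates_ae_eq measurableT qnu rE.
by apply: filterS => x /= + xT => -> .
Qed.

Lemma Hent_density (f : T -> R) : measurable_fun [set: T] f ->
  (forall x, 0 <= f x)%R ->
  (forall A, measurable A -> q A = \int[nu]_(x in A) (f x)%:E) ->
  Hent q nu = \int[q]_x lne (f x)%:E + nu setT - 1.
Proof.
move=> mf f0 qf.
have mEf : measurable_fun [set: T] (EFin \o f) by exact/measurable_EFinP.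
have qnu : q `<< nu.
  apply/null_content_dominatesP => A mA nuA; rewrite [LHS]qf//.
  by apply: null_set_integral => //; exact: measurable_funTS.
apply: Hent_ae => //; apply: integral_ae_eq => //.
  exact: Radon_Nikodym_integrable.
by move=> A _ mA; rewrite -Radon_Nikodym_integral//= qf.
Qed.

Lemma Hent_lower (D : set T) (phi : T -> R) (c : R) :
  measurable D -> q (~` D) = 0 ->
  measurable_fun D phi -> (forall x, D x -> 0 < phi x)%R ->
  q.-integrable D (fun x => (ln (phi x))%:E) ->
  \int[nu]_(x in D) (phi x)%:E <= c%:E ->
  (\int[q]_(x in D) ln (phi x) - c)%R%:E + nu setT <= Hent q nu.
Proof.
move=> mD qD mphi phi0 iphi cphi.
have [qnu|qnu] := pselect (q `<< nu); last by rewrite /Hent asboolF// leey.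
pose r := Radon_Nikodym_SigmaFinite.f q nu.
have r_fin x : r x \is a fin_num by exact: Radon_Nikodym_SigmaFinite.f_fin_num.
have r_ge0 x : 0 <= r x by exact: Radon_Nikodym_SigmaFinite.f_ge0.
have mr : measurable_fun [set: T] r.
  exact: measurable_int (Radon_Nikodym_SigmaFinite.f_integrable qnu).
rewrite (@Hent_ae r)//; last first.
  exact/ae_eq_sym/ae_eq_Radon_Nikodym_SigmaFinite.
pose D1 := D `&` [set x | 0 < r x].
have mr0 : measurable [set x | 0 < r x].
  rewrite -[X in measurable X]setTI.
  exact: emeasurable_fun_o_infty.
have mD1 : measurable D1 by exact: measurableI.
have D1D : D1 `<=` D by exact: subIsetl.
have qr0 : q [set x | r x <= 0] = 0.
  have mr1 : measurable [set x | r x <= 0].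
    rewrite -[X in measurable X]setTI; exact: emeasurable_fun_infty_c.
  rewrite (Radon_Nikodym_SigmaFinite.f_integral qnu)// -/r.
  under eq_integral.
    move=> x /set_mem/= rx; have -> : r x = 0 by apply/le_anti; rewrite rx r_ge0.
    over.
  exact: integral0.
have qD1 : q (~` D1) = 0.
  have e : ~` [set x | 0 < r x] = [set x | r x <= 0].
    by apply/seteqP; split => x /=; rewrite leNgt => /negP.
  rewrite setCI e measureU0//; first exact: measurableC.
  by rewrite -e; exact: measurableC.
rewrite (@integral_setD_null _ _ _ _ setT D1)//; [|by rewrite setTD|]; last first.
  by apply: (measurableT_comp (@measurable_lne R setT)).
pose rr x := fine (r x).
have rr0 x : D1 x -> (0 < rr x)%R.
  by move=> [_ /= rx]; rewrite /rr fine_gt0// rx ltey_eq r_fin.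
have mrr : measurable_fun D1 rr by apply: measurable_funTS; exact: measurableT_comp.
pose w x := (phi x * (rr x)^-1)%R.
have mw : measurable_fun D1 w.
  apply: measurable_funM; first exact: measurable_funS mphi.
  exact: measurable_funV_gt0.
have w0 x : D1 x -> (0 < w x)%R.
  by move=> D1x; rewrite mulr_gt0 ?invr_gt0 ?rr0 ?phi0//; case: D1x.
have intw : \int[q]_(x in D1) (w x)%:E <= c%:E.
  rewrite (eq_integral (fun x => `|w x|%:E)); last first.
    by move=> x /set_mem/w0 wx; rewrite gtr0_norm.
  rewrite -(Radon_Nikodym_SigmaFinite.change_of_variables qnu)//; last first.
    by apply/measurable_EFinP; exact: measurableT_comp.
  apply: le_trans cphi.
  rewrite (eq_integral (fun x => (phi x)%:E)); last first.
    move=> x /set_mem D1x; rewrite -/r -(fineK (r_fin x)) -/(rr x) -EFinM.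
    by rewrite gtr0_norm ?w0// /w -mulrA mulVf ?mulr1// gt_eqF// rr0.
  apply: ge0_subset_integral => //; first exact/measurable_EFinP.
  by move=> x Dx; rewrite lee_fin ltW// phi0.
have iw : q.-integrable D1 (EFin \o w).
  apply/integrableP; split; first exact/measurable_EFinP.
  rewrite (eq_integral (EFin \o w)).
    by rewrite (le_lt_trans intw)// ltry.
  by move=> x /set_mem/w0 wx /=; rewrite gtr0_norm.
have iphi1 : q.-integrable D1 (fun x => (ln (phi x))%:E).
  exact: integrableS iphi.
have ic : q.-integrable D1 (EFin \o cst 1%R).
  exact: finite_measure_integrable_cst.
have key : (\int[q]_(x in D) ln (phi x) + 1 - c)%R%:E <= \int[q]_(x in D1) lne (r x).
  apply: (@le_trans _ _ (\int[q]_(x in D1) (ln (phi x) + 1 - w x)%:E)).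
    under eq_integral do rewrite EFinB EFinD.
    rewrite integralB//; last exact: integrableD.
    rewrite integralD// -(@integral_setD_null _ _ _ _ D D1)//; last 2 first.
      apply: (subset_measure0 _ _ _ qD1); [exact: measurableD|exact: measurableC|].
      by move=> x [].
      exact: measurable_int iphi.
    have -> : \int[q]_(x in D1) 1%:E = 1.
      rewrite (integral_cst q mD1 1) mul1e.
      exact: probability_full.
    rewrite EFinB EFinD /Rintegral fineK; last exact: integrable_fin_num.
    by rewrite leeD2l// leeN2.
  apply: le_integral_measurable => //.
  - apply/measurable_EFinP; apply: measurable_funB => //.
    apply: measurable_funD => //; apply: measurableT_comp => //.
    exact: measurable_funS mphi.
  - apply: measurable_funTS.
    by apply: (measurableT_comp (@measurable_lne R setT)).
  move=> x D1x; have rx := rr0 _ D1x; have phix := phi0 _ (D1D _ D1x).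
  rewrite -(fineK (r_fin x)) -/(rr x) lne_EFin// lee_fin lerBlDr.
  by have := ln_sub_le rx phix; rewrite mulrBl mulfV ?gt_eqF// -/(w x); lra.
have nufin : nu setT \is a fin_num by exact: fin_num_measure.
rewrite -(fineK nufin).
apply: (@le_trans _ _ ((\int[q]_(x in D) ln (phi x) + 1 - c)%R%:E + (fine (nu setT) - 1)%:E)).
  by rewrite -EFinD lee_fin; lra.
by rewrite -addeA -EFinB leeD2r.
Qed.

End entropy.

Lemma Hent_eq (R : realType) (q : probability (measurableTypeR R) R)
    (nu nu' : {finite_measure set (measurableTypeR R) -> \bar R}) :
  (forall A, nu A = nu' A) -> Hent q nu = Hent q nu'.
Proof.
move=> nuE.
have nuE' : (nu : set _ -> \bar R) = nu' by apply/funext.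
have [qnu|qnu] := pselect (q `<< nu); last first.
  by rewrite /Hent !asboolF// -nuE'.
have qnu' : q `<< nu' by rewrite -nuE'.
pose r := Radon_Nikodym (charge_of_finite_measure q) nu.
have mr : measurable_fun setT r.
  exact: measurable_int (Radon_Nikodym_integrable _).
rewrite (@Hent_ae _ q nu r)//; last exact: aeW.
rewrite (@Hent_ae _ q nu' r)// ?nuE//.
apply: integral_ae_eq => //; first exact: Radon_Nikodym_integrable.
move=> A _ mA; rewrite -Radon_Nikodym_integral//= (@eq_measure_integral _ _ _ _ nu)//.
  by rewrite -Radon_Nikodym_integral.
by move=> A0 _ _; exact: (esym (nuE A0)).
Qed.

Section tilted_measure.
Context d (T : measurableType d) (R : realType).
Local Open Scope ereal_scope.

Lemma density_measure_exists (mu : {measure set T -> \bar R}) (g : T -> \bar R) :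
  measurable_fun [set: T] g -> (forall x, 0 <= g x) ->
  exists m : {measure set T -> \bar R}, forall A, m A = \int[mu]_(x in A) g x.
Proof.
move=> mg g0; pose f A := \int[mu]_(x in A) g x.
have f0 : f set0 = 0 by rewrite /f integral_set0.
have fge0 A : 0 <= f A by exact: integral_ge0.
have fsum : semi_sigma_additive f by exact: semi_sigma_additive_nng_induced.
by exists (HB.pack_for {measure set T -> \bar R} f (isMeasure.Build _ _ _ f f0 fge0 fsum)).
Qed.

Lemma finite_measure_exists (mu : {measure set T -> \bar R}) :
  mu [set: T] < +oo ->
  exists m : {finite_measure set T -> \bar R}, forall A, m A = mu A.
Proof.
move=> muoo.
have mufin : fin_num_fun mu.
  move=> A mA; rewrite ge0_fin_numE//; apply: le_lt_trans muoo.
  by rewrite le_measure ?inE.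
pose f A := mu A.
pose m0 := isMeasure.Build _ _ _ f (measure0 mu) (measure_ge0 mu)
  (@measure_semi_sigma_additive _ _ _ mu).
pose m : {measure set T -> \bar R} := HB.pack_for {measure set T -> \bar R} f m0.
by exists (HB.pack_for {finite_measure set T -> \bar R} f m0
  (Measure_isFinite.Build _ _ _ m mufin)).
Qed.

Lemma probability_exists (mu : {measure set T -> \bar R}) :
  mu [set: T] = 1 -> exists p : probability T R, forall A, p A = mu A.
Proof.
move=> mu1.
pose f A := mu A.
pose m0 := isMeasure.Build _ _ _ f (measure0 mu) (measure_ge0 mu)
  (@measure_semi_sigma_additive _ _ _ mu).
pose m : {measure set T -> \bar R} := HB.pack_for {measure set T -> \bar R} f m0.
by exists (HB.pack_for (probability T R) f m0
  (Measure_isProbability.Build _ _ _ m mu1)).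
Qed.

Lemma integral_density (q m : {finite_measure set T -> \bar R}) (g : T -> R) :
  measurable_fun [set: T] g -> (forall x, 0 <= g x)%R ->
  (forall A, measurable A -> m A = \int[q]_(x in A) (g x)%:E) ->
  forall h : T -> \bar R, measurable_fun [set: T] h -> (forall x, 0 <= h x) ->
  \int[m]_x h x = \int[q]_x (h x * (g x)%:E).
Proof.
move=> mg g0 mE h mh h0.
have mEg : measurable_fun [set: T] (EFin \o g) by exact/measurable_EFinP.
have mq : m `<< q.
  apply/null_content_dominatesP => A mA qA; rewrite [LHS]mE//.
  by apply: null_set_integral => //; exact: measurable_funTS.
rewrite -(Radon_Nikodym_SigmaFinite.change_of_variables mq)//.
have mr := measurable_int _ (Radon_Nikodym_SigmaFinite.f_integrable mq).
apply: ae_eq_integral => //; [exact: emeasurable_funM..|].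
apply: ae_eqe_mul2l; apply: integral_ae_eq => //.
  exact: Radon_Nikodym_SigmaFinite.f_integrable.
by move=> A _ mA; rewrite -Radon_Nikodym_SigmaFinite.f_integral//= mE.
Qed.

Lemma tilted_measure_exists (q : probability T R) (D : set T) (w : T -> R)
    (t : R) (c : T) :
  measurable D -> q.-integrable D (EFin \o w) -> (forall x, D x -> 0 <= w x)%R ->
  (0 <= t)%R -> measurable [set c] ->
  exists m : {finite_measure set T -> \bar R},
    (forall A, measurable A ->
       m A = \int[q]_(x in A `&` D) (w x)%:E + t%:E * \d_c A) /\
    (forall h : T -> \bar R, measurable_fun [set: T] h -> (forall x, 0 <= h x) ->
       \int[m]_x h x = \int[q]_(x in D) (h x * (w x)%:E) + t%:E * h c).
Proof.
move=> mD iw w0 t0 mc; pose g := w \_ D.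
have mw : measurable_fun D w by apply/measurable_EFinP; exact: measurable_int iw.
have mg : measurable_fun [set: T] g by exact/(measurable_restrictT _ _).1.
have g0 x : (0 <= g x)%R by rewrite /g patchE; case: ifPn => // /set_mem/w0.
have mEg : measurable_fun [set: T] (EFin \o g) by exact/measurable_EFinP.
have gE x : (g x)%:E = ((EFin \o w) \_ D) x by rewrite /g !patchE; case: ifPn.
have [m1 m1E] := @density_measure_exists q (EFin \o g) mEg (fun x => g0 x).
have m1D A : measurable A -> m1 A = \int[q]_(x in A `&` D) (w x)%:E.
  move=> mA; rewrite m1E integral_mkcondr.
  by apply: eq_integral => x _; rewrite /= gE.
have m1oo : m1 [set: T] < +oo.
  by rewrite m1D// setTI; exact: integrable_lty.
have [m1' m1'E] := finite_measure_exists m1oo.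
pose tn := NngNum t0.
pose m2 : {measure set T -> \bar R} := mscale tn (@dirac _ T c R).
pose ma : {measure set T -> \bar R} := measure_add m1' m2.
have maE A : ma A = m1' A + m2 A by exact: measure_addE.
have madd : ma setT < +oo.
  rewrite maE lte_add_pinfty//; first by rewrite -ge0_fin_numE// fin_num_measure.
  by rewrite /m2/= /mscale/= diracT mule1 ltry.
have [m mE] := finite_measure_exists madd.
exists m; split.
  move=> A mA; by rewrite mE maE m1'E m1D.
move=> h mh h0.
rewrite (@eq_measure_integral _ _ _ _ ma); last by move=> A _ _; exact: mE.
rewrite ge0_integral_measure_add//; congr (_ + _).
  rewrite (@integral_density q m1' g)//; last by move=> A _; rewrite m1'E m1E.
  rewrite [RHS]integral_mkcond; apply: eq_integral => x _.
  by rewrite gE !patchE; case: ifPn => //; rewrite mule0.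
by rewrite /m2 ge0_integral_mscale//= integral_dirac// diracT mul1e.
Qed.

End tilted_measure.

Lemma measurable_invr (R : realType) : measurable_fun [set: R] (@GRing.inv R).
Proof.
apply: (eq_measurable_fun (fun x : R => x * expR (- ln (x ^+ 2)))).
  move=> x _; have [->|x0] := eqVneq x 0; first by rewrite mul0r invr0.
  have x2 : 0 < x ^+ 2 by rewrite exprn_even_gt0.
  by rewrite expRN lnK// expr2 invfM mulrA mulfV// mul1r.
apply: measurable_funM => //; apply: (measurableT_comp (@measurable_expR R)).
by apply: measurable_funN; apply: measurableT_comp.
Qed.

Section Rintegral_facts.
Context d (T : measurableType d) (R : realType).
Variables (mu : {finite_measure set T -> \bar R}) (D : set T).
Hypothesis mD : measurable D.
Local Notation intg f := (mu.-integrable D (EFin \o f)).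

Lemma integrable_cst_EFin (k : R) : intg (fun _ : T => k).
Proof. exact: finite_measure_integrable_cst. Qed.

Lemma integrableD_EFin (f g : T -> R) :
  intg f -> intg g -> intg (fun x => f x + g x).
Proof. by move=> fi gi; exact: (integrableD mD fi gi). Qed.

Lemma integrableB_EFin (f g : T -> R) :
  intg f -> intg g -> intg (fun x => f x - g x).
Proof. by move=> fi gi; exact: (integrableB mD fi gi). Qed.

Lemma integrableZl_EFin (k : R) (f : T -> R) : intg f -> intg (fun x => k * f x).
Proof. by move=> fi; exact: (integrableZl mD k fi). Qed.

Lemma integrable_bounded_by (f g : T -> R) : measurable_fun D f -> intg g ->
  (forall x, D x -> `|f x| <= g x) -> intg f.
Proof.
move=> mf ig fg; apply: (le_integrable mD _ _ ig); first exact/measurable_EFinP.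
move=> x Dx; rewrite /= lee_fin (le_trans (fg _ Dx))// ler_norm//.
Qed.

Lemma EFin_Rintegral (f : T -> R) : intg f ->
  (\int[mu]_(x in D) (f x)%:E)%E = (\int[mu]_(x in D) f x)%:E.
Proof. by move=> fi; rewrite /Rintegral fineK//; exact: integrable_fin_num. Qed.

Lemma ge0_integrable_fin_num (f : T -> R) : measurable_fun D f ->
  (forall x, D x -> 0 <= f x) -> (\int[mu]_(x in D) (f x)%:E)%E \is a fin_num ->
  intg f.
Proof.
move=> mf f0 fin; apply/integrableP; split; first exact/measurable_EFinP.
rewrite (eq_integral (EFin \o f)); last first.
  by move=> x /set_mem/f0 fx /=; rewrite ger0_norm.
by rewrite ltey_eq fin.
Qed.

Lemma integrable_ln (f : T -> R) : measurable_fun D f -> intg f ->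
  (forall x, D x -> 0 < f x) -> intg (fun x => (f x)^-1) ->
  intg (fun x => ln (f x)).
Proof.
move=> mf fi f0 fVi; apply: (integrable_bounded_by _ (integrableD_EFin fi fVi)).
  exact: measurableT_comp.
move=> x Dx; have fx0 := f0 _ Dx; have fV0 : 0 < (f x)^-1 by rewrite invr_gt0.
have := ln_sublinear fx0; have := ln_sublinear fV0; rewrite lnV ?posrE// => h1 h2.
rewrite ler_norml; apply/andP; split; lra.
Qed.

End Rintegral_facts.

Lemma Rintegral_probability_cst d (T : measurableType d) (R : realType)
    (q : probability T R) (D : set T) (r : R) :
  measurable D -> q (~` D) = 0%E -> \int[q]_(x in D) r = r.
Proof.
move=> mD qD; rewrite Rintegral_cst//.
by rewrite [fine _](congr1 fine (probability_full mD qD)) mulr1.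
Qed.

(** * Lower bounds and optimizers *)

Section resolvent.
Context (R : realType) (lm lp : R).
Local Notation T := (measurableTypeR R).
Local Notation D := (`[lm, lp]%classic : set T).

Definition resolvent (nu : {measure set T -> \bar R}) (th : R) : R :=
  \int[nu]_(x in D) (th - x)^-1.

Lemma measurable_resolvent (th : R) (A : set T) :
  measurable_fun A (fun x : T => (th - x)^-1).
Proof.
apply: measurable_funTS; apply: (measurableT_comp (@measurable_invr R)).
exact: measurable_funB.
Qed.

Variable nu : {finite_measure set T -> \bar R}.

Lemma integrable_resolvent (th : R) (A : set T) : lp < th -> measurable A ->
  A `<=` D -> nu.-integrable A (fun x => ((th - x)^-1)%:E).
Proof.
move=> lpth mA AD.
apply: (integrable_bounded_by mA _ (integrable_cst_EFin nu mA ((th - lp)^-1))).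
  exact: measurable_resolvent.
move=> x /AD/=; rewrite in_itv/= => /andP[_ xlp].
have h : 0 < th - lp by rewrite subr_gt0.
have h' : th - lp <= th - x by rewrite lerB.
by rewrite ger0_norm ?invr_ge0 ?lef_pV2 ?posrE//; lra.
Qed.

Hypothesis hnu : carried_by lm lp nu.

Lemma integral_resolvent (th : R) : lp < th ->
  (\int[nu]_x ((th - x)^-1)%:E)%E = (resolvent nu th)%:E.
Proof.
move=> lpth; rewrite (@integral_setD_null _ _ _ _ setT D)//.
- by rewrite /resolvent EFin_Rintegral//; exact: integrable_resolvent.
- by rewrite setTD.
- by apply/measurable_EFinP; exact: measurable_resolvent.
Qed.

Lemma FfunP (G m : R) :
  m%:E = Ffun G lp nu <->
  (forall th : R, lp < th -> 2 * m <= th + G * resolvent nu th) /\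
  (forall e : R, 0 < e -> exists2 th, lp < th & th + G * resolvent nu th <= 2 * m + e).
Proof.
rewrite /Ffun; set S := (X in ereal_inf X).
have SE : S = [set (th + G * resolvent nu th)%:E | th in `]lp, +oo[%classic].
  rewrite /S; apply/seteqP; split => y [th /= thlp <-]; exists th => //;
  move: thlp; rewrite in_itv/= andbT => thlp; by rewrite integral_resolvent.
have inS th : lp < th -> S (th + G * resolvent nu th)%:E.
  by move=> h; rewrite SE; exists th => //=; rewrite in_itv/= h.
split.
  move=> mS.
  have iS : ereal_inf S = (2 * m)%:E.
    have := congr1 (fun z => 2%:E * z)%E mS.
    rewrite muleA -!EFinM mulfV ?mul1e// => <- //.
  split => [th lpth|e e0].
    by rewrite -lee_fin -iS; apply: ereal_inf_lbound; exact: inS.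
  have Sfin : ereal_inf S \is a fin_num by rewrite iS.
  have [y] := lb_ereal_inf_adherent e0 Sfin.
  rewrite iS SE => -[th /=]; rewrite in_itv/= andbT => lpth <-.
  by rewrite -EFinD lte_fin => /ltW h; exists th.
move=> [lb ub].
have -> : ereal_inf S = (2 * m)%:E.
  apply/eqP; rewrite eq_le; apply/andP; split.
    apply/lee_addgt0Pr => e e0; have [th lpth h] := ub _ e0.
    apply: (@le_trans _ _ (th + G * resolvent nu th)%:E); last by rewrite -EFinD lee_fin.
    by apply: ereal_inf_lbound; exact: inS.
  apply: le_ereal_inf_tmp => y; rewrite SE => -[th /=].
  by rewrite in_itv/= andbT => lpth <-; rewrite lee_fin lb.
by rewrite -EFinM mulrA mulVf ?mul1r// pnatr_eq0.
Qed.

End resolvent.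

(* The density dq/dnu of the optimizer is B + be / (th - x) off its atom, written
   as (B (th - x) + be) / (th - x); here be = B (psi - th), which stays meaningful
   in the limit B -> 0.  The set D0 has full measure and avoids the points where
   an integrand is singular. *)
Section dual_bounds.
Context (R : realType) (lm lp : R).
Local Notation T := (measurableTypeR R).
Local Notation D := (`[lm, lp]%classic : set T).
Variables (q : probability T R) (D0 : set T).
Hypotheses (mD0 : measurable D0) (D0D : D0 `<=` D) (qD0 : q (~` D0) = 0%E).
Variables (G m th B be : R).
Hypotheses (G0 : 0 < G) (lmlp : lm <= lp).
Hypothesis thx0 : forall x, D0 x -> 0 < th - x.
Hypothesis den0 : forall x, D0 x -> 0 < B * (th - x) + be.
Local Notation intg f := (q.-integrable D0 (EFin \o f)).
Hypothesis ig : intg (fun x => (th - x)^-1).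
Hypothesis ik : intg (fun x => (B * (th - x) + be)^-1).

Local Notation lnf := (fun x => ln ((B * (th - x) + be) / (th - x))).
Local Notation Elnf := (\int[q]_(x in D0) lnf x).
Local Notation g := (\int[q]_(x in D0) (th - x)^-1).
Local Notation K := (\int[q]_(x in D0) (B * (th - x) + be)^-1).

Lemma D0_bounds x : D0 x -> lm <= x /\ x <= lp.
Proof. by move=> /D0D /=; rewrite in_itv/= => /andP. Qed.

Lemma measurable_affine (a b : R) : measurable_fun D0 (fun x : T => a * (b - x) : R).
Proof. by apply: measurable_funM => //; exact: measurable_funB. Qed.

Lemma integrable_affine (a b e : R) : intg (fun x => a * (b - x) + e).
Proof.
apply: (integrable_bounded_by mD0 _ (integrable_cst_EFin q mD0
    (`|a| * (`|b| + (`|lm| + `|lp|)) + `|e|))).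
  by apply: measurable_funD => //; exact: measurable_affine.
move=> x /D0_bounds[x1 x2]; rewrite (le_trans (ler_normD _ _))// lerD2r normrM.
rewrite ler_wpM2l// (le_trans (ler_normB _ _))// lerD2l.
have := ler_norm lp; have := ler_norm (- lm); rewrite normrN.
have := normr_ge0 lm; have := normr_ge0 lp.
by move=> ? ? ? ?; rewrite ler_norml; lra.
Qed.

Lemma integrable_den : intg (fun x => B * (th - x) + be).
Proof. exact: integrable_affine. Qed.

Lemma integrable_ln_den : intg (fun x => ln (B * (th - x) + be)).
Proof.
apply: integrable_ln => //; last exact: integrable_den.
by apply: measurable_funD => //; exact: measurable_affine.
Qed.

Lemma integrable_ln_sub (a : R) : (forall x, D0 x -> 0 < a - x) ->
  intg (fun x => (a - x)^-1) -> intg (fun x => ln (a - x)).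
Proof.
move=> a0 ia; apply: integrable_ln => //; first exact: measurable_funB.
have := integrable_affine 1 a 0; apply: eq_integrable => // x _ /=.
by rewrite mul1r addr0.
Qed.

Lemma lnfE x : D0 x -> lnf x = ln (B * (th - x) + be) - ln (th - x).
Proof. by move=> Dx /=; rewrite ln_div ?posrE ?den0 ?thx0. Qed.

Lemma integrable_lnf : intg lnf.
Proof.
have := integrableB_EFin mD0 integrable_ln_den (integrable_ln_sub thx0 ig).
by apply: eq_integrable => // x /set_mem Dx; rewrite /= lnfE.
Qed.

Section test_measure.
Variable nu : {finite_measure set T -> \bar R}.
Hypothesis hnu : carried_by lm lp nu.
Local Notation n := (fine (nu [set: T])).
Local Notation J := (resolvent lm lp nu).

Lemma Hent_ge_affine (b0 b1 th' : R) : lp < th' ->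
  (forall x, D x -> 0 <= b0 + b1 * (th' - x)^-1) ->
  (forall x, D0 x -> 0 < b0 + b1 * (th' - x)^-1) ->
  intg (fun x => ln (b0 + b1 * (th' - x)^-1)) ->
  ((\int[q]_(x in D0) ln (b0 + b1 * (th' - x)^-1)
     - (b0 * n + b1 * J th') + n)%:E <= Hent q nu)%E.
Proof.
move=> lpth' phi0 phi1 iphi.
have mphi A : measurable_fun A (fun x : T => b0 + b1 * (th' - x)^-1).
  apply: measurable_funD => //; apply: measurable_funM => //.
  exact: measurable_resolvent.
have nufin : nu setT \is a fin_num by exact: fin_num_measure.
have nuD : nu D = nu setT.
  rewrite -(setUv D) measureU0//; exact: measurableC.
have iJ : nu.-integrable D (EFin \o (fun x => (th' - x)^-1)).
  exact: (integrable_resolvent _ lpth' _ (@subset_refl _ D)).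
have intD : (\int[nu]_(x in D) (b0 + b1 * (th' - x)^-1)%:E
    = (b0 * n + b1 * J th')%:E)%E.
  rewrite EFin_Rintegral//; last first.
    by apply: integrableD_EFin => //; [exact: integrable_cst_EFin|exact: integrableZl_EFin].
  rewrite RintegralD//; [|exact: integrable_cst_EFin|exact: integrableZl_EFin].
  rewrite RintegralZl// Rintegral_cst//; congr ((_ * fine _ + _)%:E); exact: nuD.
rewrite EFinD fineK//; apply: Hent_lower => //.
rewrite -intD; apply: ge0_subset_integral => //.
by apply/measurable_EFinP; exact: mphi.
Qed.

Hypothesis hF : m%:E = Ffun G lp nu.
Local Notation s := ((2 * m - th) / G).

Lemma resolvent_ge (th' : R) : lp < th' -> (2 * m - th') / G <= J th'.
Proof.
move=> h; have /(FfunP hnu)[/(_ _ h) + _] := hF.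
by rewrite ler_pdivrMr// mulrC; lra.
Qed.

Lemma resolvent_approx (e : R) : 0 < e ->
  exists2 th', lp < th' & J th' <= (2 * m - th') / G + e.
Proof.
move=> e0; have /(FfunP hnu)[_ /(_ (G * e))] := hF.
move=> /(_ (mulr_gt0 G0 e0))[th' h1 h2]; exists th' => //.
rewrite -(ler_pM2l G0) mulrDr mulrCA mulfV ?gt_eqF// mulr1; lra.
Qed.

Lemma Hent_lower_neg : lp < th -> be <= 0 ->
  (forall x, D x -> 0 <= B * (th - x) + be) ->
  ((Elnf - (B * n + be * s) + n)%:E <= Hent q nu)%E.
Proof.
move=> lpth be0 denD.
have xth x : D x -> 0 < th - x.
  by rewrite /= in_itv/= => /andP[_ xlp]; lra.
have fE x : D x -> (B * (th - x) + be) / (th - x) = B + be * (th - x)^-1.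
  by move=> /xth h; rewrite mulrDl mulfK// gt_eqF.
have lnE x : D0 x -> ln (B + be * (th - x)^-1) = lnf x.
  by move=> /D0D Dx; rewrite -fE.
apply: le_trans (@Hent_ge_affine B be th lpth _ _ _).
- have -> : \int[q]_(x in D0) ln (B + be * (th - x)^-1) = Elnf.
    by apply: eq_Rintegral => x /set_mem/lnE.
  rewrite lee_fin.
  have := resolvent_ge lpth => /(ler_wnM2l be0); lra.
- by move=> x Dx; rewrite -fE// divr_ge0 ?denD// ltW// xth.
- by move=> x Dx; rewrite -fE ?divr_gt0 ?den0 ?thx0//; exact: D0D.
- by apply: eq_integrable integrable_lnf => // x /set_mem Dx /=; rewrite lnE.
Qed.

Lemma ln_tangent (z w : R) : -1 < z -> -1 < w ->
  (0 <= z <= w \/ w <= z <= 0) -> z - w <= ln (1 + z) - ln (1 + w).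
Proof.
move=> z1 w1 zw.
have z0 : 0 < 1 + z by lra.
have w0 : 0 < 1 + w by lra.
have h := ln_sub_le z0 w0.
suff : (1 + w - (1 + z)) / (1 + z) <= w - z by lra.
by rewrite ler_pdivrMr//; nra.
Qed.

(* The infimum in F need not be attained, so the test function B + be / (th' - x)
   is used at an almost optimal th'; it is compared with th by convexity in th'. *)
Lemma Hent_lower_pos : lp <= th -> 0 < B -> 0 < be ->
  (forall th', lp < th' -> 0 <= (th' - th) * (B * K - g + be / G)) ->
  ((Elnf - (B * n + be * s) + n)%:E <= Hent q nu)%E.
Proof.
move=> lpth B0 be0 hk; apply/lee_addgt0Pr => e e0.
have [th' lpth' hJ] := resolvent_approx (divr_gt0 e0 be0).
have xth x : D x -> 0 < th' - x.
  by rewrite /= in_itv/= => /andP[_ xlp]; lra.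
have phi0 x : D x -> 0 < B + be * (th' - x)^-1.
  by move=> /xth h; rewrite addr_gt0// divr_gt0.
have mphi : measurable_fun D0 (fun x : T => B + be * (th' - x)^-1).
  apply: measurable_funD => //; apply: measurable_funM => //.
  exact: measurable_resolvent.
have iphi : intg (fun x => B + be * (th' - x)^-1).
  apply: integrableD_EFin => //; first exact: integrable_cst_EFin.
  by apply: integrableZl_EFin => //; exact: (integrable_resolvent q lpth' mD0 D0D).
have iln : intg (fun x => ln (B + be * (th' - x)^-1)).
  apply: integrable_ln => //; first by move=> x /D0D; exact: phi0.
  apply: (integrable_bounded_by mD0 _ (integrable_cst_EFin q mD0 B^-1)).
    by apply: measurable_funV_gt0 => // x /D0D; exact: phi0.
  move=> x /D0D Dx; rewrite ger0_norm ?invr_ge0 ?(ltW (phi0 _ Dx))//.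
  rewrite lef_pV2 ?posrE// ?phi0// lerDl divr_ge0 ?ltW// xth//.
have ic : intg (fun x => (th' - th) * (B * (B * (th - x) + be)^-1 - (th - x)^-1)).
  by apply: integrableZl_EFin => //; apply: integrableB_EFin => //; exact: integrableZl_EFin.
have lb : Elnf + (th' - th) * (B * K - g) <=
    \int[q]_(x in D0) ln (B + be * (th' - x)^-1).
  have -> : B * K - g = \int[q]_(x in D0) (B * (B * (th - x) + be)^-1 - (th - x)^-1).
    by rewrite RintegralB ?RintegralZl//; exact: integrableZl_EFin.
  rewrite -RintegralZl//; last by apply: integrableB_EFin => //; exact: integrableZl_EFin.
  rewrite -RintegralD//; last exact: integrable_lnf.
  apply: le_Rintegral => //; first by apply: integrableD_EFin => //; exact: integrable_lnf.
  move=> x Dx; have y0 := thx0 Dx; have d0 := den0 Dx.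
  have y'0 := xth _ (D0D Dx).
  set y := th - x in y0 d0 *.
  have y'E : th' - x = y + (th' - th) by rewrite /y; ring.
  rewrite y'E in y'0 *; set h := th' - th in y'0 *.
  have d'0 : 0 < B * (y + h) + be by rewrite addr_gt0// mulr_gt0.
  pose z := B * h / (B * y + be); pose w := h / y.
  have zE : 1 + z = (B * (y + h) + be) / (B * y + be).
    by rewrite /z; field; rewrite gt_eqF.
  have wE : 1 + w = (y + h) / y by rewrite /w; field; rewrite gt_eqF.
  have z1 : 0 < 1 + z by rewrite zE divr_gt0.
  have w1 : 0 < 1 + w by rewrite wE divr_gt0.
  have zw : 0 <= z <= w \/ w <= z <= 0.
    have p0 : 0 <= B / (B * y + be) by rewrite divr_ge0 ?ltW.
    have pr : B / (B * y + be) <= y^-1.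
      by rewrite ler_pdivrMr// mulrDr mulrCA mulVf ?gt_eqF// mulr1 lerDl mulr_ge0 ?invr_ge0 ?ltW.
    have -> : z = h * (B / (B * y + be)) by rewrite /z; ring.
    rewrite /w; have [h0|/ltW h0] := leP 0 h.
      by left; rewrite mulr_ge0//= ler_wpM2l.
    by right; rewrite mulr_le0_ge0// andbT ler_wnM2l.
  have := ln_tangent _ _ zw; rewrite zE wE => /(_ _ _).
  have -> : (B * (y + h) + be) / (B * y + be) = (B + be * (y + h)^-1) / ((B * y + be) / y) * ((y + h) / y).
    by field; rewrite ?gt_eqF.
  have bb : 0 < B + be * (y + h)^-1 by rewrite addr_gt0// divr_gt0.
  rewrite lnM ?posrE ?divr_gt0// [ln ((B + _) / _)]ln_div ?posrE ?divr_gt0//.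
  have -> : h * (B * (B * y + be)^-1 - y^-1) = z - w by rewrite /z /w; ring.
  by move=> tg; have := tg ltac:(lra) ltac:(lra); lra.
apply: (@le_trans _ _ ((\int[q]_(x in D0) ln (B + be * (th' - x)^-1)
     - (B * n + be * J th') + n)%:E + e%:E)%E); last first.
  rewrite leeD2r//; apply: (@Hent_ge_affine B be th' lpth' _ _ iln).
    by move=> x /phi0/ltW.
  by move=> x /D0D/phi0.
rewrite -EFinD lee_fin.
have := hk _ lpth'.
have := ler_wpM2l (ltW be0) hJ.
have -> : be * ((2 * m - th') / G + e / be) = be * s - (th' - th) * (be / G) + e.
  by field; rewrite !gt_eqF.
lra.
Qed.

(* For B <= 0, B + be / (th' - x) may be negative; keeping the numerator
   B (th - x) + be of the optimal density avoids this. *)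
Lemma Hent_lower_nonpos : lp <= th -> B <= 0 ->
  (forall x, D x -> 0 <= B * (th - x) + be) ->
  (forall th', lp < th' -> 0 <= (th' - th) * (B * s - g + be / G)) ->
  ((Elnf - (B * n + be * s) + n)%:E <= Hent q nu)%E.
Proof.
move=> lpth B0 denD hk; apply/lee_addgt0Pr => e e0.
pose M := `|be| + `|B| * (2 + `|2 * m| + `|th| + G) + 1.
have M0 : 0 < M.
  by rewrite /M ltr_wpDl// addr_ge0// mulr_ge0// ?addr_ge0// ltW.
have e1 : 0 < Num.min (e / M) 1 by rewrite lt_min ltr01 divr_gt0.
have [th' lpth' hJ] := resolvent_approx e1.
have xth x : D x -> 0 < th' - x.
  by rewrite /= in_itv/= => /andP[_ xlp]; lra.
have J0 : 0 <= J th'.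
  by apply: Rintegral_ge0 => x /xth h; rewrite invr_ge0 ltW.
have th'm : th' <= 2 * m + G.
  have : 0 <= (2 * m - th') / G + 1.
    by rewrite (le_trans J0)// (le_trans hJ)// lerD2l ge_min lexx orbT.
  by rewrite -(pmulr_rge0 _ G0) mulrDr mulr1 mulrCA mulfV ?gt_eqF//; lra.
pose be' := be - B * (th' - th).
have phiE x : D x -> B + be' * (th' - x)^-1 = (B * (th - x) + be) / (th' - x).
  by move=> /xth h; rewrite /be'; field; rewrite gt_eqF.
have be'0 : 0 <= be'.
  have Dlp : D lp by rewrite /= in_itv/= lmlp lexx.
  have := denD _ Dlp; have := xth _ Dlp.
  rewrite (_ : be' = B * (th - lp) + be - B * (th' - lp)); last by rewrite /be'; ring.
  by move=> /ltW/(mulr_le0_ge0 B0); lra.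
have be'M : be' <= M.
  have h1 := ler_norm be; have h2 := ler_norm (- B); rewrite normrN in h2.
  have h3 := ler_norm (2 * m); have h4 := ler_norm (- th); rewrite normrN in h4.
  have : - B * (th' - th) <= `|B| * (2 + `|2 * m| + `|th| + G).
    have [d0|d0] := leP 0 (th' - th); last first.
      rewrite (@le_trans _ _ 0)// ?mulr_ge0 ?addr_ge0//; last exact: ltW.
      by rewrite mulr_ge0_le0 ?oppr_ge0// ltW.
    by rewrite ler_pM ?oppr_ge0//; lra.
  by rewrite /be' /M; lra.
have lnE x : D0 x -> ln (B + be' * (th' - x)^-1) = ln (B * (th - x) + be) - ln (th' - x).
  by move=> Dx; rewrite phiE ?ln_div ?posrE ?den0 ?xth//; exact: D0D.
have ith' : intg (fun x => (th' - x)^-1) by exact: (integrable_resolvent q lpth' mD0 D0D).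
have iln' : intg (fun x => ln (th' - x)).
  by apply: integrable_ln_sub => // x /D0D/xth.
have iln : intg (fun x => ln (B + be' * (th' - x)^-1)).
  have := integrableB_EFin mD0 integrable_ln_den iln'.
  by apply: eq_integrable => // x /set_mem Dx; rewrite /= lnE.
have lb : Elnf - (th' - th) * g <= \int[q]_(x in D0) ln (B + be' * (th' - x)^-1).
  have ig' : intg (fun x => (th' - th) * (th - x)^-1) by exact: integrableZl_EFin.
  have ilnf := integrable_lnf.
  rewrite -RintegralZl// -RintegralB//.
  apply: le_Rintegral => //; first exact: integrableB_EFin.
  move=> x Dx; have y0 := thx0 Dx; have y'0 := xth _ (D0D Dx).
  rewrite lnE// lnfE//.
  have := ln_sub_le y0 y'0; have -> : th' - x - (th - x) = th' - th by ring.
  by lra.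
apply: (@le_trans _ _ ((\int[q]_(x in D0) ln (B + be' * (th' - x)^-1)
     - (B * n + be' * J th') + n)%:E + e%:E)%E); last first.
  rewrite leeD2r//; apply: (@Hent_ge_affine B be' th' lpth' _ _ iln).
    by move=> x Dx; rewrite phiE// divr_ge0 ?denD// ltW// xth.
  by move=> x Dx; rewrite phiE ?divr_gt0 ?den0 ?xth//; exact: D0D.
rewrite -EFinD lee_fin.
have := hk _ lpth'; have := ler_wpM2l be'0 hJ.
have -> : be' * ((2 * m - th') / G + Num.min (e / M) 1) =
    be * s - (th' - th) * (be / G + B * s) + B * ((th' - th) ^+ 2 / G)
    + be' * Num.min (e / M) 1.
  by rewrite /be'; ring.
have : B * ((th' - th) ^+ 2 / G) <= 0.
  by rewrite mulr_le0_ge0// divr_ge0 ?sqr_ge0// ltW.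
have : be' * Num.min (e / M) 1 <= e.
  rewrite (@le_trans _ _ (M * (e / M)))//; last by rewrite mulrCA mulfV ?gt_eqF// mulr1.
  rewrite ler_pM//; first by rewrite ltW.
  by rewrite ge_min lexx.
lra.
Qed.

End test_measure.

Section optimizer.
Variables (t c : R).
Hypotheses (t0 : 0 <= t) (cD : D c) (lpth : lp <= th) (be_neq0 : be != 0).
Hypothesis tc : t != 0 -> c != th /\ B * (th - c) + be = 0.
Local Notation s := ((2 * m - th) / G).
Hypothesis hs : K + t / (th - c) = s.
Hypothesis hk : forall th', lp < th' ->
  (th' - th) * ((g - B * s) / be) <= (th' - th) / G.

Local Notation w := (fun x => (th - x) / (B * (th - x) + be)).

Lemma integrable_optimizer : intg w.
Proof.
apply: (integrable_bounded_by mD0 _ (integrableZl_EFin mD0 (th - lm) ik)).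
  apply: measurable_funM; first exact: measurable_funB.
  apply: measurable_funV_gt0 => //.
  by apply: measurable_funD => //; exact: measurable_affine.
move=> x Dx; have h1 := thx0 Dx; have h2 := den0 Dx.
have w0 : 0 <= (th - x) / (B * (th - x) + be) by rewrite divr_ge0// ltW.
have k0 : 0 <= (B * (th - x) + be)^-1 by rewrite invr_ge0 ltW.
rewrite ger0_norm// ler_wpM2r//.
by have [? ?] := D0_bounds Dx; lra.
Qed.

Lemma optimizer_mass : B * (\int[q]_(x in D0) w x + t) + be * s = 1.
Proof.
have iw := integrable_optimizer.
have : \int[q]_(x in D0) (B * w x + be * (B * (th - x) + be)^-1) = 1.
  transitivity (\int[q]_(x in D0) (1 : R)).
    apply: eq_Rintegral => x /set_mem Dx.
    by have := den0 Dx; move=> ?; field; rewrite gt_eqF.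
  exact: Rintegral_probability_cst.
rewrite RintegralD//; [|exact: integrableZl_EFin..].
rewrite !RintegralZl// => E1.
have rE : B * t + be * (t / (th - c)) = 0.
  have [->|/tc[cth Bc]] := eqVneq t 0; first by rewrite mul0r !mulr0 addr0.
  have -> : B * t + be * (t / (th - c)) = t * (B * (th - c) + be) / (th - c).
    by field; rewrite subr_eq0 eq_sym.
  by rewrite Bc mulr0 mul0r.
rewrite -hs -E1 !mulrDr; lra.
Qed.

(* th is the minimizer in F(nu) for nu = w q + t delta_c because 1 / (th' - x) lies
   above its tangent at th. *)
Lemma optimizer_exists : exists nu : {finite_measure set T -> \bar R},
  [/\ carried_by lm lp nu, m%:E = Ffun G lp nu,
      nu [set: T] = (\int[q]_(x in D0) w x + t)%:E &
      Hent q nu = (Elnf + (\int[q]_(x in D0) w x + t) - 1)%:E].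
Proof.
have iw := integrable_optimizer.
have w0 x : D0 x -> 0 <= w x.
  by move=> Dx /=; rewrite divr_ge0// ltW// ?thx0// den0.
have mc : measurable [set c : T] by exact: measurable_set1.
have [nu [nuE nuI]] := tilted_measure_exists mD0 iw w0 t0 mc.
have nuT : nu [set: T] = (\int[q]_(x in D0) w x + t)%:E.
  by rewrite nuE// setTI diracT mule1 EFin_Rintegral// -EFinD.
have hnu : carried_by lm lp nu.
  rewrite /carried_by nuE; last by apply: measurableC.
  rewrite (_ : _ `&` D0 = set0); last by apply/seteqP; split => // x [+ /D0D].
  rewrite integral_set0 add0e diracE memNset ?mule0//.
pose Wt th' := \int[q]_(x in D0) (w x * (th' - x)^-1).
have iWt th' : lp < th' -> intg (fun x => w x * (th' - x)^-1).
  move=> lpth'; apply: (integrable_bounded_by mD0 _ (integrableZl_EFin mD0 ((th' - lp)^-1) iw)).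
    apply: measurable_funM; last exact: measurable_resolvent.
    by apply/measurable_EFinP; exact: measurable_int iw.
  move=> x Dx; have [x1 x2] := D0_bounds Dx.
  have a0 : 0 < th' - x by lra.
  have a1 : 0 < th' - lp by lra.
  have a2 : (th' - x)^-1 <= (th' - lp)^-1 by rewrite lef_pV2 ?posrE//; lra.
  have wx0 := w0 _ Dx; rewrite /= in wx0.
  have a3 : 0 <= (th' - x)^-1 by rewrite invr_ge0 ltW.
  rewrite ger0_norm; last exact: mulr_ge0.
  by rewrite mulrC ler_wpM2r.
have JE th' : lp < th' -> resolvent lm lp nu th' = Wt th' + t / (th' - c).
  move=> lpth'; apply: EFin_inj.
  have mrD : measurable_fun [set: T] ((fun x => ((th' - x)^-1)%:E) \_ D).
    apply/(measurable_restrictT _ _).1 => //.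
    by apply/measurable_EFinP; exact: measurable_resolvent.
  have D0' x : D x -> 0 < th' - x by rewrite /= in_itv/= => /andP[_]; lra.
  rewrite /resolvent -EFin_Rintegral//; last first.
    exact: (integrable_resolvent nu lpth' _ (@subset_refl _ D)).
  rewrite integral_mkcond nuI//; last first.
    by move=> x; rewrite patchE; case: ifPn => // /set_mem/D0'; rewrite lee_fin invr_ge0 => /ltW.
  rewrite EFinD /Wt -EFin_Rintegral//; last exact: iWt.
  congr (_ + _)%E; last by rewrite patchE mem_set// -EFinM.
  by apply: eq_integral => x /set_mem Dx; rewrite patchE mem_set ?D0D -?EFinM 1?mulrC//; exact: D0D.
have F : m%:E = Ffun G lp nu.
  apply/(FfunP hnu); split.
    move=> th' lpth'; rewrite JE//.
    have WtK : K - (th' - th) * ((g - B * K) / be) <= Wt th'.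
      pose k x := (B * (th - x) + be)^-1.
      have iBk : intg (fun x => B * k x) by exact: integrableZl_EFin.
      have id : intg (fun x => (th - x)^-1 - B * k x) by exact: integrableB_EFin.
      have izd : intg (fun x => (th' - th) / be * ((th - x)^-1 - B * k x)).
        exact: integrableZl_EFin.
      have -> : K - (th' - th) * ((g - B * K) / be) =
          \int[q]_(x in D0) (k x - (th' - th) / be * ((th - x)^-1 - B * k x)).
        by rewrite RintegralB// RintegralZl// RintegralB// RintegralZl// /k; ring.
      apply: le_Rintegral => //; [exact: integrableB_EFin|exact: iWt|].
      move=> x Dx; have y0 := thx0 Dx; have d0 := den0 Dx.
      have y'0 : 0 < th' - x by have [] := D0_bounds Dx; lra.
      rewrite /k /=; have -> : th' - th = (th' - x) - (th - x) by ring.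
      move: (th - x) (th' - x) y0 y'0 d0 => y y' y0 y'0 d0.
      have -> : (B * y + be)^-1 - (y' - y) / be * (y^-1 - B / (B * y + be)) =
          (B * y + be)^-1 * (2 - y' / y) by field; rewrite be_neq0 !gt_eqF.
      rewrite [y / _]mulrC -mulrA ler_wpM2l ?invr_ge0 ?(ltW d0)//.
      rewrite -subr_ge0 (_ : _ - _ = (y - y') ^+ 2 / (y * y')).
        by rewrite divr_ge0 ?sqr_ge0// mulr_ge0// ltW.
      by field; rewrite !gt_eqF.
    have tK : t / (th - c) + (th' - th) * (B * (t / (th - c)) / be) <= t / (th' - c).
      have [->|t_neq0] := eqVneq t 0; first by rewrite !(mul0r, mulr0) addr0.
      have [cth Bc] := tc t_neq0.
      have y0 : 0 < th - c.
        rewrite subr_gt0 lt_neqAle cth/= (le_trans _ lpth)//.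
        by move: cD; rewrite /= in_itv/= => /andP[].
      have y'0 : 0 < th' - c by move: cD; rewrite /= in_itv/= => /andP[_]; lra.
      have Bbe : B / be = - (th - c)^-1.
        have B0 : B != 0.
          by apply: contra_neq be_neq0 => B0; move: Bc; rewrite B0 mul0r add0r.
        have -> : be = - (B * (th - c)) by lra.
        by field; rewrite B0 gt_eqF.
      have -> : B * (t / (th - c)) / be = B / be * (t / (th - c)) by ring.
      rewrite Bbe; have -> : th' - th = (th' - c) - (th - c) by ring.
      move: (th - c) (th' - c) y0 y'0 => y y' y0 y'0.
      rewrite -subr_ge0 (_ : _ - _ = t * ((y - y') ^+ 2 / (y ^+ 2 * y'))).
        by rewrite mulr_ge0// divr_ge0 ?sqr_ge0// mulr_ge0 ?sqr_ge0// ltW.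
      by field; rewrite !gt_eqF.
    have hk' := hk lpth'.
    have : (2 * m - th') / G <= Wt th' + t / (th' - c).
      have : s - (th' - th) * ((g - B * s) / be) <= Wt th' + t / (th' - c).
        rewrite -hs; move: WtK tK; set r := t / (th - c) => h1 h2.
        apply: le_trans (lerD h1 h2); rewrite le_eqVlt; apply/orP; left; apply/eqP.
        by field.
      apply: le_trans; rewrite (_ : _ / G = s - (th' - th) / G); last by ring.
      by rewrite lerB.
    by rewrite ler_pdivrMr// mulrC; lra.
  move=> e e0.
  have lpth' : lp < th + e by rewrite (le_lt_trans lpth)// ltrDl.
  exists (th + e) => //.
  rewrite JE//.
  have h1 : Wt (th + e) <= K.
    apply: le_Rintegral => //; first exact: iWt.
    move=> x Dx; have y0 := thx0 Dx; have d0 := den0 Dx.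
    have y'0 : 0 < th + e - x by lra.
    rewrite [X in X * _]mulrC -mulrA ger_pMr ?invr_gt0//.
    by rewrite ler_pdivrMr// mul1r; lra.
  have h2 : t / (th + e - c) <= t / (th - c).
    have [->|/tc[cth _]] := eqVneq t 0; first by rewrite !mul0r.
    have y0 : 0 < th - c.
      rewrite subr_gt0 lt_neqAle cth/= (le_trans _ lpth)//.
      by move: cD; rewrite /= in_itv/= => /andP[].
    by rewrite ler_wpM2l// lef_pV2 ?posrE//; lra.
  have : G * (Wt (th + e) + t / (th + e - c)) <= G * s.
    by rewrite ler_pM2l// -hs lerD.
  by rewrite mulrCA mulfV ?gt_eqF// mulr1; lra.
exists nu; split => //.
pose f := (fun x : T => (B * (th - x) + be) / (th - x)) \_ D0.
have mf : measurable_fun [set: T] f.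
  apply/(measurable_restrictT _ _).1 => //; apply: measurable_funM.
    by apply: measurable_funD => //; exact: measurable_affine.
  exact: measurable_resolvent.
have f0 x : 0 <= f x.
  rewrite /f patchE; case: ifPn => // /set_mem Dx.
  by rewrite divr_ge0// ltW ?den0 ?thx0.
have ft : (t%:E * (f c)%:E = 0)%E.
  have [->|/tc[_ Bc]] := eqVneq t 0; first by rewrite mul0e.
  rewrite /f patchE; case: ifPn => [/set_mem Dc|]; last by rewrite mule0.
  by rewrite Bc mul0r mule0.
have fw x : D0 x -> f x * w x = 1.
  move=> Dx; rewrite /f patchE mem_set//=.
  by field; rewrite !gt_eqF ?den0 ?thx0.
rewrite (Hent_density mf f0); last first.
  move=> A mA; rewrite integral_mkcond nuI; last 2 first.
    by apply/(measurable_restrictT _ _).1 => //; apply: measurable_funTS; exact/measurable_EFinP.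
    by move=> x; rewrite patchE; case: ifPn => //; rewrite lee_fin f0.
  rewrite (_ : (t%:E * _ = 0)%E); last first.
    by rewrite patchE; case: ifPn => //; rewrite mule0.
  rewrite adde0 (eq_integral ((cst 1%E) \_ A)); last first.
    move=> x /set_mem Dx; rewrite !patchE; case: ifPn => // _; last by rewrite mul0e.
    by rewrite -EFinM fw.
  rewrite -integral_mkcondr integral_cst//; last exact: measurableI.
  rewrite mul1e; apply/eqP; rewrite eq_le; apply/andP; split.
    have mDA : measurable (D0 `&` A) by exact: measurableI.
    have mDc : measurable (~` D0) by exact: measurableC.
    have := measureU0 mDA mDc qD0; move=> /= <-.
    apply: le_measure; rewrite ?inE//; first exact: measurableU.
    by move=> x Ax; have [Dx|Dx] := pselect (D0 x); [left|right].
  apply: le_measure; rewrite ?inE//; exact: measurableI.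
rewrite nuT (@integral_setD_null _ _ _ _ setT D0)//; [|by rewrite setTD|]; last first.
  by apply: (measurableT_comp (@measurable_lne R setT)); exact/measurable_EFinP.
have -> : (\int[q]_(x in D0) lne (f x)%:E = Elnf%:E)%E.
  rewrite -EFin_Rintegral//; last exact: integrable_lnf.
  apply: eq_integral => x /set_mem Dx.
  by rewrite /f patchE mem_set// lne_EFin// divr_gt0 ?den0 ?thx0.
by [].
Qed.

End optimizer.

Section value.
Variables (t c : R).
Hypotheses (t0 : 0 <= t) (cD : D c) (lpth : lp <= th).
Hypothesis tc : t != 0 -> c != th /\ B * (th - c) + be = 0.
Local Notation s := ((2 * m - th) / G).
Hypothesis hs : K + t / (th - c) = s.
Hypothesis denD : forall x, D x -> 0 <= B * (th - x) + be.
Hypothesis critical :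
  [/\ be < 0, lp < th & B * s - g + be / G = 0] \/
  [/\ 0 < be, B <= 0 \/ t = 0 &
      forall th', lp < th' -> 0 <= (th' - th) * (B * s - g + be / G)].
Local Notation w := (fun x => (th - x) / (B * (th - x) + be)).

Lemma Hent_lower_critical (nu : {finite_measure set T -> \bar R}) :
  carried_by lm lp nu -> m%:E = Ffun G lp nu ->
  ((Elnf - (B * fine (nu [set: T]) + be * s) + fine (nu [set: T]))%:E <= Hent q nu)%E.
Proof.
move=> hnu hF; case: critical => [[be0 lth _]|[be0 Bt hk]].
  by apply: Hent_lower_neg => //; exact: ltW.
have [B0|B0] := leP B 0; first exact: Hent_lower_nonpos.
apply: Hent_lower_pos => //.
case: Bt => [|te]; first by rewrite leNgt B0.
by move: hk hs; rewrite te mul0r addr0 => hk ->.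
Qed.

Lemma critical_optimizer : exists nu : {finite_measure set T -> \bar R},
  [/\ carried_by lm lp nu, m%:E = Ffun G lp nu,
      nu [set: T] = (\int[q]_(x in D0) w x + t)%:E &
      Hent q nu = (Elnf + (\int[q]_(x in D0) w x + t) - 1)%:E].
Proof.
apply: (@optimizer_exists t c) => //.
  by case: critical => [[be0 _ _]|[be0 _ _]]; rewrite ?(lt_eqF be0) ?(gt_eqF be0).
move=> th' lpth'; case: critical => [[be0 lth E]|[be0 _ /(_ _ lpth') hk]].
  have -> : g - B * s = be / G by lra.
  by rewrite [_ / be]mulrAC mulfV ?lt_eqF// mul1r.
have -> : (th' - th) * ((g - B * s) / be) = ((th' - th) * (g - B * s)) / be by ring.
rewrite ler_pdivrMr//; have -> : (th' - th) / G * be = (th' - th) * (be / G) by ring.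
lra.
Qed.

Lemma rateH_critical : \int[q]_(x in D0) w x + t = 1 ->
  rateH G lm lp q m = ((2^-1)%:E * Elnf%:E)%E.
Proof.
move=> mass; have [nu [hnu hF nu1 HE]] := critical_optimizer.
have msum := optimizer_mass tc hs; rewrite mass mulr1 in msum.
rewrite mass in nu1 HE.
have [p pE] := probability_exists nu1.
apply/eqP; rewrite eq_le; apply/andP; split; last first.
  apply: le_ereal_inf_tmp => _ [p' [hp' Fp'] <-]; rewrite lee_pmul2l//.
  have := Hent_lower_critical hp' Fp'.
  have -> : fine (p' [set: T]) = 1 by exact: (congr1 fine (@probability_setT _ _ _ p')).
  by rewrite mulr1 msum subrK.
apply: ereal_inf_lbound; exists p; last first.
  congr (_ * _)%E; rewrite (Hent_eq _ pE) HE; congr (_%:E); lra.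
split; first by rewrite /carried_by pE.
rewrite hF /Ffun; congr (_ * ereal_inf _)%E.
apply/seteqP; split => y [th' /= h <-]; exists th' => //;
congr (_ + _ * _)%E; apply: eq_measure_integral => A _ _;
by [exact: pE|exact: (esym (pE A))].
Qed.

Lemma rateG_critical : B = 1 ->
  rateG G lm lp q m = ((2^-1)%:E * (Elnf - be * s)%:E)%E.
Proof.
move=> B1; have [nu [hnu hF nu1 HE]] := critical_optimizer.
have msum := optimizer_mass tc hs.
set I := _ + t in HE msum nu1; rewrite B1 mul1r in msum.
apply/eqP; rewrite eq_le; apply/andP; split; last first.
  apply: le_ereal_inf_tmp => _ [p' [hp' Fp'] <-]; rewrite lee_pmul2l//.
  apply: le_trans (Hent_lower_critical hp' Fp'); rewrite lee_fin B1; lra.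
apply: ereal_inf_lbound; exists nu => //; congr (_ * _)%E.
by rewrite HE; congr (_%:E); lra.
Qed.

End value.
End dual_bounds.

(** * Solutions of (i)-(iii) give the rate functions *)

Section transforms.
Context (R : realType) (lm lp : R).
Local Notation T := (measurableTypeR R).
Local Notation D := (`[lm, lp]%classic : set T).
Variable q : probability T R.
Hypothesis hq : carried_by lm lp q.

Lemma measurable_einv (f : T -> R) (A : set T) : measurable_fun [set: T] f ->
  measurable_fun A (fun x => ((f x)%:E)^-1%E).
Proof.
move=> mf; apply: measurable_funTS.
have -> : (fun x => ((f x)%:E)^-1%E) =
    (fun x => if f x == 0 then +oo%E else ((f x)^-1)%:E).
  by apply/funext => x; rewrite inver.
apply: measurable_fun_ifT => //; first exact: measurable_fun_eqr.
by apply/measurable_EFinP; exact: (measurableT_comp (@measurable_invr R)).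
Qed.

Lemma measurable_ln_dist (a : R) (A : set T) :
  measurable_fun A (fun x : T => lne (`|a - x|%R)%:E).
Proof.
apply: measurable_funTS; apply: (measurableT_comp (@measurable_lne R setT)).
apply/measurable_EFinP; apply: measurableT_comp => //.
exact: measurable_funB.
Qed.

Section full_set.
Variable D0 : set T.
Hypotheses (mD0 : measurable D0) (qD0 : q (~` D0) = 0%E).

Lemma Stieltjes_right (a : R) : lp <= a -> (forall x, D0 x -> x != a) ->
  Stieltjes lp q a = (\int[q]_(x in D0) ((a - x)^-1)%:E)%E.
Proof.
move=> lpa D0a; rewrite /Stieltjes lpa (@integral_setD_null _ _ _ _ setT D0)//.
- apply: eq_integral => x /set_mem/D0a xa; rewrite inver subr_eq0 eq_sym.
  by rewrite (negbTE xa).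
- by rewrite setTD.
- by apply: measurable_einv; exact: measurable_funB.
Qed.

Lemma Stieltjes_left (a : R) : a < lp -> (forall x, D0 x -> x != a) ->
  Stieltjes lp q a = (- \int[q]_(x in D0) ((x - a)^-1)%:E)%E.
Proof.
move=> alp D0a; rewrite /Stieltjes leNgt alp/= (@integral_setD_null _ _ _ _ setT D0)//.
- congr (- _)%E; apply: eq_integral => x /set_mem/D0a xa.
  by rewrite inver subr_eq0 (negbTE xa).
- by rewrite setTD.
- by apply: measurable_einv; exact: measurable_funB.
Qed.

Lemma Lpot_right (a : R) : (forall x, D0 x -> 0 < a - x) ->
  Lpot q a = (\int[q]_(x in D0) (ln (a - x))%:E)%E.
Proof.
move=> D0a; rewrite /Lpot (@integral_setD_null _ _ _ _ setT D0)//.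
- by apply: eq_integral => x /set_mem/D0a xa; rewrite gtr0_norm// lne_EFin.
- by rewrite setTD.
- exact: measurable_ln_dist.
Qed.

Lemma Lpot_left (a : R) : (forall x, D0 x -> 0 < x - a) ->
  Lpot q a = (\int[q]_(x in D0) (ln (x - a))%:E)%E.
Proof.
move=> D0a; rewrite /Lpot (@integral_setD_null _ _ _ _ setT D0)//.
- apply: eq_integral => x /set_mem/D0a xa.
  by rewrite distrC gtr0_norm// lne_EFin.
- by rewrite setTD.
- exact: measurable_ln_dist.
Qed.

End full_set.

Lemma probability_itv : q D = 1%E.
Proof. exact: probability_full. Qed.

Lemma Stieltjes_right_ge0 (a : R) : lp <= a -> (0 <= Stieltjes lp q a)%E.
Proof.
move=> lpa; rewrite /Stieltjes lpa (@integral_setD_null _ _ _ _ setT D)//.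
- apply: integral_ge0 => x; rewrite /= in_itv/= => /andP[_ xlp].
  rewrite inver; case: ifPn => // _; rewrite lee_fin invr_ge0 subr_ge0.
  exact: le_trans lpa.
- by rewrite setTD.
- by apply: measurable_einv; exact: measurable_funB.
Qed.

Lemma Stieltjes_fin_atom (a : R) : (a <= lm \/ lp <= a) ->
  Stieltjes lp q a \is a fin_num -> q [set a] = 0%E.
Proof.
have ms : measurable [set a : T] by exact: measurable_set1.
have hole (h : T -> \bar R) : measurable_fun setT h ->
    (forall x, D x -> (0 <= h x)%E) -> h a = +oo%E ->
    (\int[q]_x h x)%E \is a fin_num -> q [set a] = 0%E.
  move=> mh h0 ha fin.
  have [Da|Da] := pselect (D a); last first.
    apply/eqP; rewrite -measure_le0 -hq; apply: le_measure; rewrite ?inE//.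
      exact: measurableC.
    by move=> x /= ->.
  apply: contrapT => qa.
  suff : (\int[q]_x h x = +oo)%E by move=> e; move: fin; rewrite e.
  rewrite (@integral_setD_null _ _ _ _ setT D)//; last by rewrite setTD.
  apply/eqP; rewrite -leye_eq.
  apply: (@le_trans _ _ (\int[q]_(x in [set a]) h x)%E).
    rewrite (eq_integral (cst +oo%E)); last by move=> x /set_mem/= ->.
    rewrite integral_cst// gt0_mulye// lt0e measure_ge0 andbT.
    exact/eqP.
  apply: ge0_subset_integral => //; first exact: measurable_funTS.
  by move=> x /= ->.
move=> side; rewrite /Stieltjes; case: ifPn => [lpa|]; last rewrite -ltNge => alp.
  apply: hole; first by apply: measurable_einv; exact: measurable_funB.
    move=> x; rewrite /= in_itv/= => /andP[_ xlp].
    rewrite inver; case: ifPn => // _; rewrite lee_fin invr_ge0 subr_ge0.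
    exact: le_trans lpa.
  by rewrite subrr inve0.
have alm : a <= lm by case: side => //; rewrite leNgt alp.
rewrite fin_numN; apply: hole.
- by apply: measurable_einv; exact: measurable_funB.
- move=> x; rewrite /= in_itv/= => /andP[lmx _].
  rewrite inver; case: ifPn => // _; rewrite lee_fin invr_ge0 subr_ge0.
  exact: le_trans lmx.
- by rewrite subrr inve0.
Qed.

End transforms.

Lemma fin_num_addP (R : realType) (r : R) (x y : \bar R) :
  (r%:E = x + y)%E -> x \is a fin_num /\ y \is a fin_num.
Proof. by case: x; case: y => //= y x [_]. Qed.

Lemma tterm_real (R : realType) (G B t th c : R) : (t != 0 -> c != th) ->
  tterm G B t th c = (B * G * (t / (th - c)))%:E.
Proof.
move=> tc; rewrite /tterm; have [->|/tc cth] := eqVneq t 0.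
  by rewrite mulr0 mul0r mulr0 mul0e.
by rewrite inver subr_eq0 eq_sym (negbTE cth) -EFinM mulrA.
Qed.

Section solution.
Context (R : realType) (lm lp : R).
Local Notation T := (measurableTypeR R).
Local Notation D := (`[lm, lp]%classic : set T).
Variable q : probability T R.
Hypothesis hq : carried_by lm lp q.
Variables (G m B t th psi c : R).
Hypotheses (G0 : 0 < G) (lmlp : lm <= lp) (lpth : lp <= th) (cD : D c) (t0 : 0 <= t).
Hypothesis side : (0 < B /\ lp <= psi) \/ (B < 0 /\ psi <= lm).
Hypothesis hii : eq_ii G lp q m B t th psi c.
Hypothesis hiii : ineq_iii G lp q B t th psi c.
Hypothesis hsign : (B * (psi - th) < 0 /\ lp < th) \/
  (0 < B * (psi - th) /\ (B <= 0 \/ t = 0)).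

Let B_neq0 : B != 0.
Proof. by case: side => -[B0 _]; [rewrite gt_eqF|rewrite lt_eqF]. Qed.

Lemma eq_ii_fin : Stieltjes lp q psi \is a fin_num /\
  tterm G B t th c \is a fin_num.
Proof.
have [+ _] := hii => /fin_num_addP[+ ->].
case: (Stieltjes lp q psi) => [//||].
  by rewrite gt0_muley ?lte_fin.
by rewrite gt0_muleNy ?lte_fin.
Qed.

Lemma tterm_atom : t != 0 -> c = psi /\ c != th.
Proof.
move=> t_neq0; split.
  have [_ h] := hii; apply: contrapT => /eqP cpsi; move/eqP: t_neq0; apply.
  by apply: h => /eqP; rewrite eq_sym (negbTE cpsi).
apply/eqP => cth; have [_] := eq_ii_fin.
rewrite /tterm cth subrr inve0.
have : B * G * t != 0 by rewrite !mulf_neq0// gt_eqF.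
by rewrite neq_lt => /orP[h|h]; [rewrite lt0_muley|rewrite gt0_muley].
Qed.

Lemma ttermE : tterm G B t th c = (B * G * (t / (th - c)))%:E.
Proof. by apply: tterm_real => /tterm_atom[]. Qed.

Lemma Stieltjes_th_fin : Stieltjes lp q th \is a fin_num.
Proof.
have [Spsi _] := eq_ii_fin; have [+ _] := hiii.
have := Stieltjes_right_ge0 hq lpth.
rewrite ttermE -(fineK Spsi); case: (Stieltjes lp q th) => [r|_|] //.
by rewrite gt0_muley// leye_eq.
Qed.

Let s := (2 * m - th) / G.
Let be := B * (psi - th).
Let D0 := D `\` ([set th] `|` [set psi]).

Let qth : q [set th] = 0%E.
Proof. by apply: (Stieltjes_fin_atom hq) Stieltjes_th_fin; right. Qed.

Let qpsi : q [set psi] = 0%E.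
Proof.
by apply: (Stieltjes_fin_atom hq) (eq_ii_fin).1; case: side => -[_]; [right|left].
Qed.

Let mD0 : measurable D0.
Proof. by apply: measurableD => //; apply: measurableU; exact: measurable_set1. Qed.

Let D0D : D0 `<=` D. Proof. by move=> x []. Qed.

Let qD0 : q (~` D0) = 0%E.
Proof.
have mDc : measurable (~` D : set T) by exact: measurableC.
have ms (a : R) : measurable [set a : T] by exact: measurable_set1.
have mU : measurable (~` D `|` [set th] : set T) by exact: measurableU.
rewrite /D0 setCD setUA; apply: etrans (measureU0 mU (ms psi) qpsi) _.
exact: etrans (measureU0 mDc (ms th) qth) hq.
Qed.

Let th_gt x : D0 x -> 0 < th - x.
Proof.
move=> [+ nx]; rewrite /= in_itv/= => /andP[_ xlp].
rewrite subr_gt0 lt_neqAle (le_trans xlp lpth) andbT.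
by apply/eqP => xth; apply: nx; left.
Qed.

Let psi_neq x : D0 x -> x != psi.
Proof. by move=> [_ nx]; apply/eqP => xth; apply: nx; right. Qed.

Let psi_gt x : 0 < B -> D0 x -> 0 < psi - x.
Proof.
move=> B0 Dx; have := psi_neq Dx; case: Dx => + _.
rewrite /= in_itv/= => /andP[_ xlp]; case: side => -[Bs p]; last by lra.
by rewrite subr_gt0 lt_neqAle => ->; rewrite (le_trans xlp).
Qed.

Let psi_lt x : B < 0 -> D0 x -> 0 < x - psi.
Proof.
move=> B0 Dx; have := psi_neq Dx; case: Dx => + _.
rewrite /= in_itv/= => /andP[xlm _]; case: side => -[Bs p]; first by lra.
by rewrite subr_gt0 lt_neqAle eq_sym => ->; rewrite (le_trans p).
Qed.

Let denE x : B * (th - x) + be = B * (psi - x).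
Proof. by rewrite /be; ring. Qed.

Let den_gt x : D0 x -> 0 < B * (th - x) + be.
Proof.
move=> Dx; rewrite denE; case: side => -[B0 _]; first by rewrite mulr_gt0 ?psi_gt.
by rewrite nmulr_rgt0// -oppr_gt0 opprB psi_lt.
Qed.

Let denD x : D x -> 0 <= B * (th - x) + be.
Proof.
rewrite /= in_itv/= denE => /andP[x1 x2]; case: side => -[B0 p].
  by apply: mulr_ge0; [exact: ltW|rewrite subr_ge0 (le_trans x2)].
by rewrite nmulr_rge0// subr_le0 (le_trans p).
Qed.

Local Notation intg f := (q.-integrable D0 (EFin \o f)).

Let ig : intg (fun x => (th - x)^-1).
Proof.
apply: ge0_integrable_fin_num; first exact: measurable_resolvent.
  by move=> x /th_gt h; rewrite invr_ge0 ltW.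
rewrite -(Stieltjes_right mD0 qD0 lpth) ?Stieltjes_th_fin//.
by move=> x /th_gt; rewrite subr_gt0 => /lt_eqF ->.
Qed.

Let SthE : Stieltjes lp q th = (\int[q]_(x in D0) (th - x)^-1)%:E.
Proof.
rewrite (Stieltjes_right mD0 qD0 lpth) ?EFin_Rintegral//.
by move=> x /th_gt; rewrite subr_gt0 => /lt_eqF ->.
Qed.

Let psi_lt_lp : psi <= lm -> psi < lp.
Proof.
move=> plm; rewrite ltNge; apply/negP => lpp.
suff : (q D <= 0)%E by rewrite (probability_itv hq) lee_fin ler10.
rewrite -qpsi; apply: le_measure; rewrite ?inE//.
by move=> x; rewrite /= in_itv/= => /andP[x1 x2]; apply/le_anti/andP; split; lra.
Qed.

Let Spsi : intg (fun x => (psi - x)^-1) /\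
  Stieltjes lp q psi = (\int[q]_(x in D0) (psi - x)^-1)%:E.
Proof.
have [fin _] := eq_ii_fin; case: side => -[B0 p].
  have h := Stieltjes_right mD0 qD0 p psi_neq.
  have ip : intg (fun x => (psi - x)^-1).
    apply: ge0_integrable_fin_num; first exact: measurable_resolvent.
      by move=> x /(psi_gt B0) h'; rewrite invr_ge0 ltW.
    by rewrite -h.
  by split => //; rewrite h EFin_Rintegral.
have h := Stieltjes_left mD0 qD0 (psi_lt_lp p) psi_neq.
have ip : intg (fun x => (x - psi)^-1).
  apply: ge0_integrable_fin_num.
  - apply: (measurableT_comp (@measurable_invr R)); exact: measurable_funB.
  - by move=> x /(psi_lt B0) h'; rewrite invr_ge0 ltW.
  - by move: fin; rewrite h fin_numN.
have ip' : intg (fun x => (psi - x)^-1).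
  have := integrableZl_EFin mD0 (-1) ip; apply: eq_integrable => // x _ /=.
  by rewrite mulN1r -invrN opprB.
split => //; rewrite h EFin_Rintegral// -EFinN; congr (_%:E).
rewrite -mulN1r -RintegralZl//; apply: eq_Rintegral => x _.
by rewrite mulN1r -invrN opprB.
Qed.

Let kE x : (B * (th - x) + be)^-1 = B^-1 * (psi - x)^-1.
Proof. by rewrite denE invfM. Qed.

Let ik : intg (fun x => (B * (th - x) + be)^-1).
Proof.
have := integrableZl_EFin mD0 B^-1 Spsi.1.
by apply: eq_integrable => // x _ /=; rewrite kE.
Qed.

Local Notation g := (\int[q]_(x in D0) (th - x)^-1).
Local Notation K := (\int[q]_(x in D0) (B * (th - x) + be)^-1).
Local Notation P := (\int[q]_(x in D0) (psi - x)^-1).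
Local Notation Elnf :=
  (\int[q]_(x in D0) ln ((B * (th - x) + be) / (th - x))).

Let KE : K = B^-1 * P.
Proof.
by rewrite -RintegralZl//; [apply: eq_Rintegral => x _; rewrite kE|exact: Spsi.1].
Qed.

Let tc : t != 0 -> c != th /\ B * (th - c) + be = 0.
Proof. by move=> /tterm_atom[-> ?]; rewrite denE subrr mulr0. Qed.

Let hs : K + t / (th - c) = s.
Proof.
have [+ _] := hii; rewrite ttermE Spsi.2 -EFinM -EFinD => -[h].
rewrite KE /s; apply: (mulfI B_neq0); apply: (mulfI (lt0r_neq0 G0)).
have -> : G * (B * ((2 * m - th) / G)) = B * (2 * m - th).
  by field; rewrite gt_eqF.
by rewrite h; move: (t / (th - c)) => r; field.
Qed.

Let crit_ge : 0 <= B * s - g + be / G /\ (lp < th -> B * s - g + be / G = 0).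
Proof.
have [h1 _] := hii; have [h2 h3] := hiii.
move: h1 h2 h3; rewrite ttermE Spsi.2 SthE -!EFinM -!EFinD => -[h1].
rewrite !lee_fin => h2 h3.
have GE : G * (B * s - g + be / G) = be - (G * g - G * P - B * G * (t / (th - c))).
  have -> : G * (B * s - g + be / G) = B * (2 * m - th) - G * g + be.
    by rewrite /s; field; rewrite gt_eqF.
  by rewrite h1; ring.
split; first by rewrite -(pmulr_rge0 _ G0) GE subr_ge0.
move=> /h3[h4]; apply: (mulfI (lt0r_neq0 G0)); rewrite GE mulr0 /be h4; ring.
Qed.

Let critical :
  [/\ be < 0, lp < th & B * s - g + be / G = 0] \/
  [/\ 0 < be, B <= 0 \/ t = 0 &
      forall th', lp < th' -> 0 <= (th' - th) * (B * s - g + be / G)].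
Proof.
have [h1 h2] := crit_ge; case: hsign => -[be0 h]; [left|right]; split => //.
  exact: h2.
move=> th' lpth'; have [lth|thl] := ltP lp th; first by rewrite h2// mulr0.
by rewrite mulr_ge0//; lra.
Qed.

Let Lth : intg (fun x => ln (th - x)) /\
  Lpot q th = (\int[q]_(x in D0) ln (th - x))%:E.
Proof.
have i := integrable_ln_sub mD0 D0D th_gt ig; split => //.
by rewrite (Lpot_right mD0 qD0 th_gt) EFin_Rintegral.
Qed.

Let iden : intg (fun x => ln (B * (th - x) + be)).
Proof. exact: (integrable_ln_den mD0 D0D den_gt ik). Qed.

Let lnden x : D0 x -> ln (B * (th - x) + be) = ln `|B| + ln `|psi - x|.
Proof.
move=> Dx; have := den_gt Dx; rewrite denE => h.
rewrite -(gtr0_norm h) normrM lnM ?posrE ?normr_gt0//.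
by apply: contraTneq h => ->; rewrite mulr0 ltxx.
Qed.

Let Lpsi : Lpot q psi = (\int[q]_(x in D0) ln (B * (th - x) + be) - ln `|B|)%:E.
Proof.
have e : (\int[q]_(x in D0) (ln (B * (th - x) + be) - ln `|B|))%:E =
    (\int[q]_(x in D0) ln (B * (th - x) + be) - ln `|B|)%:E.
  rewrite RintegralB//; last exact: integrable_cst_EFin.
  by rewrite Rintegral_probability_cst.
rewrite -e -EFin_Rintegral//; last first.
  by apply: integrableB_EFin => //; exact: integrable_cst_EFin.
case: side => -[B0 p].
  rewrite (Lpot_right mD0 qD0 (fun x => @psi_gt x B0)); apply: eq_integral => x /set_mem Dx.
  by rewrite lnden// [`|psi - _|]gtr0_norm ?psi_gt//; congr (_%:E); ring.
rewrite (Lpot_left mD0 qD0 (fun x => @psi_lt x B0)); apply: eq_integral => x /set_mem Dx.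
by rewrite lnden// distrC [`|x - _|]gtr0_norm ?psi_lt//; congr (_%:E); ring.
Qed.

Let valE : ((ln `|B|)%:E + Lpot q psi - Lpot q th = Elnf%:E)%E.
Proof.
rewrite Lpsi Lth.2 -!EFinD; congr (_%:E).
have -> : Elnf = \int[q]_(x in D0) (ln (B * (th - x) + be) - ln (th - x)).
  by apply: eq_Rintegral => x /set_mem Dx; rewrite ln_div ?posrE ?den_gt ?th_gt.
by rewrite RintegralB//; [ring|exact: Lth.1].
Qed.

Let beK : be * s = - ((th - psi) * P + B * t).
Proof.
rewrite -hs KE; have [->|t_neq0] := eqVneq t 0.
  by rewrite mul0r addr0 mulr0 addr0 /be; field.
have [-> pth] := tterm_atom t_neq0.
by rewrite /be; field; rewrite B_neq0 subr_eq0 eq_sym pth.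
Qed.

Lemma solution_rateH : eq_i lp q B t th psi ->
  rateH G lm lp q m = valH q B th psi.
Proof.
rewrite /eq_i Spsi.2 -EFinM -EFinD => -[hi].
rewrite /valH valE; apply: (rateH_critical mD0 D0D qD0 G0 lmlp th_gt den_gt ig ik
  t0 cD lpth tc hs denD critical).
have := optimizer_mass mD0 D0D qD0 th_gt den_gt ik tc hs.
rewrite -/s beK -hi => h; apply: (mulfI B_neq0); rewrite mulr1; lra.
Qed.

Lemma solution_rateG : B = 1 -> rateG G lm lp q m = valG lp q t th psi.
Proof.
move=> B1; rewrite (rateG_critical mD0 D0D qD0 G0 lmlp th_gt den_gt ig ik
  t0 cD lpth tc hs denD critical B1) /valG; congr (_ * _)%E.
have := valE; rewrite Spsi.2 Lpsi Lth.2 B1 normr1 ln1 add0e -!EFinM -!EFinD => -[h].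
by congr (_%:E); rewrite -h -/s beK B1; ring.
Qed.

End solution.

Section sufficiency.
Context (R : realType) (lm lp : R).
Local Notation T := (measurableTypeR R).
Local Notation D := (`[lm, lp]%classic : set T).
Variable q : probability T R.
Hypotheses (hq : carried_by lm lp q) (lmlp : lm <= lp).

Lemma Hent_ge0 (nu : {finite_measure set T -> \bar R}) : (0 <= Hent q nu)%E.
Proof.
have nufin : nu setT \is a fin_num by exact: fin_num_measure.
have := @Hent_lower R q nu D (fun=> 1) (fine (nu setT)).
under eq_Rintegral do rewrite ln1.
rewrite Rintegral_cst// mul0r sub0r EFinN fineK// addeC subee//; apply => //.
- by apply: (eq_integrable _ (EFin \o cst 0)) => //;
    [move=> x _ /=; rewrite ln1|exact: finite_measure_integrable_cst].
- by rewrite integral_cst// mul1e le_measure ?inE.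
Qed.

Lemma Hent_self : Hent q q = 0%E.
Proof.
rewrite (@Hent_density R q q (fun=> 1))//; last first.
  by move=> A mA; rewrite integral_cst// mul1e.
rewrite (eq_integral (cst 0%E)); last by move=> x _; rewrite lne1.
transitivity (0 + 1 - 1 : \bar R)%E; last by rewrite add0e subee.
by congr (_ + _ - _)%E; [exact: integral0|exact: probability_setT].
Qed.

Lemma rateH_mbar (G m : R) : m%:E = mbar G lp q -> rateH G lm lp q m = 0%E.
Proof.
move=> hm; apply/eqP; rewrite eq_le; apply/andP; split.
  by apply: ereal_inf_lbound; exists q => //; rewrite Hent_self mule0.
apply: le_ereal_inf_tmp => _ [nu _ <-].
by rewrite mule_ge0// Hent_ge0.
Qed.

Lemma rateG_mbar (G m : R) : m%:E = mbar G lp q -> rateG G lm lp q m = 0%E.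
Proof.
move=> hm; apply/eqP; rewrite eq_le; apply/andP; split.
  by apply: ereal_inf_lbound; exists q => //; rewrite Hent_self mule0.
apply: le_ereal_inf_tmp => _ [nu _ <-].
by rewrite mule_ge0// Hent_ge0.
Qed.

Section real_transforms.
Variable a : R.
Hypotheses (lpa : lp <= a) (fin : Stieltjes lp q a \is a fin_num).

Lemma full_setD1 : [/\ measurable (D `\ a), q (~` (D `\ a)) = 0%E &
  forall x, (D `\ a) x -> 0 < a - x].
Proof.
have ms : measurable [set a : T] by exact: measurable_set1.
have mDc : measurable (~` D : set T) by exact: measurableC.
split; first exact: measurableD.
  rewrite setCD; apply: etrans (measureU0 mDc ms _) _ => //.
  by apply: (Stieltjes_fin_atom hq) fin; right.
move=> x [+ xa]; rewrite /= in_itv/= => /andP[_ xlp].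
by rewrite subr_gt0 lt_neqAle (le_trans xlp lpa) andbT; exact/eqP.
Qed.

Lemma integrable_Stieltjes :
  q.-integrable (D `\ a) (EFin \o (fun x => (a - x)^-1)).
Proof.
have [mD0 qD0 pos] := full_setD1.
apply: ge0_integrable_fin_num => //; first exact: measurable_resolvent.
  by move=> x /pos h; rewrite invr_ge0 ltW.
rewrite -(Stieltjes_right mD0 qD0 lpa)//.
by move=> x /pos; rewrite subr_gt0 => /lt_eqF ->.
Qed.

Lemma StieltjesE : Stieltjes lp q a = (\int[q]_(x in D `\ a) (a - x)^-1)%:E.
Proof.
have [mD0 qD0 pos] := full_setD1.
rewrite (Stieltjes_right mD0 qD0 lpa) ?EFin_Rintegral//.
  exact: integrable_Stieltjes.
by move=> x /pos; rewrite subr_gt0 => /lt_eqF ->.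
Qed.

Lemma integrable_Lpot : q.-integrable (D `\ a) (EFin \o (fun x => ln (a - x))).
Proof.
have [mD0 qD0 pos] := full_setD1.
exact: (integrable_ln_sub mD0 (@subDsetl _ D [set a]) pos integrable_Stieltjes).
Qed.

Lemma LpotE : Lpot q a = (\int[q]_(x in D `\ a) ln (a - x))%:E.
Proof.
have [mD0 qD0 pos] := full_setD1.
by rewrite (Lpot_right mD0 qD0 pos) EFin_Rintegral//; exact: integrable_Lpot.
Qed.

End real_transforms.

Variable G : R.
Hypothesis G0 : 0 < G.

Lemma solH_rateH (m B t th psi psis : R) : solH G lm lp q m B t th psi psis ->
  rateH G lm lp q m = valH q B th psi.
Proof.
move=> [[t0 lpth] hi hii hiii].
have Dlp : D lp by rewrite /= in_itv/= lmlp lexx.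
have Dlm : D lm by rewrite /= in_itv/= lmlp lexx.
case=> [[_ [B0 pE ppsi psith]]|[_ [[B0 pE thpsi]|[B0 pE psip]]]|[hm [B0 pE pt]]];
  rewrite pE in hii hiii *.
- apply: (@solution_rateH R lm lp q hq G m B t th psi lp) => //.
  + by left; split => //; rewrite -pE.
  + by left; rewrite pmulr_rlt0// subr_lt0 psith; split => //; rewrite -pE (le_lt_trans ppsi).
- apply: (@solution_rateH R lm lp q hq G m B t th psi lp) => //.
  + by left; split => //; rewrite (le_trans lpth)// ltW.
  + right; rewrite pmulr_rgt0// subr_gt0; split => //; right.
    by case: hii => _; apply; apply/eqP; rewrite gt_eqF// (le_lt_trans lpth).
- have psith : psi <= th by rewrite (le_trans psip)// pE (le_trans lmlp).
  have sd : (0 < B /\ lp <= psi) \/ (B < 0 /\ psi <= lm) by right; rewrite -pE.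
  apply: (@solution_rateH R lm lp q hq G m B t th psi lm) => //.
  right; split; last by left; exact: ltW.
  rewrite nmulr_rgt0// subr_lt0 lt_neqAle psith andbT; apply/eqP => pt.
  have lpm : lp <= lm by rewrite (le_trans lpth)// -pt -pE.
  have fin := Stieltjes_th_fin hq G0 lpth sd hii hiii.
  have := full_setD1 lpth fin => -[_ qD _].
  have : (1 <= q [set th])%E.
    rewrite -(probability_itv hq); apply: le_measure; rewrite ?inE//.
    by move=> x; rewrite /= in_itv/= => /andP[x1 x2]; apply/le_anti/andP; split; rewrite pE in psip; lra.
  by rewrite (Stieltjes_fin_atom hq (or_intror lpth) fin) leNgt lte01.
- rewrite (rateH_mbar hm) /valH pt in hi hii hiii *.
  have sd : (0 < B /\ lp <= th) \/ (B < 0 /\ th <= lm) by left.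
  have tE : t = 0.
    apply: contrapT => /eqP t_neq0.
    have [-> /eqP] := tterm_atom G0 sd hii t_neq0; exact.
  have fin := Stieltjes_th_fin hq G0 lpth sd hii hiii.
  have B1 : B = 1.
    move: hi; rewrite /eq_i tE subrr mul0e mulr0 add0e => -[/eqP].
    by rewrite subr_eq0 => /eqP.
  by rewrite B1 normr1 ln1 add0e (LpotE lpth fin) subee// mule0.
Qed.

Lemma solG_rateG (m t th psi : R) : solG G lp q m t th psi ->
  rateG G lm lp q m = valG lp q t th psi.
Proof.
move=> [[t0 lpth lppsi] hii hiii hne].
have Dlp : D lp by rewrite /= in_itv/= lmlp lexx.
have sd : (0 < 1 :> R /\ lp <= psi) \/ (1 < 0 :> R /\ psi <= lm) by left.
have [psith|thpsi|pt] := ltgtP psi th.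
- apply: (@solution_rateG R lm lp q hq G m 1 t th psi lp) => //.
  by left; rewrite mul1r subr_lt0 psith (le_lt_trans lppsi).
- apply: (@solution_rateG R lm lp q hq G m 1 t th psi lp) => //.
  right; rewrite mul1r subr_gt0; split => //; right.
  by case: hii => _; apply; apply/eqP; rewrite gt_eqF// (le_lt_trans lpth).
have hm : m%:E = mbar G lp q.
  by apply: contrapT => /hne; apply.
rewrite pt in hii hiii sd *; have tE : t = 0.
  apply: contrapT => /eqP t_neq0.
  have [-> /eqP] := tterm_atom G0 sd hii t_neq0; exact.
have fin := Stieltjes_th_fin hq G0 lpth sd hii hiii.
by rewrite (rateG_mbar hm) /valG tE subrr mul0e !add0e (LpotE lpth fin) subee// mule0.
Qed.

Lemma solH_lim_rateH (m be th : R) : solH_lim G lp q m be th ->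
  rateH G lm lp q m = valH_lim q be th.
Proof.
move=> [[_ lpth] hbe hbm hle heq].
have fin : Stieltjes lp q th \is a fin_num.
  move: hle; have := Stieltjes_right_ge0 hq lpth.
  by case: (Stieltjes lp q th) => [//|_|//]; rewrite gt0_muley// leye_eq.
have [mD0 qD0 pos] := full_setD1 lpth fin.
have D0D : D `\ th `<=` D by exact: subDsetl.
have ig := integrable_Stieltjes lpth fin.
have ia : q.-integrable (D `\ th) (EFin \o (fun x => th - x)).
  have := integrable_affine q mD0 D0D 1 th 0; apply: eq_integrable => // x _ /=.
  by rewrite mul1r addr0.
have beE : be = \int[q]_(x in D `\ th) (th - x).
  apply: EFin_inj; rewrite hbe -EFin_Rintegral//.
  rewrite (@integral_setD_null _ _ _ _ setT (D `\ th))//; first by rewrite setTD.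
  by apply/measurable_EFinP; exact: measurable_funB.
have be0 : 0 < be.
  rewrite lt_neqAle; apply/andP; split.
    by apply/eqP => be0; move: hbm; rewrite -be0 mul0r => /eqP; rewrite lt_eqF.
  by rewrite beE; apply: Rintegral_ge0 => x /pos/ltW.
pose s := (2 * m - th) / G.
have sE : be^-1 = s.
  have m0 : 2 * m - th != 0.
    by apply/eqP => h; move: hbm; rewrite h mulr0 => /eqP; rewrite lt_eqF.
  by rewrite /s -hbm; field; rewrite m0 gt_eqF.
have denE x : 0 * (th - x) + be = be by rewrite mul0r add0r.
have ik : q.-integrable (D `\ th) (EFin \o (fun x => (0 * (th - x) + be)^-1)).
  have := integrable_cst_EFin q mD0 be^-1; apply: eq_integrable => // x _ /=.
  by rewrite denE.
have KE : \int[q]_(x in D `\ th) (0 * (th - x) + be)^-1 = be^-1.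
  under eq_Rintegral do rewrite denE.
  by rewrite Rintegral_probability_cst.
have SE := StieltjesE lpth fin.
set g := \int[q]_(x in D `\ th) (th - x)^-1 in SE.
have cge : 0 <= 0 * s - g + be / G.
  by move: hle; rewrite SE -EFinM lee_fin mul0r add0r addrC subr_ge0 ler_pdivlMr// mulrC.
have ceq : lp < th -> 0 * s - g + be / G = 0.
  move=> /heq; rewrite SE -EFinM => -[->]; rewrite mul0r add0r mulrAC mulfV ?gt_eqF//.
  by rewrite mul1r addNr.
rewrite (@rateH_critical R lm lp q (D `\ th) mD0 D0D qD0 G m th 0 be G0 lmlp pos _ ig ik 0 lp)//.
- rewrite /valH_lim (LpotE lpth fin) -EFinB; congr (_ * _%:E)%E.
  have iL := integrable_Lpot lpth fin.
  transitivity (\int[q]_(x in D `\ th) (ln be - ln (th - x))).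
    by apply: eq_Rintegral => x /set_mem/pos h; rewrite denE ln_div.
  rewrite RintegralB//; last exact: integrable_cst_EFin.
  by rewrite Rintegral_probability_cst.
- by move=> x _; rewrite denE.
- by rewrite /= in_itv/= lmlp lexx.
- by rewrite eqxx.
- by rewrite mul0r addr0 KE.
- by move=> x _; rewrite denE ltW.
- right; split => //; first by left.
  move=> th' lpth'; have [lth|thl] := ltP lp th; first by rewrite ceq// mulr0.
  by rewrite mulr_ge0//; lra.
- rewrite addr0 -[RHS](mulfV (lt0r_neq0 be0)) {2}beE -RintegralZr//.
  by apply: eq_Rintegral => x _; rewrite denE.
Qed.

End sufficiency.

(** * Integrals of fractions of affine functions *)

Section fractions.
Context (R : realType) (lm lp : R).
Local Notation T := (measurableTypeR R).
Local Notation D := (`[lm, lp]%classic : set T).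
Variable q : {finite_measure set T -> \bar R}.

Lemma continuous_Rintegral (D0 : set T) (phi : R -> T -> R) (M : T -> R) (a e : R) :
  measurable D0 -> 0 < e -> q.-integrable D0 (EFin \o M) ->
  (forall b, `|b - a| < e -> measurable_fun D0 (phi b)) ->
  (forall b x, `|b - a| < e -> D0 x -> `|phi b x| <= M x) ->
  (forall b x, `|b - a| < e -> D0 x -> {for b, continuous (phi^~ x)}) ->
  {for a, continuous (fun b => \int[q]_(x in D0) phi b x)}.
Proof.
move=> mD0 e0 iM mphi domphi cphi.
have Ie b : (`](a - e), (a + e)[%classic : set R) b -> `|b - a| < e.
  by rewrite /= in_itv/= => /andP[b1 b2]; rewrite ltr_norml; apply/andP; split; lra.
apply: (@continuity_under_integral _ _ _ q phi D0 mD0 (a - e) (a + e) _ _ M iM) => //.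
- move=> b /Ie be; apply: (integrable_bounded_by mD0 _ iM); first exact: mphi.
  by move=> x Dx; exact: domphi.
- by apply: aeW => x Dx b /set_mem/Ie be; exact: cphi.
- by move=> b /Ie be; apply: aeW => x Dx; exact: domphi.
- by rewrite inE/= in_itv/=; apply/andP; split; lra.
Qed.

Lemma affine_ge0 (a b x : R) : lm <= x <= lp -> 0 <= a - b * lm -> 0 <= a - b * lp ->
  0 <= a - b * x.
Proof. by move=> /andP[x1 x2] h1 h2; have [b0|b0] := leP 0 b; nra. Qed.

Lemma affine_ge (a b x e : R) : lm <= x <= lp -> e <= a - b * lm -> e <= a - b * lp ->
  e <= a - b * x.
Proof.
move=> x12 h1 h2; have := @affine_ge0 (a - e) b x x12.
by move=> /(_ ltac:(lra) ltac:(lra)); lra.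
Qed.

Lemma measurable_fraction (A : set T) (a b a' b' : R) :
  measurable_fun A (fun x : T => (a - b * x) / (a' - b' * x) : R).
Proof.
apply: measurable_funTS; apply: measurable_funM.
  by apply: measurable_funB => //; exact: measurable_funM.
apply: (measurableT_comp (@measurable_invr R)).
by apply: measurable_funB => //; exact: measurable_funM.
Qed.

Lemma integrable_fraction (A : set T) (a b a' b' : R) : measurable A -> A `<=` D ->
  0 < a' - b' * lm -> 0 < a' - b' * lp ->
  q.-integrable A (EFin \o (fun x => (a - b * x) / (a' - b' * x))).
Proof.
move=> mA AD h1 h2; pose e := Num.min (a' - b' * lm) (a' - b' * lp).
have e0 : 0 < e by rewrite lt_min h1.
apply: (integrable_bounded_by mA _ (integrable_cst_EFin q mA
    ((`|a| + `|b| * (`|lm| + `|lp|)) / e))); first exact: measurable_fraction.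
move=> x /AD; rewrite /= in_itv/= => x12.
have ex : e <= a' - b' * x by apply: affine_ge; rewrite // ge_min lexx ?orbT.
have dx : 0 < a' - b' * x by exact: lt_le_trans ex.
rewrite normrM normfV (gtr0_norm dx) ler_pM//; [by rewrite invr_ge0 ltW| |by rewrite lef_pV2].
rewrite (le_trans (ler_normB _ _))// lerD2l normrM ler_wpM2l//.
move/andP: x12 => [x1 x2]; rewrite ler_norml.
have := ler_norm lp; have := ler_norm (- lm); rewrite normrN.
have := normr_ge0 lm; have := normr_ge0 lp.
by move=> ? ? ? ?; apply/andP; split; lra.
Qed.

Lemma continuous_fraction (n0 n1 d0 d1 : R -> R) (a : R) :
  continuous n0 -> continuous n1 -> continuous d0 -> continuous d1 ->
  0 < d0 a - d1 a * lm -> 0 < d0 a - d1 a * lp ->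
  {for a, continuous (fun b => \int[q]_(x in D) ((n0 b - n1 b * x) / (d0 b - d1 b * x)))}.
Proof.
move=> cn0 cn1 cd0 cd1 h1 h2.
pose dd y b := d0 b - d1 b * y.
have cdd y : continuous (dd y).
  move=> b; apply: cvgB; first exact: cd0.
  by apply: cvgM; [exact: cd1|exact: cvg_cst].
pose nn y b := n0 b - n1 b * y.
have cnn y : continuous (nn y).
  move=> b; apply: cvgB; first exact: cn0.
  by apply: cvgM; [exact: cn1|exact: cvg_cst].
pose e : R := Num.min (dd lm a) (dd lp a) / 2.
have e0 : 0 < e by rewrite divr_gt0// lt_min h1.
have ee : e + e = Num.min (dd lm a) (dd lp a) by rewrite /e -splitr.
have em : e < dd lm a.
  have : e + e <= dd lm a by rewrite ee ge_min lexx.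
  by lra.
have ep : e < dd lp a.
  have : e + e <= dd lp a by rewrite ee ge_min lexx orbT.
  by lra.
pose M := `|n0 a| + 1 + (`|n1 a| + 1) * (`|lm| + `|lp|).
have [r r0 hr] : exists2 r, 0 < r & forall b, `|b - a| < r ->
    [/\ e < dd lm b, e < dd lp b, `|n0 b| < `|n0 a| + 1 & `|n1 b| < `|n1 a| + 1].
  apply: near_ball; near=> b; split; near: b.
  - by apply: (cvgr_gt (dd lm a)) => //; exact: cdd.
  - by apply: (cvgr_gt (dd lp a)) => //; exact: cdd.
  - by apply: (cvgr_lt `|n0 a|); [apply: cvg_norm; exact: cn0|rewrite ltrDl].
  - by apply: (cvgr_lt `|n1 a|); [apply: cvg_norm; exact: cn1|rewrite ltrDl].
apply: (@continuous_Rintegral D _ (fun=> M / e) a r) => //.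
- exact: integrable_cst_EFin.
- by move=> b _; exact: measurable_fraction.
- move=> b x /hr[b1 b2 b3 b4]; rewrite /= in_itv/= => x12.
  have ex : e <= d0 b - d1 b * x by apply: affine_ge; rewrite // ltW.
  have dx : 0 < d0 b - d1 b * x by exact: lt_le_trans ex.
  rewrite normrM normfV (gtr0_norm dx) ler_pM//; [by rewrite invr_ge0 ltW| |by rewrite lef_pV2].
  rewrite (le_trans (ler_normB _ _))// lerD ?(ltW b3)// normrM ler_pM ?(ltW b4)//.
  move/andP: x12 => [x1 x2]; rewrite ler_norml.
  have := ler_norm lp; have := ler_norm (- lm); rewrite normrN.
  have := normr_ge0 lm; have := normr_ge0 lp.
  by move=> ? ? ? ?; apply/andP; split; lra.
- move=> b x /hr[b1 b2 b3 b4]; rewrite /= in_itv/= => x12.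
  have ex : e <= d0 b - d1 b * x by apply: affine_ge; rewrite // ltW.
  have dx : 0 < d0 b - d1 b * x by exact: lt_le_trans ex.
  apply: cvgM; first exact: (cnn x).
  by apply: cvgV; [rewrite gt_eqF|exact: (cdd x)].
Unshelve. all: by end_near. Qed.

Lemma fraction_limit (a b a' b' C : R) : lm <= lp ->
  (forall x, D x -> 0 <= a - b * x) ->
  (forall x, D x -> 0 <= a' - b' * x) ->
  (forall x, D x -> a' - b' * x = 0 -> 0 < a - b * x) ->
  (forall e : R, 0 < e -> \int[q]_(x in D) ((a - b * x) / (a' + e - b' * x)) <= C) ->
  let D1 := D `&` [set x | 0 < a' - b' * x] in
  [/\ measurable (D1 : set T), q (D `\` D1) = 0%E,
    q.-integrable D1 (EFin \o (fun x => (a - b * x) / (a' - b' * x))) &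
    \int[q]_(x in D1) ((a - b * x) / (a' - b' * x)) <= C].
Proof.
move=> lmlp N0 d0 Nd hC D1.
have maf (u v : R) : measurable_fun [set: T] (fun x : T => u - v * x : R).
  by apply: measurable_funB => //; exact: measurable_funM.
have mpos : measurable ([set x | 0 < a' - b' * x] : set T).
  rewrite (_ : mkset _ = (fun x : T => a' - b' * x) @^-1` `]0, +oo[%classic).
    by rewrite -[X in measurable X]setTI; exact: maf.
  by apply/seteqP; split => x /=; rewrite in_itv/= andbT.
have mD1 : measurable (D1 : set T) by exact: measurableI.
have de (e : R) x : 0 < e -> D x -> 0 < a' + e - b' * x.
  by move=> e0 /d0; lra.
pose f (e : R) (x : T) : R := (a - b * x) / (a' + e - b' * x).
have f0 (e : R) x : 0 < e -> D x -> 0 <= f e x.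
  by move=> e0 Dx; rewrite divr_ge0 ?N0// ltW// de.
have fint (e : R) (A : set T) : 0 < e -> measurable A -> A `<=` D ->
    (\int[q]_(x in A) (f e x)%:E <= C%:E)%E.
  move=> e0 mA AD.
  apply: (@le_trans _ _ (\int[q]_(x in D) (f e x)%:E)%E).
    apply: ge0_subset_integral => //.
      by apply/measurable_EFinP; exact: measurable_fraction.
    by move=> x Dx; rewrite lee_fin f0.
  rewrite EFin_Rintegral ?lee_fin ?hC//.
  by apply: integrable_fraction => //; apply: de => //; rewrite /= in_itv/= lexx lmlp.
pose Z := D `\` D1.
have mZ : measurable (Z : set T) by exact: measurableD.
have ZE x : Z x -> a' - b' * x = 0.
  move=> [Dx]; rewrite /D1 => nD; apply/eqP; rewrite eq_le d0// andbT leNgt.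
  by apply/negP => h; apply: nD.
have mfZ : measurable_fun Z (fun x : T => (a - b * x)%:E).
  by apply/measurable_EFinP; exact: measurable_funTS.
have intZ : (\int[q]_(x in Z) (a - b * x)%:E)%E = 0%E.
  apply/eqP; rewrite eq_le; apply/andP; split; last first.
    by apply: integral_ge0 => x [Dx _]; rewrite lee_fin N0.
  apply/lee_addgt0Pr => e e0; rewrite add0e.
  have C0 : 0 <= C.
    have := fint 1 set0 ltr01 measurable0 (@sub0set _ _).
    by rewrite integral_set0 lee_fin.
  pose e' : R := e / (C + 1).
  have e'0 : 0 < e' by rewrite divr_gt0// ltr_wpDl.
  rewrite (eq_integral (fun x => e'%:E * (f e' x)%:E)%E); last first.
    move=> x /set_mem Zx; rewrite -EFinM; congr (_%:E).
    have := ZE _ Zx; rewrite /f => z.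
    have -> : a' + e' - b' * x = e' by lra.
    by field; rewrite gt_eqF.
  rewrite ge0_integralZl//; last 3 first.
  - by apply/measurable_EFinP; exact: measurable_fraction.
  - by move=> x [Dx _]; rewrite lee_fin f0.
  - by rewrite lee_fin ltW.
  apply: (@le_trans _ _ (e'%:E * C%:E)%E).
    by rewrite lee_pmul2l// fint// => x [].
  rewrite -EFinM lee_fin /e' mulrAC ler_pdivrMr ?ltr_wpDl//.
  by rewrite mulrDr mulr1 lerDl ltW.
have qZ : q Z = 0%E.
  apply/(negligibleP _ mZ).
  have : ae_eq q Z (fun x : T => (a - b * x)%:E) (cst 0%E).
    apply/ae_eq_integral_abs => //; rewrite -[RHS]intZ.
    apply: eq_integral => x /set_mem[Dx _].
    by rewrite gee0_abs// lee_fin N0.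
  apply: negligibleS => x Zx /= /(_ Zx) -[] h.
  by have := Nd _ Zx.1 (ZE _ Zx); rewrite h ltxx.
have D1D : D1 `<=` D by move=> x [].
pose g n x := (f (n.+1%:R^-1) x)%:E.
have e0 n : 0 < n.+1%:R^-1 :> R by rewrite invr_gt0.
have mg n : measurable_fun (D1 : set T) (g n).
  by apply/measurable_EFinP; exact: measurable_fraction.
have g0 n x : D1 x -> (0 <= g n x)%E by move=> /D1D Dx; rewrite lee_fin f0.
have ndg x : D1 x -> nondecreasing_seq (g^~ x).
  move=> /D1D Dx i j ij; rewrite lee_fin /f ler_wpM2l ?N0//.
  rewrite lef_pV2 ?posrE ?de// lerB// lerD2l.
  by rewrite lef_pV2 ?posrE// ler_nat ltnS.
have glim x : D1 x -> limn (g^~ x) = ((a - b * x) / (a' - b' * x))%:E.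
  move=> [Dx /= dx]; apply/cvg_lim => //; apply: cvg_EFin; first exact: nearW.
  apply: cvgM; first exact: cvg_cst.
  apply: cvgV; first by rewrite gt_eqF.
  apply: cvgB; last exact: cvg_cst.
  by rewrite -[X in _ --> X]addr0; apply: cvgD; [exact: cvg_cst|exact: cvg_harmonic].
have intD1 : (\int[q]_(x in D1) ((a - b * x) / (a' - b' * x))%:E <= C%:E)%E.
  rewrite (eq_integral (fun x => limn (g^~ x))); last by move=> x /set_mem/glim.
  rewrite monotone_convergence//; apply: lime_le.
    apply: ereal_nondecreasing_is_cvgn => i j ij; apply: ge0_le_integral => //.
    - by move=> x D1x; exact: g0.
    - by move=> x D1x; exact: ndg.
  by apply: nearW => n; exact: fint.
have iD1 : q.-integrable D1 (EFin \o (fun x => (a - b * x) / (a' - b' * x))).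
  apply/integrableP; split.
    by apply/measurable_EFinP; exact: measurable_fraction.
  rewrite (eq_integral (fun x : T => ((a - b * x) / (a' - b' * x))%:E)).
    by rewrite (le_lt_trans intD1)// ltry.
  move=> x /set_mem[Dx /= dx]; rewrite ger0_norm// divr_ge0 ?N0//.
  exact: ltW.
by split => //; rewrite -lee_fin -EFin_Rintegral.
Qed.

End fractions.

Section fraction_alternative.
Context (R : realType) (lm lp : R).
Local Notation T := (measurableTypeR R).
Local Notation D := (`[lm, lp]%classic : set T).
Variable q : {finite_measure set T -> \bar R}.
Variables (n0 n1 d0 d1 : R -> R) (a b : R).
Hypotheses (lmlp : lm <= lp) (ab : a < b).
Hypotheses (cn0 : continuous n0) (cn1 : continuous n1).
Hypotheses (cd0 : continuous d0) (cd1 : continuous d1).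
Hypothesis N_ge0 : forall s x, a <= s <= b -> D x -> 0 <= n0 s - n1 s * x.
Hypothesis d_gt0 : forall s x, a < s <= b -> D x -> 0 < d0 s - d1 s * x.
Hypothesis d_ge0 : forall x, D x -> 0 <= d0 a - d1 a * x.
Hypothesis N_gt0 : forall x, D x -> d0 a - d1 a * x = 0 -> 0 < n0 a - n1 a * x.

Let I s := \int[q]_(x in D) ((n0 s - n1 s * x) / (d0 s - d1 s * x)).
Let D1 := D `&` [set x | 0 < d0 a - d1 a * x].

Let Dlm : D lm. Proof. by rewrite /= in_itv/= lexx. Qed.
Let Dlp : D lp. Proof. by rewrite /= in_itv/= lexx lmlp. Qed.

Lemma fraction_alternative : I b <= 1 ->
  (exists2 s, a < s <= b & I s = 1) \/
  [/\ measurable (D1 : set T), q (D `\` D1) = 0%E,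
    q.-integrable D1 (EFin \o (fun x => (n0 a - n1 a * x) / (d0 a - d1 a * x))) &
    \int[q]_(x in D1) ((n0 a - n1 a * x) / (d0 a - d1 a * x)) <= 1].
Proof.
move=> Ib; have [|no] := pselect (exists2 s, a < s <= b & I s = 1); first by left.
right.
have I1 s : a < s <= b -> I s <= 1.
  move=> /andP[as_ sb]; rewrite leNgt; apply/negP => Is.
  pose c t := Num.max s (Num.min b t).
  have cc : continuous c.
    move=> t; apply: (@continuous_max R R (fun=> s) (fun t => Num.min b t) t).
      exact: cvg_cst.
    by apply: (@continuous_min R R (fun=> b) id t); [exact: cvg_cst|exact: cvg_id].
  have cb t : a < c t <= b.
    by rewrite lt_max as_/= ge_max sb ge_min lexx.
  have cE t : s <= t <= b -> c t = t.
    by move=> /andP[st tb]; rewrite /c min_r// max_r.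
  have cI : continuous (I \o c).
    move=> t; apply: (@continuous_fraction R lm lp q (n0 \o c) (n1 \o c) (d0 \o c) (d1 \o c)) => //=.
    - by move=> x; apply: continuous_comp; [exact: cc|exact: cn0].
    - by move=> x; apply: continuous_comp; [exact: cc|exact: cn1].
    - by move=> x; apply: continuous_comp; [exact: cc|exact: cd0].
    - by move=> x; apply: continuous_comp; [exact: cc|exact: cd1].
    - by apply: d_gt0.
    - by apply: d_gt0.
  have h1 : (I \o c) b <= 1 by rewrite /= cE// lexx sb.
  have h2 : 1 <= (I \o c) s by rewrite /= cE ?lexx// ltW.
  have [x /andP[sx xb] /= Ix] := IVT_antitone sb cI h1 h2.
  apply: no; exists (c x) => //.
apply: fraction_limit => //; first by move=> x; apply: N_ge0; rewrite lexx ltW.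
move=> e e0.
pose f t := \int[q]_(x in D) ((n0 t - n1 t * x) / (d0 t + e - d1 t * x)).
apply: (@right_limit_le R f a b 1) => //.
  have h x : D x -> 0 < d0 a + e - d1 a * x by move=> /d_ge0; lra.
  apply: (@continuous_fraction R lm lp q n0 n1 (fun t => d0 t + e) d1) => //.
  - by move=> t; apply: cvgD; [exact: cd0|exact: cvg_cst].
  - exact: h.
  - exact: h.
move=> t at_ tb; have tab : a < t <= b by rewrite at_ ltW.
apply: le_trans (I1 _ tab); apply: le_Rintegral => //.
- apply: (@integrable_fraction R lm lp) => //.
  + by have := d_gt0 tab Dlm; lra.
  + by have := d_gt0 tab Dlp; lra.
- by apply: (@integrable_fraction R lm lp) => //; exact: d_gt0.
move=> x Dx; have h := d_gt0 tab Dx.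
rewrite ler_wpM2l ?N_ge0//; first by rewrite !ltW.
by rewrite lef_pV2 ?posrE//; lra.
Qed.

End fraction_alternative.

(** * Existence of solutions *)

Section real_line_transforms.
Context (R : realType) (lm lp : R).
Local Notation T := (measurableTypeR R).
Local Notation D := (`[lm, lp]%classic : set T).
Variable q : probability T R.
Hypotheses (hq : carried_by lm lp q) (lmlp : lm <= lp).

Lemma carried_full (D1 : set T) : measurable D1 -> D1 `<=` D ->
  q (D `\` D1) = 0%E -> q (~` D1) = 0%E.
Proof.
move=> mD1 D1D qD1.
have mDc : measurable (~` D : set T) by exact: measurableC.
have mDD1 : measurable (D `\` D1 : set T) by exact: measurableD.
apply: (@subset_measure0 _ _ _ q _ (~` D `|` (D `\` D1))) => //.
- exact: measurableC.
- exact: measurableU.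
- by move=> x Dx; have [Dx'|Dx'] := pselect (D x); [right|left].
- by apply: etrans (measureU0 mDc mDD1 qD1) _.
Qed.

(* Right of lp both transforms are finite; at lp itself G(lp) may be +oo.  To
   state continuity on the whole line, arguments below are truncated as
   Num.max a b for a regular point a. *)
Definition stj (a : R) : R := fine (Stieltjes lp q a).
Definition pot (a : R) : R := fine (Lpot q a).
Definition regular (a : R) := lp <= a /\ Stieltjes lp q a \is a fin_num.

Lemma regular_Stieltjes a : regular a -> Stieltjes lp q a = (stj a)%:E.
Proof. by move=> [_ fin]; rewrite /stj fineK. Qed.

Lemma regular_gt a : lp < a -> regular a.
Proof.
move=> lpa; split; first exact: ltW.
rewrite (Stieltjes_right _ hq (ltW lpa))//; last first.
  move=> x; rewrite /= in_itv/= => /andP[_ xlp].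
  by rewrite lt_eqF// (le_lt_trans xlp).
by apply: integrable_fin_num => //; exact: (integrable_resolvent q lpa _ (@subset_refl _ D)).
Qed.

Lemma regular_le a b : regular a -> a <= b -> regular b.
Proof.
move=> ra; rewrite le_eqVlt => /predU1P[<- //|ab].
by apply: regular_gt; rewrite (le_lt_trans ra.1).
Qed.

Section from_regular.
Variable a : R.
Hypothesis ra : regular a.

Lemma full_regular : [/\ measurable (D `\ a), q (~` (D `\ a)) = 0%E &
  forall x, (D `\ a) x -> 0 < a - x].
Proof. exact: (full_setD1 hq ra.1 ra.2). Qed.

Lemma integrable_stj b : a <= b ->
  q.-integrable (D `\ a) (EFin \o (fun x => (b - x)^-1)).
Proof.
move=> ab; have [mD0 qD0 pos] := full_regular.
apply: (integrable_bounded_by mD0 _ (integrable_Stieltjes hq ra.1 ra.2)).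
  exact: measurable_resolvent.
move=> x /pos h; have h' : 0 < b - x by lra.
by rewrite ger0_norm ?invr_ge0 ?(ltW h')// lef_pV2 ?posrE// lerB.
Qed.

Lemma stjE b : a <= b -> stj b = \int[q]_(x in D `\ a) (b - x)^-1.
Proof.
move=> ab; have [mD0 qD0 pos] := full_regular.
rewrite /stj (Stieltjes_right mD0 qD0) ?(le_trans ra.1 ab)//.
move=> x /pos; rewrite subr_gt0 => xa.
by rewrite lt_eqF// (lt_le_trans xa).
Qed.

Lemma integrable_pot b : a <= b ->
  q.-integrable (D `\ a) (EFin \o (fun x => ln (b - x))).
Proof.
move=> ab; have [mD0 qD0 pos] := full_regular.
apply: (integrable_ln_sub mD0 (@subDsetl _ D [set a]) _ (integrable_stj ab)).
by move=> x /pos; lra.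
Qed.

Lemma potE b : a <= b -> pot b = \int[q]_(x in D `\ a) ln (b - x).
Proof.
move=> ab; have [mD0 qD0 pos] := full_regular.
rewrite /pot (Lpot_right mD0 qD0)//.
by move=> x /pos; lra.
Qed.

Lemma stj_le b : a <= b -> stj b <= stj a.
Proof.
move=> ab; have [mD0 qD0 pos] := full_regular.
rewrite !stjE//; apply: le_Rintegral => //; [exact: integrable_stj..|].
move=> x /pos h; have h' : 0 < b - x by lra.
by rewrite lef_pV2 ?posrE// lerB.
Qed.

Lemma stj_ge : (a - lm)^-1 <= stj a.
Proof.
have [mD0 qD0 pos] := full_regular.
rewrite stjE// -[leLHS](Rintegral_probability_cst _ mD0 qD0).
apply: le_Rintegral => //; [exact: integrable_cst_EFin|exact: integrable_stj|].
move=> x Dx; have h := pos _ Dx; case: Dx; rewrite /= in_itv/= => /andP[xlm _] _.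
have h' : 0 < a - lm by lra.
by rewrite lef_pV2 ?posrE// lerB.
Qed.

Lemma regular_gt_lm : lm < a.
Proof.
rewrite lt_neqAle (le_trans lmlp ra.1) andbT; apply/eqP => lma.
have [_ + _] := full_regular.
have -> : D `\ a = set0.
  apply/seteqP; split => // x []; rewrite /= in_itv/= => /andP[x1 x2]; apply.
  by have := ra.1; move=> h; apply/le_anti/andP; split; lra.
rewrite setC0 => h; have := @probability_setT _ _ _ q; rewrite [X in X = _ -> _]h.
by move=> /eqP; rewrite eq_sym onee_eq0.
Qed.

Lemma stj_gt0 : 0 < stj a.
Proof. by rewrite (lt_le_trans _ stj_ge)// invr_gt0 subr_gt0 regular_gt_lm. Qed.

Lemma pot_sub b : a <= b -> (b - a) * stj b <= pot b - pot a <= (b - a) * stj a.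
Proof.
move=> ab; have [mD0 qD0 pos] := full_regular.
have ipa := integrable_pot (lexx a); have ipb := integrable_pot ab.
have isa := integrable_stj (lexx a); have isb := integrable_stj ab.
rewrite !potE// !stjE// -RintegralB// -!RintegralZl//.
have iz f : q.-integrable (D `\ a) (EFin \o f) ->
    q.-integrable (D `\ a) (EFin \o (fun x => (b - a) * f x)).
  by move=> h; exact: integrableZl_EFin.
apply/andP; split.
  apply: le_Rintegral => //; [exact: iz|exact: integrableB_EFin|].
  move=> x /pos h; have h' : 0 < b - x by lra.
  have := ln_sub_le h' h; rewrite (_ : a - x - (b - x) = - (b - a)); last by ring.
  by rewrite mulNr; lra.
apply: le_Rintegral => //; [exact: integrableB_EFin|exact: iz|].
move=> x /pos h; have h' : 0 < b - x by lra.
have := ln_sub_le h h'; rewrite (_ : b - x - (a - x) = b - a); last by ring.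
by [].
Qed.

Lemma continuous_max_sub (x b : R) : {for b, continuous (fun b => Num.max a b - x)}.
Proof.
apply: cvgB; last exact: cvg_cst.
apply: (@continuous_max R R (fun=> a) id b); [exact: cvg_cst|exact: cvg_id].
Qed.

Lemma continuous_stj : continuous (fun b => stj (Num.max a b)).
Proof.
have [mD0 qD0 pos] := full_regular.
have -> : (fun b => stj (Num.max a b)) =
    (fun b => \int[q]_(x in D `\ a) (Num.max a b - x)^-1).
  by apply/funext => b; rewrite stjE// le_max lexx.
move=> b; have pos' x b' : (D `\ a) x -> 0 < Num.max a b' - x.
  by move=> /pos; rewrite subr_gt0 => h; rewrite subr_gt0 lt_max h.
apply: (@continuous_Rintegral R q _ (fun b x => (Num.max a b - x)^-1)
  (fun x => (a - x)^-1) b 1 mD0) => //.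
- exact: integrable_stj.
- by move=> b' _; exact: measurable_resolvent.
- move=> b' x _ Dx; have h := pos' _ b' Dx; have h' := pos _ Dx.
  rewrite ger0_norm ?invr_ge0 ?(ltW h)// lef_pV2 ?posrE// lerB//.
  by rewrite le_max lexx.
- move=> b' x _ Dx; apply: cvgV; first by rewrite gt_eqF// pos'.
  exact: continuous_max_sub.
Qed.

Lemma continuous_pot : continuous (fun b => pot (Num.max a b)).
Proof.
have [mD0 qD0 pos] := full_regular.
have -> : (fun b => pot (Num.max a b)) =
    (fun b => \int[q]_(x in D `\ a) ln (Num.max a b - x)).
  by apply/funext => b; rewrite potE// le_max lexx.
move=> b; have pos' x b' : (D `\ a) x -> 0 < Num.max a b' - x.
  by move=> /pos; rewrite subr_gt0 => h; rewrite subr_gt0 lt_max h.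
pose P := Num.max a (b + 1).
have aP : a <= P by rewrite le_max lexx.
apply: (@continuous_Rintegral R q _ (fun b x => ln (Num.max a b - x))
    (fun x => `|ln (a - x)| + `|ln (P - x)|) b 1 mD0) => //.
- apply: integrableD_EFin => //; apply: integrable_norm => //; exact: integrable_pot.
- by move=> b' _; apply: measurableT_comp => //; exact: measurable_funB.
- move=> b' x; rewrite ltr_norml => /andP[b1 b2] Dx.
  have h := pos' _ b' Dx; have h' := pos _ Dx.
  have h1 : ln (a - x) <= ln (Num.max a b' - x).
    by rewrite ler_ln ?posrE// lerB// le_max lexx.
  have h2 : ln (Num.max a b' - x) <= ln (P - x).
    rewrite ler_ln ?posrE//; last by rewrite (lt_le_trans h')// lerB.
    rewrite lerB// ge_max aP/= le_max; apply/orP; right; lra.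
  have := ler_norm (ln (P - x)); have := ler_norm (- ln (a - x)); rewrite normrN.
  have := normr_ge0 (ln (P - x)); have := normr_ge0 (ln (a - x)).
  by move=> ? ? ? ?; rewrite ler_norml; apply/andP; split; lra.
- move=> b' x _ Dx; apply: continuous_comp; first exact: continuous_max_sub.
  by apply: continuous_ln; exact: pos'.
Qed.

End from_regular.

Lemma stj_le_inv a : lp < a -> stj a <= (a - lp)^-1.
Proof.
move=> lpa; have ra := regular_gt lpa; have [mD0 qD0 pos] := full_regular ra.
rewrite (stjE ra)// -[leRHS](Rintegral_probability_cst _ mD0 qD0).
apply: le_Rintegral => //; [exact: integrable_stj|exact: integrable_cst_EFin|].
move=> x Dx; have h := pos _ Dx; case: Dx; rewrite /= in_itv/= => /andP[_ xlp] _.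
have h' : 0 < a - lp by rewrite subr_gt0.
by rewrite lef_pV2 ?posrE// lerB.
Qed.

Lemma regular_start (C e : R) : 0 < e ->
  exists p, [/\ regular p, p <= lp + e & lp < p -> C <= stj p].
Proof.
move=> e0; have [fin|inf] := boolP (Stieltjes lp q lp \is a fin_num).
  by exists lp; split => //; [rewrite lerDl ltW|rewrite ltxx].
apply: contrapT => no.
have bnd (e' : R) : 0 < e' -> stj (lp + e') <= C.
  move=> e'0; pose p := lp + Num.min e e'.
  have m0 : 0 < Num.min e e' by rewrite lt_min e0.
  have lpp : lp < p by rewrite ltrDl.
  apply: (@le_trans _ _ (stj p)).
    by apply: stj_le; [exact: regular_gt|rewrite lerD2l ge_min lexx orbT].
  rewrite leNgt; apply/negP => h; apply: no; exists p; split.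
  - exact: regular_gt.
  - by rewrite lerD2l ge_min lexx.
  - by move=> _; exact: ltW.
have := @fraction_limit R lm lp q 1 0 lp 1 C lmlp.
case.
- by move=> x _; rewrite mul0r subr0.
- by move=> x; rewrite /= in_itv/= => /andP[_ xlp]; rewrite mul1r subr_ge0.
- by move=> x _ _; rewrite mul0r subr0.
- move=> e' e'0; apply: le_trans (bnd _ e'0).
  have lpe : lp < lp + e' by rewrite ltrDl.
  rewrite /stj (Stieltjes_right _ hq (ltW lpe))//; last first.
    by move=> x; rewrite /= in_itv/= => /andP[_ xlp]; rewrite lt_eqF// (le_lt_trans xlp).
  rewrite le_eqVlt; apply/orP; left; apply/eqP; apply: eq_Rintegral => x _.
  by rewrite mul0r subr0 !mul1r.
move=> mD1 qD1 iD1 _; move/negP: inf; apply.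
set D1 := _ `&` _ in mD1 qD1 iD1.
have qD1' : q (~` D1) = 0%E by apply: carried_full => // x [].
rewrite (Stieltjes_right mD1 qD1' (lexx lp)); last first.
  by move=> x [_ /=]; rewrite mul1r subr_gt0 => h; rewrite lt_eqF.
apply: integrable_fin_num => //; apply: eq_integrable iD1 => // x _ /=.
by rewrite mul0r subr0 !mul1r.
Qed.

End real_line_transforms.

Section existence.
Context (R : realType) (lm lp : R).
Local Notation T := (measurableTypeR R).
Local Notation D := (`[lm, lp]%classic : set T).
Variable q : probability T R.
Hypotheses (hq : carried_by lm lp q) (lmlp : lm <= lp).
Variable G : R.
Hypothesis G0 : 0 < G.

Local Notation stj := (stj lp q).
Local Notation pot := (pot q).
Local Notation regular := (regular lp q).

Section intro.
Variables (m B t th psi c sg : R).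
Hypotheses (rth : regular th) (Spsi : Stieltjes lp q psi = sg%:E) (t0 : 0 <= t).
Hypothesis tc : t != 0 -> c = psi /\ c != th.
Hypothesis hii : B * (2 * m - th) = G * sg + B * G * (t / (th - c)).
Hypothesis hiii : G * stj th - B * (2 * m - th) <= B * (psi - th).
Hypothesis hiii_eq : lp < th -> B * (psi - th) = G * stj th - B * (2 * m - th).

Lemma eq_ii_intro : eq_ii G lp q m B t th psi c.
Proof.
split; last first.
  by move=> cpsi; apply: contrapT => /eqP/tc[h _]; apply: cpsi.
by rewrite Spsi tterm_real ?hii// => /tc[].
Qed.

Lemma ineq_iii_intro : ineq_iii G lp q B t th psi c.
Proof.
have tc' : t != 0 -> c != th by move=> /tc[].
rewrite /ineq_iii tterm_real// Spsi (regular_Stieltjes rth) -!EFinM -!EFinN -!EFinD.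
have -> : G * stj th - G * sg - B * G * (t / (th - c)) = G * stj th - B * (2 * m - th).
  by rewrite hii; ring.
by split; [rewrite lee_fin|move=> /hiii_eq <-].
Qed.

Lemma solH_intro : B - 1 = (th - psi) * sg + B * t ->
  branchH G lm lp q m B th psi c -> solH G lm lp q m B t th psi c.
Proof.
move=> hi hb; split => //; first by split => //; exact: rth.1.
- by rewrite /eq_i Spsi hi.
- exact: eq_ii_intro.
- exact: ineq_iii_intro.
Qed.

Lemma solG_intro : B = 1 -> c = lp -> lp <= psi -> (m%:E <> mbar G lp q -> th <> psi) ->
  solG G lp q m t th psi.
Proof.
move=> B1 clp lppsi ne; split => //; first by split => //; exact: rth.1.
- by have := eq_ii_intro; rewrite B1 clp.
- by have := ineq_iii_intro; rewrite B1 clp.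
Qed.

End intro.

Lemma resolvent_stj (th : R) : lp < th -> resolvent lm lp q th = stj th.
Proof.
move=> lpth; have rth := regular_gt hq lpth.
have := Stieltjes_right (measurable_itv `[lm, lp]) hq (ltW lpth).
rewrite /stj => -> //; move=> x; rewrite /= in_itv/= => /andP[_ xlp].
by rewrite lt_eqF// (le_lt_trans xlp).
Qed.

Lemma mbar_real : exists mb : R, mb%:E = mbar G lp q.
Proof.
suff : mbar G lp q \is a fin_num by move=> /fineK <-; eexists.
rewrite /mbar /Ffun fin_numM// fin_numElt; apply/andP; split.
  apply: (@lt_le_trans _ _ lp%:E); first exact: ltNyr.
  apply: le_ereal_inf_tmp => y [th /=]; rewrite in_itv/= andbT => lpth <-.
  rewrite (integral_resolvent hq lpth) -EFinM -EFinD lee_fin.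
  rewrite ler_wpDr ?(ltW lpth)// mulr_ge0 ?(ltW G0)//.
  apply: Rintegral_ge0 => x; rewrite /= in_itv/= => /andP[_ xlp].
  by rewrite invr_ge0; lra.
have lpth : lp < lp + 1 by lra.
apply: (@le_lt_trans _ _ (lp + 1 + G * resolvent lm lp q (lp + 1))%:E); last exact: ltry.
apply: ereal_inf_lbound; exists (lp + 1); first by rewrite /= in_itv/= lpth.
by rewrite (integral_resolvent hq lpth).
Qed.

Section with_mbar.
Variable mb : R.
Hypothesis mbE : mb%:E = mbar G lp q.

Lemma mbar_le_gt (th : R) : lp < th -> 2 * mb <= th + G * stj th.
Proof.
by move=> lpth; have /(FfunP hq)[/(_ _ lpth) + _] := mbE; rewrite resolvent_stj.
Qed.

Lemma mbar_approx (e : R) : 0 < e ->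
  exists2 th, lp < th & th + G * stj th <= 2 * mb + e.
Proof.
move=> e0; have /(FfunP hq)[_ /(_ _ e0)[th lpth h]] := mbE.
by exists th => //; rewrite -resolvent_stj.
Qed.

Lemma mbar_le (th : R) : regular th -> 2 * mb <= th + G * stj th.
Proof.
move=> rth; have := rth.1; rewrite le_eqVlt => /predU1P[lpe|]; last exact: mbar_le_gt.
have c : continuous (fun b => Num.max th b + G * stj (Num.max th b)).
  move=> b; apply: cvgD; first exact: continuous_maxr.
  by apply: cvgM; [exact: cvg_cst|exact: (continuous_stj hq rth)].
rewrite leNgt; apply/negP => h.
have := cvgr_lt _ (c th) (2 * mb); rewrite /= maxxx => /(_ _ h) /near_ball[e e0 he].
have := he (th + e / 2); rewrite addrAC subrr add0r gtr0_norm ?divr_gt0//.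
rewrite ltr_pdivrMr// ltr_pMr// ltr1n => /(_ isT).
rewrite max_r; last by rewrite lerDl divr_ge0// ltW.
rewrite ltNge mbar_le_gt// lpe ltrDl divr_gt0//.
Qed.

Lemma mbar_attained : exists2 th, regular th & th + G * stj th = 2 * mb.
Proof.
pose K := 2 * mb + 2.
have [p [rp ple pC]] := regular_start hq lmlp ((K - lp) / G) ltr01.
pose h b := Num.max p b + G * stj (Num.max p b).
have c : continuous h.
  move=> b; apply: cvgD; first exact: continuous_maxr.
  by apply: cvgM; [exact: cvg_cst|exact: (continuous_stj hq rp)].
pose M := Num.max p K.
have pM : p <= M by rewrite le_max lexx.
have [th thpM hmin] := EVT_min pM (continuous_subspaceT c).
have pth : p <= th by move: thpM; rewrite in_itv/= => /andP[].
have rth := regular_le hq rp pth.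
exists th => //; apply/eqP; rewrite eq_le (mbar_le rth) andbT.
apply/ler_addgt0Pr => e e0.
pose e' := Num.min e 1.
have e'0 : 0 < e' by rewrite lt_min e0 ltr01.
have e'1 : e' <= 1 by rewrite ge_min lexx orbT.
have e'e : e' <= e by rewrite ge_min lexx.
have [th' lpth' hth'] := mbar_approx e'0.
have rth' := regular_gt hq lpth'.
have s'0 := stj_gt0 hq lmlp rth'.
have hK : th' + G * stj th' < K by rewrite /K; lra.
have th'K : th' <= K by have := mulr_gt0 G0 s'0; lra.
have pth' : p <= th'.
  rewrite leNgt; apply/negP => th'p.
  have lpp : lp < p by exact: lt_trans th'p.
  have h1 := pC lpp; have h2 := stj_le hq rth' (ltW th'p).
  have : K - lp <= G * stj th' by rewrite -ler_pdivrMl// mulrC (le_trans h1).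
  lra.
have := hmin th'; rewrite in_itv/= pth' le_max th'K orbT => /(_ isT).
by rewrite /h !max_r//; lra.
Qed.

End with_mbar.

Lemma solH_mbar (m : R) : m%:E = mbar G lp q ->
  exists B t th psi psis, solH G lm lp q m B t th psi psis.
Proof.
move=> hm; have [th rth hth] := mbar_attained hm.
exists 1, 0, th, th, lp; apply: (@solH_intro m 1 0 th th lp (stj th)) => //.
- exact: regular_Stieltjes.
- by rewrite eqxx.
- by rewrite mul0r mulr0 addr0 mul1r -hth; ring.
- by rewrite mul1r -hth subrr mulr0; lra.
- by move=> _; rewrite -hth; ring.
- by ring.
- by apply: Or33; split => //; split.
Qed.

Lemma solG_mbar (m : R) : m%:E = mbar G lp q ->
  exists t th psi, solG G lp q m t th psi.
Proof.
move=> hm; have [th rth hth] := mbar_attained hm.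
exists 0, th, th; apply: (@solG_intro m 1 0 th th lp (stj th)) => //.
- exact: regular_Stieltjes.
- by rewrite eqxx.
- by rewrite mul0r mulr0 addr0 mul1r -hth; ring.
- by rewrite mul1r -hth subrr mulr0; lra.
- by move=> _; rewrite -hth; ring.
- exact: rth.1.
Qed.

Section above.
Variables (m mb : R).
Hypotheses (mbE : mb%:E = mbar G lp q) (mbm : mb < m).

Lemma lp_lt_2m : lp < 2 * m.
Proof.
have [th rth hth] := mbar_attained mbE.
by have := mbm; have := mulr_gt0 G0 (stj_gt0 hq lmlp rth); have := rth.1; lra.
Qed.

(* Phi is y for rateG and - ln (1 - y) for rateH; dPhi is its derivative and
   becomes the value of B. *)
Variables (Phi dPhi : R -> R) (Bmax : R).
Let Y := (2 * m - lp) ^+ 2 / (4 * G).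
Hypotheses (cPhi : continuous Phi) (Phi0 : Phi 0 = 0).
Hypothesis tangentPhi : forall y z, 0 <= y <= Y -> 0 <= z <= Y ->
  Phi y + dPhi y * (z - y) <= Phi z.
Hypothesis dPhi_bounds : forall y, 0 <= y <= Y -> 1 <= dPhi y <= Bmax.

Let y th psi := (th - psi) * (2 * m - th) / G.

Let yY th psi : lp <= psi -> psi <= th -> th <= 2 * m -> 0 <= y th psi <= Y.
Proof.
move=> h1 h2 h3; apply/andP; split.
  by rewrite divr_ge0 ?(ltW G0)// mulr_ge0; lra.
rewrite /y /Y ler_pdivrMr// invfM mulrA divfK ?gt_eqF//.
rewrite ler_pdivlMr//.
have : (th - psi) * (2 * m - th) <= (th - lp) * (2 * m - th).
  by rewrite ler_wpM2r; lra.
have : 0 <= (2 * th - lp - 2 * m) ^+ 2 by rewrite sqr_ge0.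
by rewrite !expr2; lra.
Qed.

Lemma above_start : exists th psi, [/\ lp < psi, psi < th, th < 2 * m &
  G * stj psi < 2 * m - th].
Proof.
have mbm' := mbm; have e0 : 0 < m - mb by lra.
have [th lpth hth] := mbar_approx mbE e0.
have rth := regular_gt hq lpth.
have s0 := mulr_gt0 G0 (stj_gt0 hq lmlp rth).
pose a := (lp + th) / 2.
have lpa : lp < a by rewrite /a; lra.
have ath : a < th by rewrite /a; lra.
have ra := regular_gt hq lpa.
have c : continuous (fun b => G * stj (Num.max a b)).
  by move=> b; apply: cvgM; [exact: cvg_cst|exact: (continuous_stj hq ra)].
apply: contrapT => no.
have : 2 * m - th <= G * stj (Num.max a th).
  apply: (@left_limit_ge R (fun b => G * stj (Num.max a b)) th a) => //; first exact: c.
  move=> b ab bth.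
  rewrite leNgt; apply/negP => h; apply: no; exists th, b; split => //.
  - exact: lt_trans ab.
  - lra.
  - by move: h; rewrite max_r// ltW.
rewrite max_r ?(ltW ath)//; lra.
Qed.

Lemma pot_le (a b : R) : regular a -> a <= b -> pot a <= pot b.
Proof.
move=> ra ab; have /andP[h _] := pot_sub hq ra ab.
rewrite -subr_ge0 (le_trans _ h)// mulr_ge0 ?subr_ge0//.
exact: ltW (stj_gt0 hq lmlp (regular_le hq ra ab)).
Qed.

Lemma above_maximum (p : R) : regular p -> p <= 2 * m ->
  exists th psi, [/\ p <= psi, psi <= th, th <= 2 * m &
    forall th' psi', p <= psi' -> psi' <= th' -> th' <= 2 * m ->
      pot psi' - pot th' + Phi (y th' psi') <= pot psi - pot th + Phi (y th psi)].
Proof.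
move=> rp pm.
pose W (z : R * R) := pot (Num.max p (Num.min z.1 z.2)) - pot (Num.max p z.1)
  + Phi (y z.1 (Num.min z.1 z.2)).
have cmin : continuous (fun z : R * R => Num.min z.1 z.2).
  move=> z; apply: (@continuous_min R _ fst snd z); [exact: cvg_fst|exact: cvg_snd].
have cW : continuous W.
  move=> z; apply: cvgD; first apply: cvgB.
  - apply: (@continuous_comp _ _ _ (fun z : R * R => Num.min z.1 z.2)
      (fun b => pot (Num.max p b))); [exact: cmin|exact: (continuous_pot hq rp)].
  - apply: (@continuous_comp _ _ _ fst (fun b => pot (Num.max p b))).
      exact: cvg_fst.
    exact: (continuous_pot hq rp).
  - apply: (@continuous_comp _ _ _ (fun z : R * R => y z.1 (Num.min z.1 z.2)) Phi);
      last exact: cPhi.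
    apply: cvgM; last exact: cvg_cst.
    apply: cvgM; first by apply: cvgB; [exact: cvg_fst|exact: cmin].
    by apply: cvgB; [exact: cvg_cst|exact: cvg_fst].
pose A := (`[p, 2 * m]%classic `*` `[p, 2 * m]%classic) : set (R * R).
have cA : compact A by apply: compact_setX; exact: segment_compact.
have A0 : A !=set0 by exists (p, p); split; rewrite /= in_itv/= lexx.
have [[th psi] /set_mem[/= th1 psi1] hmax] := compact_EVT_max A0 cA (continuous_subspaceT cW).
move: th1 psi1; rewrite !in_itv/= => /andP[th1 th2] /andP[psi1 psi2].
exists th, (Num.min th psi); split => //.
- by rewrite le_min th1.
- by rewrite ge_min lexx.
move=> th' psi' h1 h2 h3.
have := hmax (th', psi'); rewrite inE => /(_ _).
rewrite /W/= !(min_r h2) (max_r h1) (max_r (le_trans h1 h2)) (max_r th1).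
rewrite [Num.max p (Num.min th psi)]max_r; last by rewrite le_min th1.
by apply; split; rewrite /= in_itv/= ?h1 ?h3 ?(le_trans h1)// (le_trans h2).
Qed.

Lemma above_critical : exists th psi t, let B := dPhi (y th psi) in
  let s := (2 * m - th) / G in
  [/\ [/\ regular psi, psi < th, th < 2 * m & 0 <= y th psi <= Y],
      0 <= t /\ (t != 0 -> psi = lp),
      B * s = stj psi + B * (t / (th - lp)) &
      stj th = B * (s - (th - psi) / G)].
Proof.
have [th1 [psi1 [lppsi1 psith1 th1m hpsi1]]] := above_start.
pose C := Bmax * ((2 * m - lp) / G) + 1.
have e0 : 0 < psi1 - lp by rewrite subr_gt0.
have [p [rp pe pC]] := regular_start hq lmlp C e0.
have ppsi1 : p <= psi1 by lra.
have [|th [psi [ppsi psith thm hmax]]] := above_maximum rp; first by lra.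
have lpp := rp.1.
have rpsi := regular_le hq rp ppsi.
have rth := regular_le hq rpsi psith.
have yE a : y a a = 0 by rewrite /y subrr !mul0r.
have Y0 : 0 <= (0 : R) <= Y.
  by rewrite lexx/= /Y divr_ge0 ?sqr_ge0// mulr_ge0 ?(ltW G0).
have Wpos : 0 < pot psi - pot th + Phi (y th psi).
  apply: lt_le_trans (hmax th1 psi1 ppsi1 (ltW psith1) (ltW th1m)).
  have /andP[_ h1] := pot_sub hq (regular_gt hq lppsi1) (ltW psith1).
  have yb := yY (ltW lppsi1) (ltW psith1) (ltW th1m).
  have := tangentPhi Y0 yb; rewrite Phi0 add0r subr0 => h2.
  have /andP[h3 _] := dPhi_bounds Y0.
  have h4 : y th1 psi1 <= dPhi 0 * y th1 psi1 by rewrite ler_peMl//; case/andP: yb.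
  have : (th1 - psi1) * stj psi1 < y th1 psi1.
    rewrite /y -mulrA ltr_pM2l ?subr_gt0// ltr_pdivlMr//; lra.
  by lra.
have lt_psith : psi < th.
  rewrite lt_neqAle psith andbT; apply/eqP => e; move: Wpos.
  by rewrite e yE Phi0 subrr addr0 ltxx.
have lt_thm : th < 2 * m.
  rewrite lt_neqAle thm andbT; apply/eqP => e; move: Wpos.
  rewrite {2}e /y e subrr mulr0 mul0r Phi0 addr0 subr_gt0 ltNge -e.
  by rewrite (pot_le rpsi psith).
have yb := yY (le_trans lpp ppsi) psith thm.
set B := dPhi (y th psi); set s := (2 * m - th) / G.
have /andP[B1 BM] := dPhi_bounds yb; rewrite -/B in B1 BM.
have B0 : 0 < B by lra.
have key th' psi' : p <= psi' -> psi' <= th' -> th' <= 2 * m ->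
    pot psi' - pot th' - pot psi + pot th <= B * (y th psi - y th' psi').
  move=> h1 h2 h3; have := hmax _ _ h1 h2 h3.
  have := tangentPhi yb (yY (le_trans lpp h1) h2 h3); rewrite -/B.
  by rewrite !mulrBr; lra.
have stj_ub : stj psi <= B * s.
  have := @right_limit_le R (fun b => stj (Num.max p b)) psi th (B * s).
  rewrite max_r//; apply => //; first exact: (continuous_stj hq rp).
  move=> b pb bth; have ppb : p <= b by rewrite (le_trans ppsi)// ltW.
  rewrite max_r//.
  have := key th b ppb (ltW bth) thm.
  have -> : B * (y th psi - y th b) = (b - psi) * (B * s) by rewrite /y /s; ring.
  have /andP[h _] := pot_sub hq rpsi (ltW pb).
  move=> h'; rewrite -(@ler_pM2l _ (b - psi)) ?subr_gt0//; lra.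
have stj_lb : p < psi -> B * s <= stj psi.
  move=> lt_ppsi.
  have := @left_limit_ge R (fun b => stj (Num.max p b)) psi p (B * s).
  rewrite max_r//; apply => //; first exact: (continuous_stj hq rp).
  move=> b pb bpsi; rewrite max_r ?(ltW pb)//.
  have := key th b (ltW pb) (le_trans (ltW bpsi) psith) thm.
  have -> : B * (y th psi - y th b) = - ((psi - b) * (B * s)) by rewrite /y /s; ring.
  have /andP[_ h] := pot_sub hq (regular_le hq rp (ltW pb)) (ltW bpsi).
  move=> h'; rewrite -(@ler_pM2l _ (psi - b)) ?subr_gt0//; lra.
pose k := B * (s - (th - psi) / G).
have caff (u v : R) : continuous (fun x : R => u - B * ((x - v) / G)).
  move=> x; apply: cvgB; first exact: cvg_cst.
  apply: cvgM; first exact: cvg_cst.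
  apply: cvgM; last exact: cvg_cst.
  by apply: cvgB; [exact: cvg_id|exact: cvg_cst].
have yd b : B * (y b psi - y th psi) = (b - th) * (k - B * ((b - th) / G)).
  by rewrite /y /k /s; field; rewrite gt_eqF.
have th_ge : k <= stj th.
  have := @right_limit_le R (fun x => k - B * ((x - th) / G)) th (2 * m) (stj th).
  rewrite subrr mul0r mulr0 subr0; apply => //; first exact: caff.
  move=> b thb bm.
  have h1 := key b psi ppsi (le_trans psith (ltW thb)) (ltW bm).
  have h2 := yd b; have /andP[_ h] := pot_sub hq rth (ltW thb).
  rewrite -(@ler_pM2l _ (b - th)) ?subr_gt0// -h2; lra.
have th_le : stj th <= k.
  have := @left_limit_ge R (fun x => k - B * ((x - th) / G)) th psi (stj th).
  rewrite subrr mul0r mulr0 subr0; apply => //; first exact: caff.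
  move=> b psib bth.
  have h1 := key b psi ppsi (ltW psib) (le_trans (ltW bth) thm).
  have h2 := yd b; have /andP[h _] := pot_sub hq (regular_le hq rpsi (ltW psib)) (ltW bth).
  rewrite -(@ler_pM2l _ (th - b)) ?subr_gt0//.
  have -> : (th - b) * (k - B * ((b - th) / G)) = - (B * (y b psi - y th psi)).
    by rewrite h2; ring.
  lra.
have thE : stj th = k by apply/le_anti/andP.
have [lt_ppsi|le_psip] := ltP p psi.
  exists th, psi, 0; split => //.
  - by split => //; rewrite eqxx.
  - by rewrite mul0r mulr0 addr0; apply/le_anti; rewrite stj_ub stj_lb.
have psip : psi = p by apply/le_anti; rewrite le_psip.
have plp : p = lp.
  apply/le_anti; rewrite lpp andbT leNgt; apply/negP => lt_lpp.
  have := pC lt_lpp; rewrite -psip leNgt => /negP; apply.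
  rewrite (le_lt_trans stj_ub)// /C.
  have : B * s <= Bmax * ((2 * m - lp) / G).
    rewrite ler_pM ?(ltW B0)//; first by rewrite divr_ge0 ?(ltW G0)//; lra.
    by rewrite ler_pM2r ?invr_gt0//; have := rth.1; lra.
  lra.
exists th, psi, ((th - lp) * (s - stj psi / B)); split => //.
- split; last by rewrite psip plp.
  apply: mulr_ge0; first by have := rth.1; lra.
  by rewrite subr_ge0 ler_pdivrMr// mulrC.
- have thlp : th - lp != 0 by rewrite -plp -psip subr_eq0 gt_eqF.
  have aux (b s' z w : R) : b != 0 -> w != 0 -> b * s' = z + b * (w * (s' - z / b) / w).
    by move=> ? ?; field; apply/andP.
  by apply: aux; rewrite // gt_eqF.
Qed.

End above.

Lemma solG_above (m mb : R) : mb%:E = mbar G lp q -> mb < m ->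
  exists t th psi, solG G lp q m t th psi.
Proof.
move=> mbE mbm.
have [||y z _ _|y _|th [psi [t [[rpsi psith thm _] [t0 tc] hs hst]]]] :=
  @above_critical m mb mbE mbm id (fun=> 1) 1.
- by move=> x; exact: cvg_id.
- by [].
- by lra.
- by rewrite lexx.
have rth := regular_le hq rpsi (ltW psith); have Gn0 := lt0r_neq0 G0.
exists t, th, psi; apply: (@solG_intro m 1 t th psi lp (stj psi)) => //.
- exact: regular_Stieltjes.
- by move=> /tc <-; rewrite lt_eqF.
- have := congr1 (fun z => G * z) hs; rewrite !mul1r mulrCA mulfV// mulr1 => ->.
  by rewrite mulrDr.
- rewrite hst !mul1r mulrBr !(mulrCA G) mulfV// !mulr1; lra.
- by move=> _; rewrite hst !mul1r mulrBr !(mulrCA G) mulfV// !mulr1; ring.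
- exact: rpsi.1.
- by move=> _ /eqP; rewrite gt_eqF.
Qed.

Lemma solH_above (m mb : R) : mb%:E = mbar G lp q -> mb < m ->
  (2 * m - lp) ^+ 2 < 4 * G -> exists B t th psi psis, solH G lm lp q m B t th psi psis.
Proof.
move=> mbE mbm mG; set Y := (2 * m - lp) ^+ 2 / (4 * G).
have Y1 : Y < 1 by rewrite ltr_pdivrMr ?mul1r// mulr_gt0.
have y1 y : y <= Y -> 0 < 1 - y by lra.
have maxE y : y <= Y -> Num.max (1 - Y) (1 - y) = 1 - y.
  by move=> yY; rewrite max_r//; lra.
have cPhi : continuous (fun y : R => - ln (Num.max (1 - Y) (1 - y))).
  move=> y; apply: cvgN.
  suff : {for y, continuous (fun y : R => ln (Num.max (1 - Y) (1 - y)))} by [].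
  apply: continuous_comp.
    apply: (@continuous_max R R (fun=> 1 - Y) (fun y => 1 - y) y); first exact: cvg_cst.
    by apply: cvgB; [exact: cvg_cst|exact: cvg_id].
  by apply: continuous_ln; rewrite lt_max subr_gt0 Y1.
have [||y z /andP[y0 yY] /andP[z0 zY]|y /andP[y0 yY]|
    th [psi [t [[rpsi psith thm /andP[yy0 yyY]] [t0 tc]]]]] :=
  @above_critical m mb mbE mbm (fun y => - ln (Num.max (1 - Y) (1 - y)))
    (fun y => (1 - y)^-1) (1 - Y)^-1.
- by [].
- have Y0 : 0 <= Y by rewrite divr_ge0 ?sqr_ge0// mulr_ge0// ltW.
  by rewrite maxE// subr0 ln1 oppr0.
- rewrite !maxE//; have := ln_sub_le (y1 _ yY) (y1 _ zY).
  rewrite (_ : 1 - z - (1 - y) = - (z - y)); last by ring.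
  by rewrite mulNr [(1 - y)^-1 * _]mulrC; lra.
- have h := y1 _ yY; have h' := y1 _ (lexx Y).
  by rewrite -[leLHS]invr1 !lef_pV2 ?posrE//; apply/andP; split; rewrite /Y; lra.
set yy := (th - psi) * (2 * m - th) / G in yy0 yyY *; set B := (1 - yy)^-1 => hs hst.
have rth := regular_le hq rpsi (ltW psith); have Gn0 := lt0r_neq0 G0.
have B0 : 0 < B by rewrite invr_gt0 y1.
have Byy : B * (1 - yy) = 1 by rewrite mulVf// gt_eqF// y1.
have thlp : th - lp != 0.
  by rewrite subr_eq0 gt_eqF//; exact: le_lt_trans rpsi.1 psith.
exists B, t, th, psi, lp; apply: (@solH_intro m B t th psi lp (stj psi)) => //.
- exact: regular_Stieltjes.
- by move=> /tc <-; rewrite lt_eqF.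
- have := congr1 (fun z => G * z) hs; rewrite !(mulrCA G) mulfV// mulr1 => ->.
  by rewrite mulrDr mulrA (mulrC G B).
- rewrite hst mulrCA [G * _]mulrBr !(mulrCA G) mulfV// !mulr1; lra.
- by move=> _; rewrite hst mulrCA [G * _]mulrBr !(mulrCA G) mulfV// !mulr1; ring.
- have := congr1 (fun z => (th - psi) * z) hs; rewrite mulrDr.
  have -> : (th - psi) * (B * ((2 * m - th) / G)) = B - B * (1 - yy).
    by rewrite /yy; ring.
  rewrite Byy => ->; congr (_ + _); have [->|/tc psilp] := eqVneq t 0; first by rewrite mul0r !mulr0.
  by rewrite psilp mulrCA [(th - lp) * _]mulrC divfK.
- by apply: Or31; split; [rewrite -mbE lte_fin|split => //; exact: rpsi.1].
Qed.

Lemma stj_large (r : R) : 0 < r -> regular (lp + G / r) /\ G * stj (lp + G / r) <= r.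
Proof.
move=> r0; have h : 0 < G / r by rewrite divr_gt0.
have lpa : lp < lp + G / r by rewrite ltrDl.
split; first exact: (regular_gt hq lpa).
apply: (@le_trans _ _ (G * (G / r)^-1)).
  rewrite ler_pM2l//; have := stj_le_inv hq lpa.
  by rewrite (_ : lp + G / r - lp = G / r)//; ring.
by rewrite invf_div mulrCA mulfV ?mulr1// gt_eqF.
Qed.

Lemma solG_below (m mb : R) : mb%:E = mbar G lp q -> m < mb -> lp < 2 * m ->
  exists t th psi, solG G lp q m t th psi.
Proof.
move=> mbE mmb lpm.
have [ps psE] : exists ps, forall b, ps b = 2 * b - 2 * m + G * stj b by eexists.
have [k kE] : exists k, forall b, k b = 2 * m - b - G * stj (ps b) by eexists.
have ps_gt b : regular b -> b < ps b.
  by move=> /(mbar_le mbE); rewrite psE; lra.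
have psr b : regular b -> regular (ps b).
  by move=> rb; exact: (regular_le hq rb (ltW (ps_gt _ rb))).
have sol th psi : regular th -> th < psi -> 2 * m - th = G * stj psi ->
    ps th <= psi -> (lp < th -> psi = ps th) ->
    exists t th psi, solG G lp q m t th psi.
  move=> rth thpsi h1 h2 h3.
  have rpsi := regular_le hq rth (ltW thpsi).
  exists 0, th, psi; apply: (@solG_intro m 1 0 th psi lp (stj psi)) => //.
  - exact: regular_Stieltjes.
  - by rewrite eqxx.
  - by rewrite mul0r mulr0 addr0 mul1r.
  - by move: h2; rewrite psE !mul1r; lra.
  - by move=> /h3 ->; rewrite psE !mul1r; ring.
  - exact: rpsi.1.
  - by move=> _ /eqP; rewrite lt_eqF.
pose e := (2 * m - lp) / 2.
have e0 : 0 < e by rewrite divr_gt0// subr_gt0.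
have [p [rp ple pC]] := regular_start hq lmlp ((G / e + 2 * m - lp) / G) e0.
have p2m : p <= 2 * m by move: ple; rewrite /e; lra.
have lpp := rp.1.
have [kp|kp] := leP 0 (k p).
  have k2m : k (2 * m) <= 0.
    have r2m := regular_le hq rp p2m.
    by have := mulr_gt0 G0 (stj_gt0 hq lmlp (psr _ r2m)); rewrite kE; lra.
  pose f b := k (Num.max p b).
  have cf : continuous f.
    have cstj : continuous (fun b => G * stj (Num.max p b)).
      by move=> b; apply: cvgM; [exact: cvg_cst|exact: (continuous_stj hq rp)].
    have cps : continuous (fun b => ps (Num.max p b)).
      rewrite (funext psE : ps = _).
      move=> b; apply: cvgD; last exact: cstj.
      apply: cvgB; last exact: cvg_cst.
      by apply: cvgM; [exact: cvg_cst|exact: continuous_maxr].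
    have -> : f = (fun b => 2 * m - Num.max p b - G * stj (Num.max p (ps (Num.max p b)))).
      apply/funext => b; rewrite /f kE (@max_r _ _ p (ps _))//.
      have pb : p <= Num.max p b by rewrite le_max lexx.
      exact: le_trans pb (ltW (ps_gt _ (regular_le hq rp pb))).
    move=> b; apply: cvgB.
      by apply: cvgB; [exact: cvg_cst|exact: continuous_maxr].
    apply: (@continuous_comp _ _ _ (fun b => ps (Num.max p b))
      (fun b => G * stj (Num.max p b))); [exact: cps|exact: cstj].
  have fE b : p <= b -> f b = k b by move=> pb; rewrite /f max_r.
  have f2m : f (2 * m) <= 0 by rewrite (fE _ p2m).
  have fp : 0 <= f p by rewrite (fE _ (lexx p)).
  have [th /andP[pth thm]] := IVT_antitone p2m cf f2m fp.
  rewrite (fE _ pth) => kth.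
  have rth := regular_le hq rp pth.
  by apply: (sol th (ps th)) => //; [exact: ps_gt|move: kth; rewrite kE; lra].
have plp : p = lp.
  apply/le_anti; rewrite lpp andbT leNgt; apply/negP => ltlpp.
  move: kp; rewrite ltNge => /negP; apply.
  have h1 := pC ltlpp; have h2 := ps_gt _ rp.
  have h3 := stj_le_inv hq (le_lt_trans lpp h2).
  have h4 : G / e <= ps p - lp.
    move: h1; rewrite ler_pdivrMr// => h1.
    by rewrite psE; lra.
  have h5 : (ps p - lp)^-1 <= e / G.
    have h6 : 0 < ps p - lp by lra.
    have h7 : 0 < G / e by rewrite divr_gt0.
    by rewrite -[e / G]invf_div lef_pV2 ?posrE.
  have : G * stj (ps p) <= e.
    by rewrite -ler_pdivlMl// mulrC (le_trans h3).
  by rewrite kE; move: ple; rewrite /e; lra.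
rewrite plp in rp kp; have rps := psr _ rp.
have [rL sL] := @stj_large (2 * m - lp) ltac:(lra).
set L := lp + G / (2 * m - lp) in rL sL.
have psL : ps lp <= L.
  rewrite leNgt; apply/negP => /ltW/(stj_le hq rL) h.
  by move: kp; rewrite kE; have := ler_wpM2l (ltW G0) h; lra.
pose f b := G * stj (Num.max (ps lp) b).
have cf : continuous f.
  by move=> b; apply: cvgM; [exact: cvg_cst|exact: (continuous_stj hq rps)].
have fE b : ps lp <= b -> f b = G * stj b by move=> pb; rewrite /f max_r.
have fL : f L <= 2 * m - lp by rewrite (fE _ psL).
have fps : 2 * m - lp <= f (ps lp).
  by rewrite (fE _ (lexx _)); move: kp; rewrite kE; lra.
have [psi /andP[pspsi _]] := IVT_antitone psL cf fL fps.
rewrite (fE _ pspsi) => psiE.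
apply: (sol lp psi) => //.
- exact: lt_le_trans (ps_gt _ rp) _.
- by rewrite ltxx.
Qed.

(* B + be u / G = 1, with u = 2m - th, is (i) and (ii) combined. *)
Lemma solH_of_density (m th B be t : R) (D1 : set T) :
  (m%:E < mbar G lp q)%E -> regular th -> 0 < be ->
  B + be * (2 * m - th) / G = 1 ->
  G * stj th - B * (2 * m - th) <= be ->
  (lp < th -> be = G * stj th - B * (2 * m - th)) ->
  measurable D1 -> D1 `<=` D -> q (~` D1) = 0%E ->
  (forall x, D1 x -> 0 < B * (th - x) + be) -> 0 <= B * (th - lm) + be ->
  q.-integrable D1 (EFin \o (fun x => (th - x) / (B * (th - x) + be))) ->
  0 <= t -> (t != 0 -> B * (th - lm) + be = 0) ->
  \int[q]_(x in D1) ((th - x) / (B * (th - x) + be)) + t = 1 ->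
  (exists B t th psi psis, solH G lm lp q m B t th psi psis) \/
  (exists be th, solH_lim G lp q m be th).
Proof.
move=> mmb rth be0 hu hiii hiii_eq mD1 D1D qD1 den0 denlm iN t0 tlm hN.
have lpth := rth.1; have Gn0 := lt0r_neq0 G0; have ben0 := lt0r_neq0 be0.
have iN' : q.-integrable D1 (EFin \o (fun x => B * ((th - x) / (B * (th - x) + be)))).
  exact: integrableZl_EFin.
have KE x : D1 x -> (B * (th - x) + be)^-1 =
    be^-1 * (1 - B * ((th - x) / (B * (th - x) + be))).
  by move=> /den0/lt0r_neq0 h; field; apply/andP.
have iK : q.-integrable D1 (EFin \o (fun x => (B * (th - x) + be)^-1)).
  have : q.-integrable D1 (EFin \o (fun x =>
      be^-1 * (1 - B * ((th - x) / (B * (th - x) + be))))).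
    apply: integrableZl_EFin => //; apply: integrableB_EFin => //.
    exact: integrable_cst_EFin.
  by apply: eq_integrable => // x /set_mem Dx /=; rewrite -KE.
set K := \int[q]_(x in D1) (B * (th - x) + be)^-1.
have hK : be * K = 1 - B * (1 - t).
  have -> : K = \int[q]_(x in D1) (be^-1 * (1 - B * ((th - x) / (B * (th - x) + be)))).
    by apply: eq_Rintegral => x /set_mem; exact: KE.
  rewrite RintegralZl//; last first.
    by apply: integrableB_EFin => //; exact: integrable_cst_EFin.
  rewrite RintegralB//; last exact: integrable_cst_EFin.
  by rewrite RintegralZl// (Rintegral_probability_cst _ mD1 qD1) mulrA mulfV// mul1r -hN addrK.
have [x0 D1x0] : exists x, D1 x.
  apply: contrapT => no; have D10 : D1 = set0.
    by apply/seteqP; split => // x Dx; apply: no; exists x.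
  have := probability_full mD1 qD1; rewrite D10 measure0 => /eqP.
  by rewrite eq_sym onee_eq0.
have [B0|Bn0] := eqVneq B 0.
  right; exists be, th.
  have tE : t = 0.
    apply: contrapT => /eqP/tlm; rewrite B0 mul0r add0r => h.
    by rewrite h ltxx in be0.
  have iA : q.-integrable D1 (EFin \o (fun x => th - x)).
    have : q.-integrable D1 (EFin \o (fun x => be * ((th - x) / (B * (th - x) + be)))).
      exact: integrableZl_EFin.
    apply: eq_integrable => // x _ /=; rewrite B0 mul0r add0r mulrCA mulfV// mulr1.
    by [].
  split.
  - by [].
  - rewrite (@integral_setD_null _ _ _ _ setT D1)//.
    + rewrite EFin_Rintegral//; congr (_%:E).
      rewrite -[LHS]mulr1 -hN tE addr0 -RintegralZl//.
      apply: eq_Rintegral => x _; rewrite B0 mul0r add0r mulrCA mulfV// mulr1.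
      by [].
    + by rewrite setTD.
    + by apply/measurable_EFinP; exact: measurable_funB.
  - by have := hu; rewrite B0 add0r => /(congr1 (fun z => z * G)); rewrite divfK// mul1r.
  - rewrite (regular_Stieltjes rth) -EFinM lee_fin; move: hiii; rewrite B0; lra.
  - move=> h; rewrite (regular_Stieltjes rth) -EFinM {1}(hiii_eq h) B0 mul0r subr0.
    by [].
left; pose psi := th + be / B.
have psiE x : B * (th - x) + be = B * (psi - x).
  by rewrite /psi; field.
have psiKE x : D1 x -> B * (B * (th - x) + be)^-1 = (psi - x)^-1.
  move=> /den0/lt0r_neq0; rewrite psiE mulf_eq0 negb_or => /andP[_ h].
  by rewrite invfM mulrA mulfV// mul1r.
have iKpsi : q.-integrable D1 (EFin \o (fun x => (psi - x)^-1)).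
  have : q.-integrable D1 (EFin \o (fun x => B * (B * (th - x) + be)^-1)).
    exact: integrableZl_EFin.
  by apply: eq_integrable => // x /set_mem Dx /=; rewrite psiKE.
have KpsiE : \int[q]_(x in D1) (psi - x)^-1 = B * K.
  rewrite /K -RintegralZl//; apply: eq_Rintegral => x /set_mem Dx.
  by rewrite psiKE.
have hi : B - 1 = (th - psi) * (B * K) + B * t.
  have -> : (th - psi) * (B * K) = - (be * K).
    by rewrite /psi; field.
  by rewrite hK; ring.
have hii c : (t != 0 -> c = psi) -> B * (2 * m - th) = G * (B * K) + B * G * (t / (th - c)).
  move=> tc; have -> : t / (th - c) = - (t * B / be).
    have [->|/tc ->] := eqVneq t 0; first by rewrite !mul0r oppr0.
    have -> : th - psi = - (be / B) by rewrite /psi; ring.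
    by field; apply/andP.
  have uE : 2 * m - th = G * (1 - B) / be.
    have -> : 1 - B = be * (2 * m - th) / G by have := hu; lra.
    by field; apply/andP.
  have -> : K = (1 - B * (1 - t)) / be by rewrite -hK; field.
  by rewrite uE; field.
have Bpsi : B * (psi - th) = be by rewrite /psi addrAC subrr add0r mulrC divfK.
have [Bpos|Bneg] := ltP 0 B.
  have tE : t = 0.
    apply: contrapT => /eqP/tlm h.
    have : 0 <= B * (th - lm) by rewrite mulr_ge0 ?(ltW Bpos)// subr_ge0 (le_trans lmlp).
    by lra.
  have thpsi : th < psi by rewrite /psi ltrDl divr_gt0.
  exists B, t, th, psi, lp; apply: (@solH_intro m B t th psi lp (B * K)) => //.
  - rewrite (Stieltjes_right mD1 qD1); first by rewrite EFin_Rintegral ?KpsiE.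
      lra.
    by move=> x /D1D; rewrite /= in_itv/= => /andP[_ xlp]; rewrite lt_eqF//; lra.
  - by rewrite tE eqxx.
  - by apply: hii; rewrite tE eqxx.
  - by rewrite Bpsi.
  - by move=> h; rewrite Bpsi hiii_eq.
  - by apply: Or32; split => //; left.
have {}Bneg : B < 0 by rewrite lt_neqAle Bn0.
have psix0 : psi < x0.
  by have := den0 _ D1x0; rewrite psiE nmulr_rgt0// subr_lt0.
have psilp : psi < lp.
  by move: (D1D _ D1x0); rewrite /= in_itv/= => /andP[_ x0lp]; lra.
have tpsi : t != 0 -> lm = psi.
  move=> /tlm/eqP; rewrite psiE mulf_eq0 (negbTE Bn0)/= subr_eq0 => /eqP.
  by [].
exists B, t, th, psi, lm; apply: (@solH_intro m B t th psi lm (B * K)) => //.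
- rewrite (Stieltjes_left mD1 qD1 psilp); last first.
    by move=> x /den0; rewrite psiE nmulr_rgt0// subr_lt0 => h; rewrite gt_eqF.
  have xKE x : D1 x -> - B * (B * (th - x) + be)^-1 = (x - psi)^-1.
    by move=> Dx; rewrite mulNr psiKE// -invrN opprB.
  have iR : q.-integrable D1 (EFin \o (fun x => (x - psi)^-1)).
    have : q.-integrable D1 (EFin \o (fun x => - B * (B * (th - x) + be)^-1)).
      exact: integrableZl_EFin.
    by apply: eq_integrable => // x /set_mem Dx /=; rewrite xKE.
  rewrite EFin_Rintegral// -EFinN; congr (_%:E).
  have -> : \int[q]_(x in D1) (x - psi)^-1 = \int[q]_(x in D1) (- B * (B * (th - x) + be)^-1).
    by apply: eq_Rintegral => x /set_mem Dx; rewrite xKE.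
  by rewrite RintegralZl// mulNr opprK.
- by move=> /tpsi ->; split => //; rewrite lt_eqF//; lra.
- exact: hii.
- by rewrite Bpsi.
- by move=> h; rewrite Bpsi hiii_eq.
- apply: Or32; split => //; right; split => //.
  by move: denlm; rewrite psiE nmulr_rge0// subr_le0.
Qed.

Section below.
Variables (m mb : R).
Hypotheses (mbE : mb%:E = mbar G lp q) (mmb : m < mb).

Let Dlm : D lm. Proof. by rewrite /= in_itv/= lexx. Qed.
Let Dlp : D lp. Proof. by rewrite /= in_itv/= lexx andbT. Qed.

Local Notation solvable := ((exists B t th psi psis, solH G lm lp q m B t th psi psis) \/
  (exists be th, solH_lim G lp q m be th)).

Let mmb' : (m%:E < mbar G lp q)%E. Proof. by rewrite -mbE lte_fin. Qed.

(* Together with equality in (iii), the relation B + be u / G = 1 forces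
   B = G slope / V and be = G (G g - u) / V, where u = 2m - th and g = stj th;
   then B (th - lm) + be = G P / V. *)
Let V th := G - (2 * m - th) ^+ 2.
Let slope th g := 1 - (2 * m - th) * g.
Let P th g := slope th g * (th - lm) + (G * g - (2 * m - th)).

Let beta_gt0 th : regular th -> 0 < G * stj th - (2 * m - th).
Proof. by move=> /(mbar_le mbE); have := mmb; lra. Qed.

Let den_ge th x (b be c : R) : D x -> x <= th -> c <= be -> c <= b * (th - lm) + be ->
  c <= b * (th - x) + be.
Proof.
rewrite /= in_itv/= => /andP[lmx xlp] xth h1 h2.
have [b0|b0] := leP 0 b.
  have : 0 <= b * (th - x) by rewrite mulr_ge0// subr_ge0.
  by lra.
have : 0 <= b * (lm - x) by rewrite mulr_le0// ?(ltW b0)//; lra.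
by lra.
Qed.

Let ratio th g x := (V th * th - V th * x) /
  (G * (slope th g * th + (G * g - (2 * m - th))) - G * slope th g * x).

Lemma solH_of_ratio (th t : R) (D1 : set T) : regular th -> 0 < V th ->
  0 <= P th (stj th) -> measurable D1 -> D1 `<=` D -> q (~` D1) = 0%E ->
  (forall x, D1 x -> 0 < slope th (stj th) * (th - x) + (G * stj th - (2 * m - th))) ->
  q.-integrable D1 (EFin \o ratio th (stj th)) ->
  0 <= t -> (t != 0 -> P th (stj th) = 0) ->
  \int[q]_(x in D1) ratio th (stj th) x + t = 1 -> solvable.
Proof.
move=> rth V0 P0 mD1 D1D qD1 den0 iN t0 tP hN.
have b0 := beta_gt0 rth; have Vn0 := lt0r_neq0 V0; have Gn0 := lt0r_neq0 G0.
set g := stj th in P0 den0 iN tP hN b0 *.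
pose B := G * slope th g / V th; pose be := G * (G * g - (2 * m - th)) / V th.
have denE x : B * (th - x) + be =
    G * (slope th g * (th - x) + (G * g - (2 * m - th))) / V th.
  by rewrite /B /be; field.
have ratioE x : D1 x -> (th - x) / (B * (th - x) + be) = ratio th g x.
  move=> /den0/lt0r_neq0 h; rewrite denE /ratio.
  have -> : G * (slope th g * th + (G * g - (2 * m - th))) - G * slope th g * x =
    G * (slope th g * (th - x) + (G * g - (2 * m - th))) by ring.
  by field; rewrite h Gn0 Vn0.
have V2 : V th = G - (2 * m - th) ^+ 2 by [].
apply: (@solH_of_density m th B be t D1) => //.
- by rewrite divr_gt0// mulr_gt0.
- rewrite /B /be /slope; move: Vn0; rewrite V2 => Vn0; field; rewrite Vn0 Gn0.
  by [].
- rewrite /B /be /slope -/g le_eqVlt; apply/orP; left; apply/eqP.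
  by move: Vn0; rewrite V2 => Vn0; field.
- move=> _; rewrite /B /be /slope -/g.
  by move: Vn0; rewrite V2 => Vn0; field.
- by move=> x Dx; rewrite denE divr_gt0// mulr_gt0// den0.
- by rewrite denE divr_ge0 ?(ltW V0)// mulr_ge0// ltW.
- by apply: eq_integrable iN => // x /set_mem Dx /=; rewrite ratioE.
- move=> /tP h; rewrite denE (_ : _ + _ = P th g)// h mulr0 mul0r.
  by [].
- rewrite -hN; congr (_ + _); apply: eq_Rintegral => x /set_mem Dx.
  by rewrite ratioE.
Qed.

Lemma solH_of_root_or_start (a : R) : regular a -> a < 2 * m ->
  (forall th, a <= th <= 2 * m -> 0 < V th) -> 0 <= P a (stj a) ->
  (forall th, a < th <= 2 * m -> 0 < P th (stj th)) ->
  solvable \/ 0 < P a (stj a) /\ \int[q]_(x in D) ratio a (stj a) x <= 1.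
Proof.
move=> ra a2m V0 Pa P0.
pose gg th := stj (Num.max a th).
have cgg : continuous gg by exact: (continuous_stj hq ra).
have ggE th : a <= th -> gg th = stj th by move=> h; rewrite /gg max_r.
have cu : continuous (fun th : R => 2 * m - th).
  by move=> x; apply: cvgB; [exact: cvg_cst|exact: cvg_id].
have cV : continuous V.
  move=> x; apply: cvgB; first exact: cvg_cst.
  by apply: cvgM; exact: cu.
have cslope : continuous (fun th => slope th (gg th)).
  move=> x; apply: cvgB; first exact: cvg_cst.
  by apply: cvgM; [exact: cu|exact: cgg].
have cb : continuous (fun th => G * gg th - (2 * m - th)).
  move=> x; apply: cvgB; last exact: cu.
  by apply: cvgM; [exact: cvg_cst|exact: cgg].
have xle th x : a <= th -> D x -> x <= th.
  move=> ath; rewrite /= in_itv/= => /andP[_ xlp].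
  exact: le_trans xlp (le_trans ra.1 ath).
have denE th x : G * (slope th (gg th) * th + (G * gg th - (2 * m - th)))
    - G * slope th (gg th) * x =
    G * (slope th (gg th) * (th - x) + (G * gg th - (2 * m - th))) by ring.
have NE th x : V th * th - V th * x = V th * (th - x) by rewrite mulrBr.
have rr th : a <= th -> regular th by move=> h; exact: (regular_le hq ra h).
have den0 th x : a < th <= 2 * m -> D x ->
    0 < slope th (stj th) * (th - x) + (G * stj th - (2 * m - th)).
  move=> thI Dx; have ath : a <= th by case/andP: thI => /ltW.
  have h1 := P0 _ thI; have h2 := beta_gt0 (rr _ ath).
  pose c := Num.min (P th (stj th)) (G * stj th - (2 * m - th)).
  apply: (@lt_le_trans _ _ c); first by rewrite lt_min h1.
  by apply: den_ge => //; [exact: xle|rewrite ge_min lexx orbT|rewrite ge_min lexx].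
have [||||s x|s x|x|x||[s /andP[as_ s2m] Is]|[mD1 qD1 iD1 ID1]] :=
  @fraction_alternative R lm lp q (fun th => V th * th) V
    (fun th => G * (slope th (gg th) * th + (G * gg th - (2 * m - th))))
    (fun th => G * slope th (gg th)) a (2 * m) lmlp a2m.
- by move=> x; apply: cvgM; [exact: cV|exact: cvg_id].
- exact: cV.
- move=> x; apply: cvgM; first exact: cvg_cst.
  apply: cvgD; last exact: cb.
  by apply: cvgM; [exact: cslope|exact: cvg_id].
- by move=> x; apply: cvgM; [exact: cvg_cst|exact: cslope].
- move=> /[dup] sI /andP[as_ _] Dx; rewrite NE mulr_ge0 ?(ltW (V0 _ sI))// subr_ge0.
  exact: xle.
- move=> /[dup] sI /andP[/ltW as_ _] Dx; rewrite denE ggE// mulr_gt0//.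
  exact: den0.
- move=> Dx; rewrite denE ggE// mulr_ge0 ?(ltW G0)//.
  by apply: den_ge => //; [exact: xle|exact: ltW (beta_gt0 ra)].
- move=> Dx; rewrite denE ggE// => /eqP; rewrite mulf_eq0 gt_eqF//= => /eqP d0.
  rewrite NE mulr_gt0 ?V0 ?lexx ?ltW// subr_gt0 lt_neqAle xle// andbT.
  apply/eqP => xa; move: d0; rewrite xa subrr mulr0 add0r => h.
  by have := beta_gt0 ra; rewrite h ltxx.
- rewrite -[leRHS](@Rintegral_probability_cst _ _ _ q D _ (measurable_itv _) hq).
  have a2mI : a < 2 * m <= 2 * m by rewrite a2m lexx.
  have r2m := rr _ (ltW a2m).
  have dpos x : D x -> 0 < G * (slope (2 * m) (gg (2 * m)) * (2 * m - x)
      + (G * gg (2 * m) - (2 * m - 2 * m))).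
    by move=> Dx; rewrite mulr_gt0// ggE ?(ltW a2m)//; exact: den0.
  apply: le_Rintegral => //; last 2 first.
  - exact: integrable_cst_EFin.
  - move=> x Dx; have h := dpos _ Dx; rewrite denE NE ler_pdivrMr// mul1r.
    rewrite /V /slope subrr expr0n/= subr0 mul0r subr0 mul1r ler_pM2l//.
    rewrite lerDl subr0 mulr_ge0 ?(ltW G0)// ggE ?(ltW a2m)//.
    exact: ltW (stj_gt0 hq lmlp r2m).
  by apply: (@integrable_fraction R lm lp) => //; rewrite denE; exact: dpos.
- left; have sI : a < s <= 2 * m by rewrite as_.
  have rs := rr _ (ltW as_); rewrite (ggE _ (ltW as_)) in Is.
  apply: (@solH_of_ratio s 0 D) => //.
  + by apply: V0; rewrite (ltW as_).
  + exact: ltW (P0 _ sI).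
  + by move=> x; exact: den0.
  + apply: (@integrable_fraction R lm lp) => //; rewrite -(ggE _ (ltW as_)) denE
      mulr_gt0// ggE ?(ltW as_)//; exact: den0.
  + by rewrite eqxx.
  + by rewrite addr0.
rewrite (ggE _ (lexx a)) in mD1 qD1 iD1 ID1.
set D1 := _ `&` _ in mD1 qD1 iD1 ID1.
have D1D : D1 `<=` D by move=> x [].
have [Pa0|Pan] := ltP 0 (P a (stj a)).
  right; split => //; suff D1E : D1 = D by rewrite -[in leLHS]D1E.
  apply/seteqP; split => // x Dx; split => //=; rewrite -(ggE _ (lexx a)) denE mulr_gt0//.
  rewrite ggE//; pose c := Num.min (P a (stj a)) (G * stj a - (2 * m - a)).
  apply: (@lt_le_trans _ _ c); first by rewrite lt_min Pa0 (beta_gt0 ra).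
  by apply: den_ge => //; [exact: xle|rewrite ge_min lexx orbT|rewrite ge_min lexx].
left; apply: (@solH_of_ratio a (1 - \int[q]_(x in D1) ratio a (stj a) x) D1) => //.
- by apply: V0; rewrite lexx ltW.
- exact: (carried_full hq mD1 D1D qD1).
- by move=> x [_ /=]; rewrite -(ggE _ (lexx a)) denE pmulr_rgt0// ggE.
- by rewrite subr_ge0.
- by move=> _; apply/le_anti/andP.
- by rewrite addrC subrK.
Qed.

(* theta = lp is kept, and be increases from its value b1 for equality in (iii) to
   the value b2 at which the density vanishes at lm. *)
Lemma solH_at_start : regular lp -> 0 < V lp -> 0 < P lp (stj lp) ->
  G < (2 * m - lp) * (lp - lm) ->
  \int[q]_(x in D) ratio lp (stj lp) x <= 1 -> solvable.
Proof.
move=> rlp V0 P0 Gw I1; have b0 := beta_gt0 rlp.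
have Vn0 := lt0r_neq0 V0; have Gn0 := lt0r_neq0 G0.
pose b1 := G * (G * stj lp - (2 * m - lp)) / V lp.
pose b2 := G * (lp - lm) / ((2 * m - lp) * (lp - lm) - G).
pose B be := 1 - be * (2 * m - lp) / G.
have b1_gt0 : 0 < b1 by rewrite divr_gt0// mulr_gt0.
have w0 : 0 < (2 * m - lp) * (lp - lm) - G by rewrite subr_gt0.
have BE be : B be * (lp - lm) + be =
    (b2 - be) * (((2 * m - lp) * (lp - lm) - G) / G).
  by rewrite /B /b2; field; rewrite (lt0r_neq0 w0) Gn0.
have b12 : b1 < b2.
  rewrite /b1 /b2 ltr_pdivrMr// mulrAC ltr_pdivlMr// -subr_gt0.
  move: P0; rewrite /P /slope /V => P0.
  have := mulr_gt0 (mulr_gt0 G0 G0) P0.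
  by congr (0 < _); ring.
have xlp x : D x -> x <= lp by rewrite /= in_itv/= => /andP[].
have den0 be x : b1 <= be -> be < b2 -> D x -> 0 < B be * (lp - x) + be.
  move=> h1 h2 Dx; have be0 : 0 < be by exact: lt_le_trans h1.
  have h3 : 0 < B be * (lp - lm) + be.
    by rewrite BE mulr_gt0 ?subr_gt0// divr_gt0.
  pose c := Num.min (B be * (lp - lm) + be) be.
  apply: (@lt_le_trans _ _ c); first by rewrite lt_min h3.
  by apply: den_ge => //; [exact: xlp|rewrite ge_min lexx orbT|rewrite ge_min lexx].
have hiii be : b1 <= be -> G * stj lp - B be * (2 * m - lp) <= be.
  rewrite /b1 ler_pdivrMr// /B => h; rewrite -(ler_pM2l G0) -subr_ge0.
  move: h; rewrite -subr_ge0 /V; congr (0 <= _); field.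
  by [].
have denE be x : B be * lp + be - B be * x = B be * (lp - x) + be by ring.
have fracE be x : (lp - 1 * x) / (B be * lp + be - B be * x) =
    (lp - x) / (B be * (lp - x) + be).
  by rewrite denE mul1r.
have cB : continuous (fun s : R => B (- s)).
  move=> s; apply: cvgB; first exact: cvg_cst.
  apply: cvgM; last exact: cvg_cst.
  by apply: cvgM; [apply: cvgN; exact: cvg_id|exact: cvg_cst].
have [|||||s x|s x|x|x||[s /andP[as_ sb] Is]|[mD1 qD1 iD1 ID1]] :=
  @fraction_alternative R lm lp q (fun=> lp) (fun=> 1)
    (fun s => B (- s) * lp - s) (fun s => B (- s)) (- b2) (- b1) lmlp.
- by rewrite ltrN2.
- by move=> s; exact: cvg_cst.
- by move=> s; exact: cvg_cst.
- move=> s; apply: cvgB; last exact: cvg_id.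
  by apply: cvgM; [exact: cB|exact: cvg_cst].
- exact: cB.
- by move=> _ /xlp; rewrite mul1r subr_ge0.
- move=> /andP[h1 h2] Dx; rewrite denE; apply: den0 => //; lra.
- move=> Dx; rewrite denE opprK; apply: den_ge => //; [exact: xlp|lra|].
  by rewrite BE subrr mul0r.
- move=> Dx; rewrite denE opprK mul1r => d0.
  rewrite subr_gt0 lt_neqAle xlp// andbT; apply/eqP => xl.
  by move: d0; rewrite xl subrr mulr0 add0r; lra.
- apply: le_trans I1; rewrite le_eqVlt; apply/orP; left; apply/eqP.
  apply: eq_Rintegral => x /set_mem Dx; rewrite fracE opprK.
  have h := den0 _ _ (lexx b1) b12 Dx.
  have dE : B b1 * (lp - x) + b1 =
      G * (slope lp (stj lp) * (lp - x) + (G * stj lp - (2 * m - lp))) / V lp.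
    by rewrite /B /b1 /slope; move: Vn0; rewrite /V => Vn0; field; rewrite Vn0 Gn0.
  move: h; rewrite dE => /lt0r_neq0; rewrite !mulf_eq0 !negb_or => /andP[/andP[_ dn0] _].
  rewrite /ratio; have -> : G * (slope lp (stj lp) * lp + (G * stj lp - (2 * m - lp)))
    - G * slope lp (stj lp) * x =
    G * (slope lp (stj lp) * (lp - x) + (G * stj lp - (2 * m - lp))) by ring.
  by field; rewrite dn0 Gn0 Vn0.
- have h1 : b1 <= - s by lra.
  have h2 : - s < b2 by lra.
  have be0 : 0 < - s by exact: lt_le_trans h1.
  apply: (@solH_of_density m lp (B (- s)) (- s) 0 D) => //.
  + by rewrite /B subrK.
  + exact: hiii.
  + by rewrite ltxx.
  + by move=> x; exact: den0.
  + by apply: ltW; exact: den0.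
  + have : q.-integrable D (EFin \o (fun x =>
        (lp - 1 * x) / (B (- s) * lp - s - B (- s) * x))).
      by apply: (@integrable_fraction R lm lp) => //; rewrite denE; exact: den0.
    by apply: eq_integrable => // x _ /=; rewrite fracE.
  + by rewrite eqxx.
  + rewrite addr0 -[RHS]Is; apply: eq_Rintegral => x _.
    by rewrite fracE.
rewrite opprK in mD1 qD1 iD1 ID1; set D1 := _ `&` _ in mD1 qD1 iD1 ID1.
have D1D : D1 `<=` D by move=> x [].
have b2lm : B b2 * (lp - lm) + b2 = 0 by rewrite BE subrr mul0r.
pose t := 1 - \int[q]_(x in D1) ((lp - x) / (B b2 * (lp - x) + b2)).
apply: (@solH_of_density m lp (B b2) b2 t D1) => //.
- exact: lt_trans b12.
- by rewrite /B subrK.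
- exact: hiii (ltW b12).
- by rewrite ltxx.
- exact: (carried_full hq mD1 D1D qD1).
- by move=> x [_ /=]; rewrite denE.
- by rewrite b2lm.
- by apply: eq_integrable iD1 => // x _ /=; rewrite fracE.
- rewrite subr_ge0; apply: le_trans ID1; rewrite le_eqVlt; apply/orP; left; apply/eqP.
  by apply: eq_Rintegral => x _; rewrite fracE.
- by rewrite addrC subrK.
Qed.

Section strict.
Variable th' : R.
Hypotheses (lpth' : lp < th') (Gth' : G < (2 * m - th') * (th' - lm)).
Let s := Num.sqrt G.
Let s0 : 0 < s. Proof. by rewrite sqrtr_gt0. Qed.
Let sE : s * s = G. Proof. by rewrite -expr2 sqr_sqrtr// ltW. Qed.

Let lmth' : lm < th'. Proof. exact: le_lt_trans lmlp lpth'. Qed.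

Let th'm : th' < 2 * m.
Proof.
have : 0 < (2 * m - th') * (th' - lm) by exact: lt_trans G0 Gth'.
by rewrite pmulr_lgt0 subr_gt0//.
Qed.

Let sm : 2 * s < 2 * m - lm.
Proof.
have h1 := Gth'; have h2 := s0; have h3 := lmth'; have h4 := th'm.
rewrite -sE in h1; rewrite -ltr_sqr ?nnegrE; [|lra|lra].
have := sqr_ge0 ((2 * m - th') - (th' - lm)).
by rewrite !expr2; lra.
Qed.

Let P_neg p : regular p -> 2 * m - p = s -> P p (stj p) < 0.
Proof.
move=> rp ps; have h := beta_gt0 rp; rewrite /P /slope ps -sE; rewrite ps -sE in h.
have h1 := s0; have h2 := sm.
have hE : s * s * stj p - s = s * (s * stj p - 1) by ring.
rewrite hE pmulr_rgt0// in h; rewrite hE.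
have -> : (1 - s * stj p) * (p - lm) + s * (s * stj p - 1) =
  - ((s * stj p - 1) * (p - lm - s)) by ring.
by rewrite oppr_lt0 mulr_gt0//; lra.
Qed.

Lemma below_start : exists p, [/\ regular p, 2 * m - s <= p, p < 2 * m &
  lp < p -> P p (stj p) <= 0].
Proof.
have h1 := s0; have h2 := sm; have h3 := lpth'; have h4 := th'm.
have [lps|slp] := ltP lp (2 * m - s).
  have rp := regular_gt hq lps.
  exists (2 * m - s); split => //; first by lra.
  by move=> _; apply/ltW/P_neg => //; ring.
pose de := (2 * m - th') * (th' - lm) - G.
have de0 : 0 < de by rewrite subr_gt0.
have e0 : 0 < th' - lp by rewrite subr_gt0.
have [p [rp ple pC]] := regular_start hq lmlp ((2 * m - lm) / de) e0.
have lpp := rp.1; exists p; split => //; [lra|lra|].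
move=> /pC; rewrite ler_pdivrMr// => h5.
have g0 := stj_gt0 hq lmlp rp.
have h6 : de <= (2 * m - p) * (p - lm) - G.
  rewrite /de lerD2r -subr_ge0.
  have -> : (2 * m - p) * (p - lm) - (2 * m - th') * (th' - lm) =
    (th' - p) * (th' + p - 2 * m - lm) by ring.
  by rewrite mulr_ge0//; lra.
have := ler_wpM2l (ltW g0) h6.
rewrite /P /slope => h7.
have -> : (1 - (2 * m - p) * stj p) * (p - lm) + (G * stj p - (2 * m - p)) =
  2 * p - lm - 2 * m - stj p * ((2 * m - p) * (p - lm) - G) by ring.
by lra.
Qed.

Lemma solH_below : solvable.
Proof.
have [p [rp sp pm Pp]] := below_start.
pose f th := P th (stj (Num.max p th)).
have fE th : p <= th -> f th = P th (stj th) by move=> h; rewrite /f max_r.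
have cf : continuous f.
  have cgg : continuous (fun th => stj (Num.max p th)) by exact: (continuous_stj hq rp).
  have cu : continuous (fun th : R => 2 * m - th).
    by move=> x; apply: cvgB; [exact: cvg_cst|exact: cvg_id].
  move=> x; apply: cvgD; last first.
    by apply: cvgB; [apply: cvgM; [exact: cvg_cst|exact: cgg]|exact: cu].
  apply: cvgM; last by apply: cvgB; [exact: cvg_id|exact: cvg_cst].
  by apply: cvgB; [exact: cvg_cst|apply: cvgM; [exact: cu|exact: cgg]].
have rge th : p <= th -> regular th by move=> h; exact: (regular_le hq rp h).
have f2m : 0 < f (2 * m).
  rewrite fE ?(ltW pm)// /P /slope subrr mul0r !subr0 mul1r.
  have := mulr_gt0 G0 (stj_gt0 hq lmlp (rge _ (ltW pm))).
  by have h2 := sm; have h1 := s0; lra.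
have V0 th a : p <= a -> 0 <= P a (stj a) -> a <= th <= 2 * m -> 0 < V th.
  move=> pa Pa /andP[ath thm].
  have : 2 * m - th != s.
    apply/eqP => ths; have thp : a = p by apply/le_anti; rewrite pa andbT; lra.
    move: Pa; rewrite leNgt => /negP; apply; rewrite thp; apply: P_neg => //.
    by apply/le_anti; apply/andP; split; lra.
  move=> ne; have hs : 2 * m - th < s by rewrite lt_neqAle ne/=; lra.
  rewrite /V subr_gt0 -sE -expr2 ltr_sqr ?nnegrE//; [lra|exact: ltW].
have [[x /andP[px xm] fx]|no] := pselect (exists2 x, p <= x <= 2 * m & f x <= 0).
  have [c [xc cm fc pos]] := last_root cf xm fx f2m.
  have pc := le_trans px xc; rewrite (fE _ pc) in fc.
  have Pc : 0 <= P c (stj c) by rewrite fc.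
  have [||//|[]] := solH_of_root_or_start (rge _ pc) cm _ Pc.
  - by move=> th; apply: V0.
  - move=> th /[dup] /andP[cth _] /pos; rewrite fE//.
    exact: le_trans pc (ltW cth).
  - by rewrite fc ltxx.
have pos th : p <= th <= 2 * m -> 0 < P th (stj th).
  move=> /[dup] /andP[pth _] thI; rewrite -fE// ltNge; apply/negP => h.
  by apply: no; exists th.
have Pp0 : 0 < P p (stj p) by apply: pos; rewrite lexx ltW.
have plp : p = lp.
  by apply/le_anti; rewrite rp.1 andbT leNgt; apply/negP => /Pp; rewrite leNgt Pp0.
have VV th : p <= th <= 2 * m -> 0 < V th by apply: V0 => //; exact: ltW.
have [th /andP[pth thm]|//|[_ I1]] := solH_of_root_or_start rp pm VV (ltW Pp0).
  by apply: pos; rewrite (ltW pth).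
rewrite plp in rp sp pm Pp0 VV I1.
apply: solH_at_start => //; first by apply: VV; rewrite lexx ltW.
have h1 := Gth'; have h2 := sm; have h3 := lpth'; apply: (lt_le_trans h1).
rewrite -subr_ge0.
have -> : (2 * m - lp) * (lp - lm) - (2 * m - th') * (th' - lm) =
  (th' - lp) * (th' + lp - 2 * m - lm) by ring.
by rewrite mulr_ge0//; lra.
Qed.

End strict.

End below.

Lemma Hent_dominates (nu : {finite_measure set T -> \bar R}) :
  ((2^-1)%:E * Hent q nu < +oo)%E -> q `<< nu.
Proof.
rewrite /Hent; case: asboolP => // _.
by rewrite gt0_muley ?ltxx// lte_fin invr_gt0.
Qed.

Lemma rateH_lt_pinfty (m : R) : (rateH G lm lp q m < +oo)%E ->
  exists nu : probability T R,
    [/\ carried_by lm lp nu, m%:E = Ffun G lp nu & q `<< nu].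
Proof. by move=> /ereal_inf_lt[_ [nu [nu1 nu2] <-] /Hent_dominates qnu]; exists nu. Qed.

Lemma rateG_lt_pinfty (m : R) : (rateG G lm lp q m < +oo)%E ->
  exists nu : {finite_measure set T -> \bar R},
    [/\ carried_by lm lp nu, m%:E = Ffun G lp nu & q `<< nu].
Proof. by move=> /ereal_inf_lt[_ [nu [nu1 nu2] <-] /Hent_dominates qnu]; exists nu. Qed.

Lemma dirac_of_Rintegral_le0 (nu : {finite_measure set T -> \bar R}) (f : T -> R) (a : R) :
  carried_by lm lp nu -> nu.-integrable D (EFin \o f) ->
  (forall x, D x -> 0 <= f x) -> (forall x, D x -> x != a -> 0 < f x) ->
  \int[nu]_(x in D) f x <= 0 -> nu (~` [set a]) = 0%E.
Proof.
move=> hnu intf f0 fpos If.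
have mf : measurable_fun D (EFin \o f) by exact: measurable_int intf.
have mD : measurable D by exact: measurable_itv.
have ms : measurable (~` [set a] : set T) by apply: measurableC; exact: measurable_set1.
apply/(negligibleP _ ms).
have nD : nu.-negligible (~` D) by apply/(negligibleP _ (measurableC mD)).
have : ae_eq nu D (EFin \o f) (cst 0%E).
  apply/ae_eq_integral_abs => //; rewrite (eq_integral (EFin \o f)); last first.
    by move=> x /set_mem Dx; rewrite /= ger0_norm// f0.
  apply/eqP; rewrite eq_le; apply/andP; split; last first.
    by apply: integral_ge0 => x Dx; rewrite lee_fin f0.
  by rewrite EFin_Rintegral// lee_fin.
move=> nf; apply: negligibleS (negligibleU nD nf) => x /= /eqP xa.
have [Dx|] := pselect (D x); last by left.
right => /(_ Dx) -[] fx; have := fpos _ Dx.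
by move: xa => /eqP /eqP xa /(_ xa); rewrite fx ltxx.
Qed.

Lemma resolvent_dirac (nu : probability T R) (a th : R) : carried_by lm lp nu ->
  lp < th -> nu (~` [set a]) = 0%E -> resolvent lm lp nu th = (th - a)^-1.
Proof.
move=> hnu lpth nua; have ms : measurable [set a : T] by exact: measurable_set1.
suff : (resolvent lm lp nu th)%:E = ((th - a)^-1)%:E by case.
apply: etrans (esym (integral_resolvent hnu lpth)) _.
have mr : measurable_fun [set: T] (fun x : T => ((th - x)^-1)%:E).
  by apply/measurable_EFinP; exact: measurable_resolvent.
have nua' : nu (setT `\` [set a]) = 0%E by rewrite setTD.
apply: etrans (integral_setD_null measurableT ms (@subsetT _ _) nua' mr) _.
rewrite (eq_integral (cst ((th - a)^-1)%:E)); last by move=> x /set_mem ->.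
by rewrite integral_cst// [X in (_ * X)%E](probability_full ms nua) mule1.
Qed.

Lemma mbar_concentrated (nu : probability T R) (m a : R) : carried_by lm lp nu ->
  m%:E = Ffun G lp nu -> q `<< nu -> nu (~` [set a]) = 0%E -> m%:E = mbar G lp q.
Proof.
move=> hnu mF qnu nua.
have ms : measurable (~` [set a] : set T) by apply: measurableC; exact: measurable_set1.
have qa : q (~` [set a]) = 0%E by move/null_content_dominatesP: qnu; apply.
have rE th : lp < th -> resolvent lm lp q th = resolvent lm lp nu th.
  by move=> h; rewrite (@resolvent_dirac q a)// (@resolvent_dirac nu a).
have [h1 h2] := (FfunP hnu G m).1 mF.
apply/(FfunP hq); split => [th lpth|e e0]; first by rewrite rE// h1.
by have [th lpth h] := h2 _ e0; exists th; rewrite ?rE.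
Qed.

Lemma above_strict (nu : probability T R) (m : R) : carried_by lm lp nu ->
  m%:E = Ffun G lp nu -> lp < 2 * m -> nu (~` [set lp]) <> 0%E ->
  (2 * m - lp) ^+ 2 < 4 * G.
Proof.
move=> hnu mF lpm nua; pose s := Num.sqrt G.
have s0 : 0 < s by rewrite sqrtr_gt0.
have sE : s * s = G by rewrite -expr2 sqr_sqrtr// ltW.
have lpth : lp < lp + s by rewrite ltrDl.
have mD : measurable D by exact: measurable_itv.
have ic : nu.-integrable D (EFin \o (fun=> s^-1)) by exact: integrable_cst_EFin.
have iJ := integrable_resolvent nu lpth mD (@subset_refl _ D).
have J_lt : resolvent lm lp nu (lp + s) < s^-1.
  rewrite ltNge; apply/negP => h; apply: nua.
  have cmp x : D x -> 0 < lp + s - x /\ s <= lp + s - x.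
    by rewrite /= in_itv/= => /andP[_ xlp]; split; lra.
  apply: (@dirac_of_Rintegral_le0 nu (fun x => s^-1 - (lp + s - x)^-1)) => //.
  - exact: integrableB_EFin.
  - by move=> x /cmp[h1 h2]; rewrite subr_ge0 lef_pV2.
  - move=> x Dx xlp; have [h1 h2] := cmp _ Dx; rewrite subr_gt0 ltf_pV2//.
    move: Dx; rewrite /= in_itv/= => /andP[_ xlp'].
    have : x < lp by rewrite lt_neqAle xlp.
    by lra.
  - rewrite RintegralB// (@Rintegral_probability_cst _ _ _ nu D _ mD hnu) subr_le0.
    exact: h.
have := ((FfunP hnu G m).1 mF).1 _ lpth.
have := J_lt; rewrite -(ltr_pM2l G0) -{2}sE mulfK ?gt_eqF// => h1 h2.
rewrite -sE (_ : 4 * (s * s) = (2 * s) ^+ 2); last by ring.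
by rewrite ltr_sqr ?nnegrE; lra.
Qed.

Lemma below_strict (nu : probability T R) (m : R) : carried_by lm lp nu ->
  m%:E = Ffun G lp nu -> nu (~` [set lm]) <> 0%E ->
  exists2 th, lp < th & G < (2 * m - th) * (th - lm).
Proof.
move=> hnu mF nua.
have mD : measurable D by exact: measurable_itv.
have ilin : nu.-integrable D (EFin \o (fun x => x - lm)).
  have : nu.-integrable D (EFin \o (fun x => (- lm - (-1) * x) / (1 - 0 * x))).
    by apply: (@integrable_fraction R lm lp) => //; rewrite mul0r subr0.
  apply: eq_integrable => // x _ /=.
  by rewrite mul0r subr0 divr1 mulN1r opprK addrC.
pose ka := \int[nu]_(x in D) (x - lm).
have ka0 : 0 < ka.
  rewrite ltNge; apply/negP => h; apply: nua.
  apply: (@dirac_of_Rintegral_le0 nu (fun x => x - lm)) => //.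
  - by move=> x; rewrite /= in_itv/= subr_ge0 => /andP[].
  - by move=> x; rewrite /= in_itv/= subr_gt0 lt_neqAle => /andP[-> _]; rewrite eq_sym => ->.
pose M := `|2 * m + 1 - lm| + 1.
have M0 : 0 < M by rewrite ltr_wpDl.
pose e := Num.min 1 (G * ka / M / M / 2).
have e0 : 0 < e by rewrite lt_min ltr01/= !divr_gt0// mulr_gt0.
have e1 : e <= 1 by rewrite ge_min lexx.
have eM : e * M < G * ka / M.
  have : 0 < G * ka / M by rewrite divr_gt0// mulr_gt0.
  have : e * M <= G * ka / M / M / 2 * M by rewrite ler_pM2r// ge_min lexx orbT.
  have -> : G * ka / M / M / 2 * M = G * ka / M / 2 by field; rewrite gt_eqF.
  by lra.
have [th lpth hth] := ((FfunP hnu G m).1 mF).2 _ e0.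
have iJ := integrable_resolvent nu lpth mD (@subset_refl _ D).
exists th => //.
have thx x : D x -> 0 < th - x.
  by rewrite /= in_itv/= => /andP[_ xlp]; lra.
have J0 : 0 <= resolvent lm lp nu th.
  by apply: Rintegral_ge0 => x /thx h; rewrite invr_ge0 ltW.
have thM : th - lm <= M.
  have := mulr_ge0 (ltW G0) J0; have := ler_norm (2 * m + 1 - lm); rewrite /M; lra.
have thlm : 0 < th - lm by have := lmlp; lra.
have hJ : 1 + ka / M <= (th - lm) * resolvent lm lp nu th.
  rewrite /resolvent -RintegralZl// /ka mulrC -RintegralZl//.
  rewrite -[X in X + _](@Rintegral_probability_cst _ _ _ nu D _ mD hnu) -RintegralD//; last 2 first.
  - exact: integrable_cst_EFin.
  - exact: integrableZl_EFin.
  apply: le_Rintegral => //.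
  - by apply: integrableD_EFin => //; [exact: integrable_cst_EFin|exact: integrableZl_EFin].
  - exact: integrableZl_EFin.
  move=> x Dx; have h := thx _ Dx.
  have -> : (th - lm) * (th - x)^-1 = 1 + (th - x)^-1 * (x - lm).
    by field; rewrite gt_eqF.
  have xlm : 0 <= x - lm by move: Dx; rewrite /= in_itv/= subr_ge0 => /andP[].
  rewrite lerD2l ler_wpM2r// lef_pV2 ?posrE//; lra.
have h1 := ler_wpM2l (ltW thlm) hth; have h2 := ler_wpM2l (ltW G0) hJ.
have h3 := ler_wpM2l (ltW e0) thM.
have h4 : G * (1 + ka / M) = G + G * ka / M by ring.
rewrite h4 in h2; lra.
Qed.

Lemma mass_strict (nu : {finite_measure set T -> \bar R}) (m : R) :
  carried_by lm lp nu -> m%:E = Ffun G lp nu -> q `<< nu -> lp < 2 * m.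
Proof.
move=> hnu mF qnu.
have mD : measurable D by exact: measurable_itv.
pose n := fine (nu D).
have n0 : 0 < n.
  rewrite fine_gt0// lt0e measure_ge0 andbT ltey_eq fin_num_measure// andbT.
  apply/eqP => nuD; have nuT : nu setT = 0%E.
    by rewrite -(setUv D) measureU0//; exact: measurableC.
  have : q setT = 0%E by move/null_content_dominatesP: qnu; apply.
  by rewrite probability_setT => /eqP; rewrite onee_eq0.
pose M := `|2 * m + 1 - lm| + 1.
have M0 : 0 < M by rewrite ltr_wpDl.
pose e := Num.min 1 (G * n / M).
have e0 : 0 < e by rewrite lt_min ltr01/= divr_gt0// mulr_gt0.
have e1 : e <= 1 by rewrite ge_min lexx.
have eM : e <= G * n / M by rewrite ge_min lexx orbT.
have [th lpth hth] := ((FfunP hnu G m).1 mF).2 _ e0.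
have iJ := integrable_resolvent nu lpth mD (@subset_refl _ D).
have thx x : D x -> 0 < th - x.
  by rewrite /= in_itv/= => /andP[_ xlp]; lra.
have J0 : 0 <= resolvent lm lp nu th.
  by apply: Rintegral_ge0 => x /thx h; rewrite invr_ge0 ltW.
have thM : th - lm <= M.
  have := mulr_ge0 (ltW G0) J0; have := ler_norm (2 * m + 1 - lm); rewrite /M; lra.
have hJ : M^-1 * n <= resolvent lm lp nu th.
  have <- : \int[nu]_(x in D) M^-1 = M^-1 * n by rewrite Rintegral_cst.
  apply: le_Rintegral => //; first exact: integrable_cst_EFin.
  move=> x Dx; have h := thx _ Dx; rewrite lef_pV2 ?posrE//.
  by move: Dx; rewrite /= in_itv/= => /andP[lmx _]; lra.
have h2 := ler_wpM2l (ltW G0) hJ.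
have h3 : G * (M^-1 * n) = G * n / M by ring.
by rewrite h3 in h2; lra.
Qed.

End existence.

Theorem proposition1p10 (R : realType) (Gamma lm lp : R)
    (q : probability (measurableTypeR R) R)
    (hGamma : 0 < Gamma) (hl : lm <= lp) (hq : carried_by lm lp q) :
  (qplus q = lp -> qminus q = lm ->
   forall m : R,
     (forall B t th psi psis : R,
        solH Gamma lm lp q m B t th psi psis ->
        rateH Gamma lm lp q m = valH q B th psi) /\
     (forall be th : R,
        solH_lim Gamma lp q m be th ->
        rateH Gamma lm lp q m = valH_lim q be th) /\
     ((rateH Gamma lm lp q m < +oo)%E ->
        (exists B t th psi psis : R, solH Gamma lm lp q m B t th psi psis) \/
        (exists be th : R, solH_lim Gamma lp q m be th))) /\
  (forall m : R,
     (forall t th psi : R,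
        solG Gamma lp q m t th psi ->
        rateG Gamma lm lp q m = valG lp q t th psi) /\
     ((rateG Gamma lm lp q m < +oo)%E ->
        exists t th psi : R, solG Gamma lp q m t th psi)).
Proof.
  (* your proof *)
Proof.
have [mb mbE] := mbar_real hq hGamma.
split => [_ _ m|m].
  split; first by move=> B t th psi psis; exact: solH_rateH.
  split; first by move=> be th; exact: solH_lim_rateH.
  move=> /rateH_lt_pinfty[nu [hnu mF qnu]].
  have strict a : m <> mb -> nu (~` [set a]) <> 0%E.
    move=> ne nua; apply: ne.
    have := mbar_concentrated hq hnu mF qnu nua.
    by rewrite -mbE => -[].
  have [mmb|mbm|mE] := ltgtP m mb; last first.
  - by left; apply: (solH_mbar hq hl hGamma); rewrite mE.
  - left; apply: (solH_above hq hl hGamma mbE mbm).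
    apply: (above_strict hGamma hnu mF (lp_lt_2m hq hl hGamma mbE mbm)).
    by apply: strict => /eqP; rewrite gt_eqF.
  have [|th' lpth' Gth'] := below_strict hl hGamma hnu mF.
    by apply: strict => /eqP; rewrite lt_eqF.
  exact: (solH_below hq hl hGamma mbE mmb lpth' Gth').
split; first by move=> t th psi; exact: solG_rateG.
move=> /rateG_lt_pinfty[nu [hnu mF qnu]].
have [mmb|mbm|mE] := ltgtP m mb; last first.
- by apply: (solG_mbar hq hl hGamma); rewrite mE.
- exact: (solG_above hq hl hGamma mbE mbm).
apply: (solG_below hq hl hGamma mbE mmb).
exact: (mass_strict hGamma hnu mF qnu).
Qed.
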